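(* Let $A$ be a non-positive DG-ring, with the natural map of DG-rings $\pi_A : A \to \mathrm{H}^0(A)$. Then the following hold: (1) For the reduction functor $F = \mathrm{H}^0(A)\otimes^{\mathrm{L}}_A - : \mathsf{D}(A) \to \mathsf{D}(\mathrm{H}^0(A))$, the following are equivalent: $F$ is full; $F$ is faithful; $A \cong \mathrm{H}^0(A)$ (i.e. $A$ is equivalent to the underlying ring $\mathrm{H}^0(A)$). (2) For the coreduction functor $G = \mathrm{R}\operatorname{Hom}_A(\mathrm{H}^0(A),-) : \mathsf{D}(A) \to \mathsf{D}(\mathrm{H}^0(A))$, the following are equivalent: $G$ is full; $G$ is faithful; $A \cong \mathrm{H}^0(A)$ (i.e. $A$ is equivalent to the underlying ring $\mathrm{H}^0(A)$). (3) The forgetful functor $S : \mathsf{D}(\mathrm{H}^0(A)) \to \mathsf{D}(A)$ is full if and only if $A \cong \mathrm{H}^0(A)$ (i.e. $A$ is equivalent to the underlying ring $\mathrm{H}^0(A)$). (4) There exists a DG-ring $A$ which is not equivalent to the underlying ring $\mathrm{H}^0(A)$ such that the forgetful functor $\mathsf{D}(\mathrm{H}^0(A)) \to \mathsf{D}(A)$ is faithful, and there exists a DG-ring $A$ which is not equivalent to the underlying ring $\mathrm{H}^0(A)$ such that the forgetful functor $\mathsf{D}(\mathrm{H}^0(A)) \to \mathsf{D}(A)$ is not faithful. In both cases, such an $A$ can be found which is moreover a commutative noetherian DG-ring with bounded cohomology.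
   Context: Gradings are cohomological. A non-positive DG-ring $A = \bigoplus_{n=-\infty}^0 A^n$ is a graded (unital, associative) ring with a differential $d : A \to A$ of degree $+1$ satisfying the graded Leibniz rule; all DG-rings here are non-positive. $\mathrm{H}^0(A)$ is an ordinary ring, and there is a natural map of DG-rings $\pi_A : A \to \mathrm{H}^0(A)$. $\mathsf{D}(A)$ is the unbounded derived category of (left) DG-modules over $A$. The forgetful functor $S : \mathsf{D}(\mathrm{H}^0(A)) \to \mathsf{D}(A)$ is restriction of scalars along $\pi_A$; one has an adjoint triple $F \dashv S \dashv G$. ''$A \cong \mathrm{H}^0(A)$'' / ''$A$ is equivalent to the ring $\mathrm{H}^0(A)$'' means that $\pi_A$ is a quasi-isomorphism, i.e. $\mathrm{H}^n(A) = 0$ for all $n < 0$. A DG-ring $A$ is commutative if it is graded-commutative and every homogeneous element $a$ of odd degree satisfies $a^2 = 0$. A commutative DG-ring $A$ is noetherian if $\mathrm{H}^0(A)$ is a noetherian ring and each $\mathrm{H}^n(A)$ is a finitely generated $\mathrm{H}^0(A)$-module. $A$ has bounded cohomology if $\mathrm{H}^n(A) = 0$ for all $n \ll 0$. *)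

(* Defs.v *)
From HB Require Import structures.
From mathcomp Require Import all_boot all_order all_algebra.
From mathcomp Require Import generic_quotient boolp functions.

Set Implicit Arguments.
Unset Strict Implicit.
Unset Printing Implicit Defensive.

Import Order.TTheory GRing.Theory Num.Theory.
Local Open Scope ring_scope.
Local Open Scope quotient_scope.

(* Gradings are internal: a graded group is an abelian group V together with
   the projections cmp n : V -> V onto its homogeneous summands V^n. *)

Record dgstruct (V : zmodType) := DGStruct {
  cmp : int -> V -> V;
  dif : V -> V;
  cmpD : forall n, {morph cmp n : x y / x + y};
  cmp_cmp : forall m n x, cmp m (cmp n x) = if m == n then cmp n x else 0;
  cmp_sum : forall x, exists s : seq int, uniq s /\ x = \sum_(n <- s) cmp n x;
  difD : {morph dif : x y / x + y};
  dif_cmp : forall n x, cmp (n + 1) (dif x) = dif (cmp n x);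
  dif_dif : forall x, dif (dif x) = 0
}.

Definition homog (V : zmodType) (s : dgstruct V) (n : int) (x : V) : Prop :=
  cmp s n x = x.
Definition cocycle (V : zmodType) (s : dgstruct V) (n : int) (x : V) : Prop :=
  homog s n x /\ dif s x = 0.
Definition coboundary (V : zmodType) (s : dgstruct V) (n : int) (x : V) : Prop :=
  exists2 y, homog s (n - 1) y & x = dif s y.

(* H^n = 0 *)
Definition coh_zero (V : zmodType) (s : dgstruct V) (n : int) : Prop :=
  forall x, cocycle s n x -> coboundary s n x.
Definition acyclic (V : zmodType) (s : dgstruct V) : Prop :=
  forall n, coh_zero s n.

(* H^n(f) is injective and surjective for every n. *)
Definition quasi_iso (V W : zmodType) (s : dgstruct V) (t : dgstruct W)
    (f : V -> W) : Prop :=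
  forall n,
    (forall x, cocycle s n x -> coboundary t n (f x) -> coboundary s n x) /\
    (forall y, cocycle t n y ->
       exists2 x, cocycle s n x & coboundary t n (y - f x)).

Section DGStructTheory.
Variables (V : zmodType) (s : dgstruct V).

Lemma cmp_morph n : zmod_morphism (cmp s n).
Proof.
have c0 : cmp s n 0 = 0.
  by apply: (addrI (cmp s n 0)); rewrite -cmpD !addr0.
have cN x : cmp s n (- x) = - cmp s n x.
  by apply/eqP; rewrite -addr_eq0 -cmpD addNr c0.
by move=> x y; rewrite cmpD cN.
Qed.

Lemma dif_morph : zmod_morphism (dif s).
Proof.
have c0 : dif s 0 = 0.
  by apply: (addrI (dif s 0)); rewrite -difD !addr0.
have cN x : dif s (- x) = - dif s x.
  by apply/eqP; rewrite -addr_eq0 -difD addNr c0.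
by move=> x y; rewrite difD cN.
Qed.

HB.instance Definition _ n :=
  GRing.isZmodMorphism.Build V V (cmp s n) (cmp_morph n).
HB.instance Definition _ := GRing.isZmodMorphism.Build V V (dif s) dif_morph.

Lemma homog_cmp n x : homog s n (cmp s n x).
Proof. by rewrite /homog cmp_cmp eqxx. Qed.

Lemma homog_neq m n x : homog s n x -> m != n -> cmp s m x = 0.
Proof. by move=> hx /negPf mn; rewrite -hx cmp_cmp mn. Qed.

Lemma homog_dif n x : homog s n x -> homog s (n + 1) (dif s x).
Proof. by move=> hx; rewrite /homog dif_cmp hx. Qed.

Lemma homogD n x y : homog s n x -> homog s n y -> homog s n (x + y).
Proof. by rewrite /homog raddfD /= => -> ->. Qed.

Lemma homogN n x : homog s n x -> homog s n (- x).
Proof. by rewrite /homog raddfN /= => ->. Qed.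

Lemma dif_cmpE n x : cmp s n (dif s x) = dif s (cmp s (n - 1) x).
Proof. by rewrite -dif_cmp subrK. Qed.

Lemma homog_ind (P : V -> Prop) :
  P 0 -> (forall x y, P x -> P y -> P (x + y)) ->
  (forall n x, homog s n x -> P x) -> forall x, P x.
Proof.
move=> P0 PD Ph x; have [r [_ ->]] := cmp_sum s x.
by elim/big_ind: _ => // n _; apply: (Ph n); apply: homog_cmp.
Qed.

End DGStructTheory.

Record dgring := DGRing {
  dgr_ring :> pzRingType;
  dgr_st : dgstruct dgr_ring;
  dgr_1 : homog dgr_st 0 1;
  dgr_mul : forall i j a b,
    homog dgr_st i a -> homog dgr_st j b -> homog dgr_st (i + j) (a * b);
  dgr_leibniz : forall i a b, homog dgr_st i a ->
    dif dgr_st (a * b) =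
      dif dgr_st a * b + (-1) ^+ `|i|%N * (a * dif dgr_st b);
  dgr_nonpos : forall n a, 0 < n -> cmp dgr_st n a = 0
}.

Record dgmod (A : dgring) := DGMod {
  dgm_mod :> lmodType A;
  dgm_st : dgstruct dgm_mod;
  dgm_scale : forall i j (a : A) (m : dgm_mod),
    homog (dgr_st A) i a -> homog dgm_st j m -> homog dgm_st (i + j) (a *: m);
  dgm_leibniz : forall i (a : A) (m : dgm_mod), homog (dgr_st A) i a ->
    dif dgm_st (a *: m) =
      dif (dgr_st A) a *: m + (-1) ^+ `|i|%N *: (a *: dif dgm_st m)
}.

Record dgrhom (A B : dgring) := DGRHom {
  drh :> A -> B;
  drhD : {morph drh : x y / x + y};
  drhM : {morph drh : x y / x * y};
  drh1 : drh 1 = 1;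
  drh_cmp : forall n x, drh (cmp (dgr_st A) n x) = cmp (dgr_st B) n (drh x);
  drh_dif : forall x, drh (dif (dgr_st A) x) = dif (dgr_st B) (drh x)
}.

Lemma drh0 (A B : dgring) (phi : dgrhom A B) : phi 0 = 0.
Proof. by apply: (addrI (phi 0)); rewrite -drhD !addr0. Qed.

Record dghom (A : dgring) (M N : dgmod A) := DGHom {
  dmh :> M -> N;
  dmhD : {morph dmh : x y / x + y};
  dmhZ : forall (a : A) x, dmh (a *: x) = a *: dmh x;
  dmh_cmp : forall n x, dmh (cmp (dgm_st M) n x) = cmp (dgm_st N) n (dmh x);
  dmh_dif : forall x, dmh (dif (dgm_st M) x) = dif (dgm_st N) (dmh x)
}.

Definition dghom_id (A : dgring) (M : dgmod A) : dghom M M.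
Proof. by exists id. Defined.

Definition dghom_comp (A : dgring) (M N P : dgmod A)
  (g : dghom N P) (f : dghom M N) : dghom M P.
Proof.
exists (g \o f) => [x y|a x|n x|x] /=.
- by rewrite !dmhD.
- by rewrite !dmhZ.
- by rewrite !dmh_cmp.
- by rewrite !dmh_dif.
Defined.

Lemma scale_sign (R : pzRingType) (V : lmodType R) k (x : V) :
  (-1) ^+ k *: x = if odd k then - x else x.
Proof.
by rewrite -signr_odd; case: (odd k); rewrite (expr1, expr0) ?scaleN1r ?scale1r.
Qed.

Section DGTheory.
Variable A : dgring.
Local Notation sA := (dgr_st A).

Lemma dgr_homog_pos n (a : A) : 0 < n -> homog sA n a -> a = 0.
Proof. by move=> n0 <-; rewrite dgr_nonpos. Qed.

Lemma cmp0M (a b : A) : cmp sA 0 (a * b) = cmp sA 0 a * cmp sA 0 b.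
Proof.
elim/(homog_ind (s := sA)): a => [|a a' IH IH'|i a ha].
- by rewrite mul0r raddf0 mul0r.
- by rewrite mulrDl !raddfD /= IH IH' mulrDl.
elim/(homog_ind (s := sA)): b => [|b b' IH IH'|j b hb].
- by rewrite mulr0 raddf0 mulr0.
- by rewrite mulrDr !raddfD /= IH IH' mulrDr.
have hab := dgr_mul ha hb.
have [i0|i0] := eqVneq i 0; have [j0|j0] := eqVneq j 0.
- by move: ha hb hab; rewrite i0 j0 addr0 => -> -> ->.
- by rewrite (homog_neq hb) 1?eq_sym // mulr0 (homog_neq hab) // i0 add0r eq_sym.
- by rewrite (homog_neq ha) 1?eq_sym // mul0r (homog_neq hab) // j0 addr0 eq_sym.
rewrite (homog_neq ha) 1?eq_sym // mul0r.
have [i_gt0|i_le0] := ltP 0 i.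
  by rewrite (dgr_homog_pos i_gt0 ha) mul0r raddf0.
have [j_gt0|j_le0] := ltP 0 j.
  by rewrite (dgr_homog_pos j_gt0 hb) mulr0 raddf0.
rewrite (homog_neq hab) // gt_eqF //.
by rewrite -[0]addr0 ltr_leD // lt_neqAle i0.
Qed.

Lemma dif_homog0 (a : A) : homog sA 0 a -> dif sA a = 0.
Proof.
by move=> /homog_dif; rewrite add0r; apply: dgr_homog_pos.
Qed.

Lemma dgm_cmpZ (M : dgmod A) i (a : A) n (x : M) : homog sA i a ->
  cmp (dgm_st M) (i + n) (a *: x) = a *: cmp (dgm_st M) n x.
Proof.
move=> ha; elim/(homog_ind (s := dgm_st M)): x => [|x y IH IH'|j x hx].
- by rewrite !(scaler0, raddf0).
- by rewrite !(scalerDr, raddfD) /= IH IH'.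
have hax := dgm_scale ha hx.
have [<-|nj] := eqVneq j n; first by rewrite hx hax.
rewrite (homog_neq hx) 1?eq_sym // scaler0 (homog_neq hax) //.
by rewrite (inj_eq (addrI i)) eq_sym.
Qed.

End DGTheory.

Section ClassicalQuotient.
Variables (T : choiceType) (R : T -> T -> Prop).
Hypotheses (Rr : forall x, R x x) (Rs : forall x y, R x y -> R y x)
           (Rt : forall x y z, R x y -> R y z -> R x z).

Let e : rel T := fun x y => `[< R x y >].
Let er : reflexive e. Proof. by move=> x; apply/asboolP. Qed.
Let es : symmetric e.
Proof. by move=> x y; apply/asboolP/asboolP; apply: Rs. Qed.
Let et : transitive e.
Proof. by move=> y x z /asboolP xy /asboolP yz; apply/asboolP/(Rt xy). Qed.

Definition cquot_equiv : equiv_rel T := EquivRel e er es et.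
Definition cquot : Type := {eq_quot cquot_equiv}.
HB.instance Definition _ := Choice.on cquot.
Definition cls (x : T) : cquot := \pi_{eq_quot cquot_equiv}%qT x.
Definition rep (c : cquot) : T := repr (c : {eq_quot cquot_equiv}).

Lemma clsP x y : cls x = cls y <-> R x y.
Proof. by split=> [/eqquotP/asboolP//|xy]; apply/eqquotP/asboolP. Qed.

Lemma repK : cancel rep cls. Proof. exact: reprK. Qed.

Lemma rep_cls x : R (rep (cls x)) x.
Proof. by apply/clsP; rewrite repK. Qed.

Lemma cls_surj c : exists x, c = cls x.
Proof. by exists (rep c); rewrite repK. Qed.

End ClassicalQuotient.

(* H^0(A) = Z^0(A) / B^0(A), where Z^0(A) = A^0 since A is non-positive. *)

Section H0.
Variable A : dgring.
Local Notation sA := (dgr_st A).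

Definition deg0 : {pred A} := fun a => cmp sA 0 a == a.

Lemma deg0P (a : A) : a \in deg0 <-> homog sA 0 a.
Proof. by split=> /eqP. Qed.

Lemma deg0_subring : subring_closed deg0.
Proof.
split=> [|a b /deg0P ha /deg0P hb|a b /deg0P ha /deg0P hb]; apply/deg0P.
- exact: dgr_1.
- by apply: homogD => //; apply: homogN.
- by rewrite -[0]addr0; apply: dgr_mul.
Qed.

Definition Z0 : Type := {a : A | a \in deg0}.
HB.instance Definition _ := [isSub for (@sval A _ : Z0 -> A)].
HB.instance Definition _ := [Choice of Z0 by <:].
HB.instance Definition _ :=
  GRing.SubChoice_isSubPzRing.Build A deg0 Z0 deg0_subring.

Definition H0_eq (a b : Z0) : Prop := coboundary sA 0 (val a - val b).

Lemma H0_eq_refl a : H0_eq a a.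
Proof.
by exists 0; rewrite ?subrr ?raddf0 // /homog raddf0.
Qed.

Lemma H0_eq_sym a b : H0_eq a b -> H0_eq b a.
Proof.
move=> [y hy e]; exists (- y); first exact: homogN.
by rewrite (raddfN (dif sA)) /= -e opprB.
Qed.

Lemma H0_eq_trans a b c : H0_eq a b -> H0_eq b c -> H0_eq a c.
Proof.
move=> [y hy e] [z hz f]; exists (y + z); first exact: homogD.
by rewrite difD -e -f addrA subrK.
Qed.

Definition H0_car : Type := cquot H0_eq_refl H0_eq_sym H0_eq_trans.
HB.instance Definition _ := Choice.on H0_car.
Definition H0_cls (a : Z0) : H0_car := cls _ _ _ a.
Local Notation H0_rep := (@rep _ _ H0_eq_refl H0_eq_sym H0_eq_trans).

Lemma H0_clsP a b : H0_cls a = H0_cls b <-> H0_eq a b.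
Proof. exact: clsP. Qed.

Lemma H0_cls_surj c : exists a, c = H0_cls a.
Proof. exact: cls_surj. Qed.

Lemma H0_rep_cls a : H0_eq (H0_rep (H0_cls a)) a.
Proof. exact: rep_cls. Qed.

Definition H0_add (c e : H0_car) := H0_cls (H0_rep c + H0_rep e).
Definition H0_opp (c : H0_car) := H0_cls (- H0_rep c).
Definition H0_mul (c e : H0_car) := H0_cls (H0_rep c * H0_rep e).

Lemma H0_addE a b : H0_add (H0_cls a) (H0_cls b) = H0_cls (a + b).
Proof.
apply/H0_clsP; case: (H0_rep_cls a) (H0_rep_cls b) => [y hy e] [z hz f].
exists (y + z); first exact: homogD.
by rewrite difD -e -f !rmorphD /= opprD addrACA.
Qed.

Lemma H0_oppE a : H0_opp (H0_cls a) = H0_cls (- a).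
Proof.
apply/H0_clsP; case: (H0_rep_cls a) => [y hy e]; exists (- y).
  exact: homogN.
by rewrite (raddfN (dif sA)) /= -e opprB raddfN /= opprK addrC.
Qed.

Lemma H0_mulE a b : H0_mul (H0_cls a) (H0_cls b) = H0_cls (a * b).
Proof.
apply/H0_clsP; move: (H0_rep_cls a) (H0_rep_cls b).
set a' := H0_rep _; set b' := H0_rep _ => - [y hy e] [z hz f].
have h0 (c : Z0) : homog sA 0 (val c) by apply/deg0P/(valP c).
exists (y * val b' + val a * z).
  apply: homogD; first by rewrite -[0 - 1]addr0; apply: dgr_mul.
  by rewrite -[0 - 1]add0r; apply: dgr_mul.
rewrite difD (dgr_leibniz _ hy) (dgr_leibniz _ (h0 a)) /=.
rewrite -[dif sA y]e -[dif sA z]f.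
rewrite (dif_homog0 (h0 a)) (dif_homog0 (h0 b')) mul0r mulr0 mulr0 addr0 add0r.
by rewrite expr0 mul1r mulrBl mulrBr addrA subrK.
Qed.

Ltac H0_elim c := case: (H0_cls_surj c) => ? ->.

Lemma H0_addA : associative H0_add.
Proof.
by move=> a b c; H0_elim a; H0_elim b; H0_elim c; rewrite !H0_addE addrA.
Qed.
Lemma H0_addC : commutative H0_add.
Proof. by move=> a b; H0_elim a; H0_elim b; rewrite !H0_addE addrC. Qed.
Lemma H0_add0 : left_id (H0_cls 0) H0_add.
Proof. by move=> a; H0_elim a; rewrite !H0_addE add0r. Qed.
Lemma H0_addN : left_inverse (H0_cls 0) H0_opp H0_add.
Proof. by move=> a; H0_elim a; rewrite H0_oppE H0_addE addNr. Qed.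
HB.instance Definition _ :=
  GRing.isZmodule.Build H0_car H0_addA H0_addC H0_add0 H0_addN.

Lemma H0_clsD a b : H0_cls (a + b) = H0_cls a + H0_cls b.
Proof. by rewrite -H0_addE. Qed.

Lemma H0_mulA : associative H0_mul.
Proof.
by move=> a b c; H0_elim a; H0_elim b; H0_elim c; rewrite !H0_mulE mulrA.
Qed.
Lemma H0_mul1l : left_id (H0_cls 1) H0_mul.
Proof. by move=> a; H0_elim a; rewrite !H0_mulE mul1r. Qed.
Lemma H0_mul1r : right_id (H0_cls 1) H0_mul.
Proof. by move=> a; H0_elim a; rewrite !H0_mulE mulr1. Qed.
Lemma H0_mulDl : left_distributive H0_mul (+%R : H0_car -> _).
Proof.
move=> a b c; H0_elim a; H0_elim b; H0_elim c.
by rewrite -H0_clsD !H0_mulE mulrDl H0_clsD.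
Qed.
Lemma H0_mulDr : right_distributive H0_mul (+%R : H0_car -> _).
Proof.
move=> a b c; H0_elim a; H0_elim b; H0_elim c.
by rewrite -H0_clsD !H0_mulE mulrDr H0_clsD.
Qed.
HB.instance Definition _ := GRing.Zmodule_isPzRing.Build H0_car
  H0_mulA H0_mul1l H0_mul1r H0_mulDl H0_mulDr.

Lemma H0_clsM a b : H0_cls (a * b) = H0_cls a * H0_cls b.
Proof. by rewrite -H0_mulE. Qed.

End H0.
Arguments deg0 : clear implicits.

Section DegreeZero.
Variable R : pzRingType.

Definition conc_cmp (n : int) (x : R) : R := if n == 0 then x else 0.

Definition conc_st : dgstruct R.
Proof.
exists conc_cmp (fun=> 0); rewrite /conc_cmp.
- by move=> n x y; case: eqP; rewrite ?addr0.
- move=> m n x; case: (eqVneq m n) => [->|mn]; first by case: (n == 0).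
  by case: (eqVneq n 0) mn => [->|_ _]; [move=> /negPf->|rewrite if_same].
- by move=> x; exists [:: 0]; rewrite big_seq1.
- by move=> x y; rewrite addr0.
- by move=> n x; rewrite if_same.
- by [].
Defined.

Definition conc_dgring : dgring.
Proof.
exists R conc_st.
- by [].
- rewrite /homog /= /conc_cmp => i j a b.
  case: eqP => [->|_ <-]; last by rewrite mul0r if_same.
  by case: eqP => [->|_ _ <-]; rewrite ?addr0 ?eqxx // mulr0 if_same.
- by move=> *; rewrite /= mul0r !mulr0 addr0.
- by move=> n a n0; rewrite /= /conc_cmp gt_eqF.
Defined.

End DegreeZero.

(* H^0(A), regarded as a DG-ring concentrated in degree 0, so that DG-modules
   over it are complexes of left H^0(A)-modules. *)
Definition H0 (A : dgring) : dgring := conc_dgring (H0_car A).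

Section PiH.
Variable A : dgring.
Local Notation sA := (dgr_st A).

Lemma deg0_cmp (a : A) : cmp sA 0 a \in deg0 A.
Proof. by apply/deg0P; apply: homog_cmp. Qed.

Definition piH_fun (a : A) : H0 A := H0_cls (exist _ (cmp sA 0 a) (deg0_cmp a)).

Lemma piH_fun_eq (a : A) (b : Z0 A) : cmp sA 0 a = val b -> piH_fun a = H0_cls b.
Proof. by move=> e; congr H0_cls; apply: val_inj. Qed.

Lemma piH_fun0 (a : A) : cmp sA 0 a = 0 -> piH_fun a = 0.
Proof. by move=> e; apply: (piH_fun_eq (b := 0)). Qed.

Definition piH : dgrhom A (H0 A).
Proof.
exists piH_fun.
- move=> a b; rewrite [RHS](esym (H0_clsD _ _)); apply: piH_fun_eq.
  by rewrite raddfD.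
- move=> a b; rewrite [RHS](esym (H0_clsM _ _)); apply: piH_fun_eq.
  by rewrite cmp0M.
- by apply: (piH_fun_eq (b := 1)); apply: dgr_1.
- move=> n a; rewrite /= /conc_cmp; case: eqP => [->|/eqP n0].
    by apply: piH_fun_eq; rewrite cmp_cmp eqxx.
  by apply: piH_fun0; rewrite cmp_cmp eq_sym (negPf n0).
- move=> a /=; rewrite [LHS](_ : _ = H0_cls 0) //; apply/H0_clsP.
  exists (cmp sA (0 - 1) a); first exact: homog_cmp.
  by rewrite /= subr0 dif_cmpE.
Defined.

Lemma piH_surj (h : H0 A) : exists2 a : A, homog sA 0 a & h = piH a.
Proof.
have [a ->] := H0_cls_surj h.
have ha : homog sA 0 (val a) by apply/deg0P/(valP a).
by exists (val a) => //; rewrite /= (piH_fun_eq (b := a)).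
Qed.

Lemma piH_homog n (a : A) : homog sA n a -> n != 0 -> piH a = 0.
Proof. by move=> ha n0; apply: piH_fun0; rewrite (homog_neq ha) // eq_sym. Qed.

End PiH.

(* A is equivalent to its underlying ring H^0(A). *)
Definition equiv_H0 (A : dgring) : Prop :=
  quasi_iso (dgr_st A) (dgr_st (H0 A)) (piH A).

Definition dg_qis (A : dgring) (M N : dgmod A) (f : dghom M N) : Prop :=
  quasi_iso (dgm_st M) (dgm_st N) f.

(* E-categories: hom-types come with an equivalence relation heq, which is the
   equality of morphisms. *)

Record category := Category {
  ob :> Type;
  hom : ob -> ob -> Type;
  heq : forall x y, hom x y -> hom x y -> Prop;
  idm : forall x, hom x x;
  ccomp : forall x y z, hom y z -> hom x y -> hom x z;
  heq_refl : forall x y (f : hom x y), heq f f;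
  heq_sym : forall x y (f g : hom x y), heq f g -> heq g f;
  heq_trans : forall x y (f g h : hom x y), heq f g -> heq g h -> heq f h;
  ccomp_heq : forall x y z (g g' : hom y z) (f f' : hom x y),
    heq g g' -> heq f f' -> heq (ccomp g f) (ccomp g' f');
  ccomp_idl : forall x y (f : hom x y), heq (ccomp (idm y) f) f;
  ccomp_idr : forall x y (f : hom x y), heq (ccomp f (idm x)) f;
  ccompA : forall x y z t (h : hom z t) (g : hom y z) (f : hom x y),
    heq (ccomp h (ccomp g f)) (ccomp (ccomp h g) f)
}.
Arguments hom {c} x y.
Arguments heq {c x y} f g.
Arguments idm {c} x.
Arguments ccomp {c x y z} g f.

Definition is_iso (C : category) (x y : C) (f : hom x y) : Prop :=
  exists g : hom y x, heq (ccomp g f) (idm x) /\ heq (ccomp f g) (idm y).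

Record functor (C C' : category) := Functor {
  fob :> C -> C';
  fmap : forall x y : C, hom x y -> hom (fob x) (fob y);
  fmap_heq : forall x y (f g : hom x y), heq f g -> heq (fmap f) (fmap g);
  fmap_id : forall x, heq (fmap (idm x)) (idm (fob x));
  fmap_comp : forall x y z (g : hom y z) (f : hom x y),
    heq (fmap (ccomp g f)) (ccomp (fmap g) (fmap f))
}.
Arguments fmap {C C'} _ {x y} _.

Definition full (C C' : category) (F : functor C C') : Prop :=
  forall (x y : C) (g : hom (F x) (F y)), exists f : hom x y, heq (fmap F f) g.

Definition faithful (C C' : category) (F : functor C C') : Prop :=
  forall (x y : C) (f g : hom x y), heq (fmap F f) (fmap F g) -> heq f g.

(* The localization C[W^-1]: same objects; morphisms are formal composites of
   morphisms of C and of formal inverses of elements of W, modulo the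
   congruence generated by the relations of C and the inverse laws. *)

Section Localization.
Variables (C : category) (W : forall x y : C, hom x y -> Prop).

Inductive lhom : C -> C -> Type :=
| lof x y : hom x y -> lhom x y
| linv x y (w : hom x y) : W w -> lhom y x
| lcomp x y z : lhom y z -> lhom x y -> lhom x z.

Inductive leq : forall x y, lhom x y -> lhom x y -> Prop :=
| leq_refl x y (f : lhom x y) : leq f f
| leq_sym x y (f g : lhom x y) : leq f g -> leq g f
| leq_trans x y (f g h : lhom x y) : leq f g -> leq g h -> leq f h
| leq_lcomp x y z (g g' : lhom y z) (f f' : lhom x y) :
    leq g g' -> leq f f' -> leq (lcomp g f) (lcomp g' f')
| leq_idl x y (f : lhom x y) : leq (lcomp (lof (idm y)) f) f
| leq_idr x y (f : lhom x y) : leq (lcomp f (lof (idm x))) f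
| leq_assoc x y z t (h : lhom z t) (g : lhom y z) (f : lhom x y) :
    leq (lcomp h (lcomp g f)) (lcomp (lcomp h g) f)
| leq_of x y (f g : hom x y) : heq f g -> leq (lof f) (lof g)
| leq_of_comp x y z (g : hom y z) (f : hom x y) :
    leq (lof (ccomp g f)) (lcomp (lof g) (lof f))
| leq_invl x y (w : hom x y) (Ww : W w) :
    leq (lcomp (linv Ww) (lof w)) (lof (idm x))
| leq_invr x y (w : hom x y) (Ww : W w) :
    leq (lcomp (lof w) (linv Ww)) (lof (idm y)).

Definition loc_cat : category :=
  Category leq_refl leq_sym leq_trans leq_lcomp leq_idl leq_idr leq_assoc.

Definition loc : functor C loc_cat :=
  @Functor C loc_cat id lof leq_of (fun x => leq_refl _) leq_of_comp.

End Localization.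

Section LocalizedFunctor.
Variables (C C' : category) (W : forall x y : C, hom x y -> Prop).
Variables (W' : forall x y : C', hom x y -> Prop) (F : functor C C').
Hypothesis FW : forall x y (f : hom x y), W f -> W' (fmap F f).

Fixpoint loc_fmap x y (f : lhom W x y) : lhom W' (F x) (F y) :=
  match f with
  | lof _ _ f => lof W' (fmap F f)
  | linv _ _ _ Ww => linv (FW Ww)
  | lcomp _ _ _ g f => lcomp (loc_fmap g) (loc_fmap f)
  end.

Lemma loc_fmap_leq x y (f g : lhom W x y) :
  leq f g -> leq (loc_fmap f) (loc_fmap g).
Proof.
have lid z : leq (lof W' (fmap F (idm z))) (lof W' (idm (F z))).
  by apply: leq_of; apply: fmap_id.
elim=> {x y f g} /=.
- by move=> *; apply: leq_refl.
- by move=> *; apply: leq_sym.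
- by move=> x y f g h _ fg _ gh; apply: leq_trans fg gh.
- by move=> *; apply: leq_lcomp.
- move=> x y f; apply: leq_trans (leq_idl _).
  by apply: leq_lcomp (leq_refl _); apply: lid.
- move=> x y f; apply: leq_trans (leq_idr _).
  by apply: leq_lcomp (leq_refl _) _; apply: lid.
- by move=> *; apply: leq_assoc.
- by move=> *; apply: leq_of; apply: fmap_heq.
- move=> x y z g f; apply: leq_trans (leq_of_comp _ _ _).
  by apply: leq_of; apply: fmap_comp.
- by move=> x y w Ww; apply: leq_trans (leq_invl _) (leq_sym (lid _)).
- by move=> x y w Ww; apply: leq_trans (leq_invr _) (leq_sym (lid _)).
Qed.

Definition loc_functor : functor (loc_cat W) (loc_cat W') :=
  @Functor (loc_cat W) (loc_cat W') F loc_fmap loc_fmap_leq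
    (fun x => leq_of W' (fmap_id F x)) (fun _ _ _ _ _ => leq_refl _).

End LocalizedFunctor.

Definition dgmod_cat (A : dgring) : category.
Proof.
exists (dgmod A) (@dghom A) (fun M N (f g : dghom M N) => f =1 g)
  (@dghom_id A) (@dghom_comp A) => //=.
- by move=> M N f g fg x; rewrite fg.
- by move=> M N f g h fg gh x; rewrite fg gh.
- by move=> M N P g g' f f' gg' ff' x /=; rewrite ff' gg'.
Defined.

Definition Dcat (A : dgring) : category :=
  @loc_cat (dgmod_cat A) (@dg_qis A).

Definition Dloc (A : dgring) : functor (dgmod_cat A) (Dcat A) :=
  @loc (dgmod_cat A) (@dg_qis A).

(* The complex Hom_A(M, N): its degree n part consists of the A-linear maps of
   degree n (with the Koszul sign), its differential is
   f |-> d o f - (-1)^n f o d. *)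

Section HomComplex.
Variables (A : dgring) (M N : dgmod A).

Definition graded_hom (n : int) (f : M -> N) : Prop :=
  [/\ {morph f : x y / x + y},
      forall k x, homog (dgm_st M) k x -> homog (dgm_st N) (k + n) (f x)
    & forall i (a : A) x, homog (dgr_st A) i a ->
        f (a *: x) = (-1) ^+ `|(i * n)%R|%N *: (a *: f x)].

Definition hom_dif (n : int) (f : M -> N) (x : M) : N :=
  dif (dgm_st N) (f x) - (-1) ^+ `|n|%N *: f (dif (dgm_st M) x).

Definition hom_acyclic : Prop :=
  forall n f, graded_hom n f -> (forall x, hom_dif n f x = 0) ->
    exists2 h, graded_hom (n - 1) h & forall x, f x = hom_dif (n - 1) h x.

End HomComplex.

Definition K_projective (A : dgring) (P : dgmod A) : Prop :=
  forall N : dgmod A, acyclic (dgm_st N) -> hom_acyclic P N.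

Definition K_injective (A : dgring) (I : dgmod A) : Prop :=
  forall N : dgmod A, acyclic (dgm_st N) -> hom_acyclic N I.

(* F is a left derived functor of T, computed by K-projective resolutions:
   there is a natural map eps_M : F M -> T M in D(B), and every M has a
   K-projective resolution p : P -> M with eps_P invertible, so that
   F M ~ F P ~ T P. Since every morphism of D(A) becomes the class of a map of
   DG-modules on K-projective resolutions, naturality of eps also determines F
   on morphisms; F is thus unique up to a unique isomorphism over T. *)

Definition left_derived (A B : dgring)
    (T : functor (dgmod_cat A) (dgmod_cat B)) (F : functor (Dcat A) (Dcat B)) : Prop :=
  exists eps : forall M : dgmod A, @hom (Dcat B) (F M) (T M),
    (forall (M N : dgmod A) (f : dghom M N),
       heq (ccomp (eps N) (fmap F (fmap (Dloc A) f)))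
           (ccomp (fmap (Dloc B) (fmap T f)) (eps M))) /\
    (forall M : dgmod A, exists (P : dgmod A) (p : dghom P M),
       [/\ K_projective P, dg_qis p & is_iso (eps P)]).

Definition right_derived (A B : dgring)
    (T : functor (dgmod_cat A) (dgmod_cat B)) (F : functor (Dcat A) (Dcat B)) : Prop :=
  exists eta : forall M : dgmod A, @hom (Dcat B) (T M) (F M),
    (forall (M N : dgmod A) (f : dghom M N),
       heq (ccomp (fmap F (fmap (Dloc A) f)) (eta M))
           (ccomp (eta N) (fmap (Dloc B) (fmap T f)))) /\
    (forall M : dgmod A, exists (I : dgmod A) (i : dghom M I),
       [/\ K_injective I, dg_qis i & is_iso (eta I)]).

Section Restriction.
Variables (A B : dgring) (phi : dgrhom A B).

Section Object.
Variable N : dgmod B.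

Definition restr_car : Type := N.
HB.instance Definition _ := GRing.Zmodule.on restr_car.

Definition restr_scale (a : A) (x : restr_car) : restr_car := phi a *: (x : N).

Lemma restr_scaleA a b x :
  restr_scale a (restr_scale b x) = restr_scale (a * b) x.
Proof. by rewrite /restr_scale drhM scalerA. Qed.
Lemma restr_scale1 : left_id 1 restr_scale.
Proof. by move=> x; rewrite /restr_scale drh1 scale1r. Qed.
Lemma restr_scaleDr : right_distributive restr_scale +%R.
Proof. by move=> a x y; apply: scalerDr. Qed.
Lemma restr_scaleDl x : {morph restr_scale^~ x : a b / a + b}.
Proof. by move=> a b; rewrite /restr_scale drhD; apply: scalerDl. Qed.
HB.instance Definition _ := GRing.Zmodule_isLmodule.Build A restr_car
  restr_scaleA restr_scale1 restr_scaleDr restr_scaleDl.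

Lemma drh_homog n (a : A) : homog (dgr_st A) n a -> homog (dgr_st B) n (phi a).
Proof. by rewrite /homog -drh_cmp => ->. Qed.

Definition restr_dgmod : dgmod A.
Proof.
exists restr_car (dgm_st N).
- by move=> i j a x ha; apply: dgm_scale; apply: drh_homog.
- move=> i a x ha; rewrite [LHS](dgm_leibniz _ (drh_homog ha)) -drh_dif.
  by congr (_ + _); rewrite !scale_sign.
Defined.

End Object.

Definition restr_hom (M N : dgmod B) (f : dghom M N) :
    dghom (restr_dgmod M) (restr_dgmod N) :=
  @DGHom A (restr_dgmod M) (restr_dgmod N) f
    (dmhD f) (fun a => dmhZ f (phi a)) (dmh_cmp f) (dmh_dif f).

Definition restr : functor (dgmod_cat B) (dgmod_cat A).
Proof. by apply: (@Functor (dgmod_cat B) (dgmod_cat A) restr_dgmod restr_hom). Defined.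

Lemma restr_qis (M N : dgmod_cat B) (f : hom M N) :
  dg_qis f -> dg_qis (fmap restr f).
Proof. by []. Qed.

Definition restr_D : functor (Dcat B) (Dcat A) := loc_functor restr_qis.

End Restriction.

(* The forgetful functor S : D(H^0(A)) -> D(A). *)
Definition forgetful (A : dgring) : functor (Dcat (H0 A)) (Dcat A) := restr_D (piH A).

Section ConcentratedModule.
Variables (R : pzRingType) (V : lmodType (conc_dgring R)) (s : dgstruct V).
Hypothesis cmpZ : forall n (a : conc_dgring R) x, cmp s n (a *: x) = a *: cmp s n x.
Hypothesis difZ : forall (a : conc_dgring R) x, dif s (a *: x) = a *: dif s x.

Lemma conc_homog i (a : R) :
  homog (conc_st R) i a -> i = 0 \/ a = 0.
Proof. by rewrite /homog /= /conc_cmp; case: eqP => [|_ <-]; [left|right]. Qed.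

Definition conc_dgmod : dgmod (conc_dgring R).
Proof.
exists V s.
- move=> i j a x ha hx; case: (conc_homog ha) => ->.
    by rewrite add0r /homog cmpZ hx.
  by rewrite scale0r /homog raddf0.
- move=> i a x ha; rewrite difZ /= scale0r add0r.
  case: (conc_homog ha) => ->; first by rewrite expr0 scale1r.
  by rewrite !scale0r scaler0.
Defined.

End ConcentratedModule.

Section FiniteSupport.
Variables (V : zmodType) (c : int -> V -> V).
Hypothesis cD : forall n, {morph c n : x y / x + y}.
Hypothesis cc : forall m n x, c m (c n x) = if m == n then c n x else 0.
Let fs x := exists s : seq int, uniq s /\ x = \sum_(n <- s) c n x.

Lemma fs0 : fs 0.
Proof. by exists [::]; rewrite big_nil. Qed.

Lemma fsD x y : fs x -> fs y -> fs (x + y).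
Proof.
have c0 n : c n 0 = 0 by apply: (addrI (c n 0)); rewrite -cD !addr0.
have ext z (s r : seq int) : uniq s -> uniq r -> {subset s <= r} ->
    z = \sum_(n <- s) c n z -> z = \sum_(n <- r) c n z.
  move=> us ur sr ez.
  have z0 m : m \notin s -> c m z = 0.
    move=> ms; rewrite ez (big_morph (c m) (cD m) (c0 m)) big_seq big1 // => n ns.
    by rewrite cc; case: eqP ns ms => // <- ->.
  rewrite (bigID (mem s)) /= [X in _ + X]big1 // addr0 -big_filter.
  rewrite {1}ez; apply: perm_big; apply: uniq_perm => // [|n].
    by rewrite filter_uniq.
  by rewrite mem_filter; case ns: (n \in s) => //=; rewrite sr.
move=> [s [us es]] [r [ur er]]; exists (undup (s ++ r)); split.
  exact: undup_uniq.
under eq_bigr do rewrite cD.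
rewrite big_split /=; congr (_ + _).
  by apply: (ext _ s) => // [|n ns]; rewrite ?undup_uniq // mem_undup mem_cat ns.
by apply: (ext _ r) => // [|n ns]; rewrite ?undup_uniq // mem_undup mem_cat ns orbT.
Qed.

Lemma fs_cmp n x : fs (c n x).
Proof. by exists [:: n]; rewrite big_seq1 cc eqxx. Qed.

End FiniteSupport.

(* The tensor product H^0(A) (x)_A M: formal sums of pure tensors h (x) m, two
   of them being equal when no A-balanced biadditive map separates them. *)

Section Tensor.
Variable A : dgring.
Local Notation H := (H0 A).

Definition balanced (M : dgmod A) (Z : zmodType) (b : H -> M -> Z) : Prop :=
  [/\ forall h h' m, b (h + h') m = b h m + b h' m,
      forall h m m', b h (m + m') = b h m + b h m'
    & forall h (a : A) m, b (h * piH A a) m = b h (a *: m)].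

Section TensorObject.
Variable M : dgmod A.

Definition tsum (Z : zmodType) (b : H -> M -> Z) (s : seq (H * M)) : Z :=
  \sum_(x <- s) b x.1 x.2.

Definition tens_eq (s t : seq (H * M)) : Prop :=
  forall (Z : zmodType) (b : H -> M -> Z), balanced b -> tsum b s = tsum b t.

Lemma tens_eq_refl s : tens_eq s s. Proof. by []. Qed.
Lemma tens_eq_sym s t : tens_eq s t -> tens_eq t s.
Proof. by move=> st Z b /st. Qed.
Lemma tens_eq_trans s t u : tens_eq s t -> tens_eq t u -> tens_eq s u.
Proof. by move=> st tu Z b bb; rewrite st ?tu. Qed.

Definition tens : Type := cquot tens_eq_refl tens_eq_sym tens_eq_trans.
HB.instance Definition _ := Choice.on tens.
Definition tcls (s : seq (H * M)) : tens := cls _ _ _ s.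
Definition trep : tens -> seq (H * M) := @rep _ _ _ _ _.
Definition pure (h : H) (m : M) : tens := tcls [:: (h, m)].

Lemma tclsP s t : tcls s = tcls t <-> tens_eq s t.
Proof. exact: clsP. Qed.
Lemma tcls_surj c : exists s, c = tcls s.
Proof. exact: cls_surj. Qed.
Lemma trep_cls s : tens_eq (trep (tcls s)) s.
Proof. exact: rep_cls. Qed.

Lemma balanced0l (Z : zmodType) (b : H -> M -> Z) m : balanced b -> b 0 m = 0.
Proof. by case=> bD _ _; apply: (addrI (b 0 m)); rewrite -bD !addr0. Qed.
Lemma balanced0r (Z : zmodType) (b : H -> M -> Z) h : balanced b -> b h 0 = 0.
Proof. by case=> _ bD _; apply: (addrI (b h 0)); rewrite -bD !addr0. Qed.
Lemma balancedNl (Z : zmodType) (b : H -> M -> Z) h m : balanced b -> b (- h) m = - b h m.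
Proof.
move=> bb; apply/eqP; rewrite -addr_eq0; case: (bb) => <- _ _.
by rewrite addNr balanced0l.
Qed.

Definition tadd (c e : tens) : tens := tcls (trep c ++ trep e).

Lemma tsum_cat (Z : zmodType) (b : H -> M -> Z) s t : tsum b (s ++ t) = tsum b s + tsum b t.
Proof. exact: big_cat. Qed.

Lemma taddE s t : tadd (tcls s) (tcls t) = tcls (s ++ t).
Proof.
by apply/tclsP => Z b bb; rewrite !tsum_cat; congr (_ + _); apply: trep_cls.
Qed.

End TensorObject.

Section TensorMap.
Variables (M N : dgmod A) (u : H -> H) (v : M -> N).
Let w (x : H * M) : H * N := (u x.1, v x.2).

Definition tmap (c : tens M) : tens N := tcls (map w (trep c)).

Hypothesis uv : forall (Z : zmodType) (b : H -> N -> Z), balanced b ->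
  balanced (fun h m => b (u h) (v m)).

Lemma tsum_map (Z : zmodType) (b : H -> N -> Z) s :
  tsum b (map w s) = tsum (fun h m => b (u h) (v m)) s.
Proof. by rewrite /tsum big_map. Qed.

Lemma tmapE s : tmap (tcls s) = tcls (map w s).
Proof.
by apply/tclsP => Z b bb; rewrite !tsum_map; apply: trep_cls; apply: uv.
Qed.

End TensorMap.

Section TensorModule.
Variable M : dgmod A.

Ltac t_elim c := let s := fresh "s" in case: (tcls_surj c) => s ->.

Lemma balanced_opp (Z : zmodType) (b : H -> M -> Z) :
  balanced b -> balanced (fun h m => b (- h) m).
Proof.
case=> [bl br ba]; split=> *; first by rewrite opprD bl.
- exact: br.
- by rewrite -ba mulNr.
Qed.

Lemma balanced_mul h0 (Z : zmodType) (b : H -> M -> Z) :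
  balanced b -> balanced (fun h m => b (h0 * h) m).
Proof.
case=> [bl br ba]; split=> *; first by rewrite mulrDr bl.
- exact: br.
- by rewrite -ba mulrA.
Qed.

Definition topp : tens M -> tens M := tmap (fun h => - h) id.

Lemma taddA : associative (@tadd M).
Proof. by move=> a b c; t_elim a; t_elim b; t_elim c; rewrite !taddE catA. Qed.
Lemma taddC : commutative (@tadd M).
Proof.
move=> x y; t_elim x; t_elim y; rewrite !taddE; apply/tclsP => Z b bb.
by rewrite !tsum_cat addrC.
Qed.
Lemma tadd0 : left_id (tcls [::]) (@tadd M).
Proof. by move=> a; t_elim a; rewrite taddE. Qed.
Lemma taddN : left_inverse (tcls [::]) topp (@tadd M).
Proof.
move=> a; t_elim a; rewrite /topp (tmapE balanced_opp) taddE; apply/tclsP => Z b bb.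
rewrite tsum_cat (@tsum_map _ _ -%R id) /tsum -big_split big_nil big1 // => x _.
by rewrite balancedNl //; apply: addNr.
Qed.
HB.instance Definition _ := GRing.isZmodule.Build (tens M) taddA taddC tadd0 taddN.

Lemma tclsD (s t : seq (H * M)) : tcls (s ++ t) = tcls s + tcls t.
Proof. by rewrite -taddE. Qed.

Lemma tens_ind (P : tens M -> Prop) :
  P 0 -> (forall x y, P x -> P y -> P (x + y)) -> (forall h m, P (pure h m)) ->
  forall x, P x.
Proof.
move=> P0 PD Pp x; t_elim x; elim: s => [|[h m] s IH]; first exact: P0.
by rewrite -cat1s tclsD; apply: PD => //; apply: Pp.
Qed.

Lemma pureDl h h' (m : M) : pure (h + h') m = pure h m + pure h' m.
Proof.
rewrite -tclsD; apply/tclsP => Z b [bl _ _].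
by rewrite /tsum !big_cons big_nil !addr0 /= bl.
Qed.

Lemma pureDr h (m m' : M) : pure h (m + m') = pure h m + pure h m'.
Proof.
rewrite -tclsD; apply/tclsP => Z b [_ br _].
by rewrite /tsum !big_cons big_nil !addr0 /= br.
Qed.

Lemma pureM h (a : A) (m : M) : pure (h * piH A a) m = pure h (a *: m).
Proof.
apply/tclsP => Z b [_ _ ba].
by rewrite /tsum !big_cons big_nil !addr0 /= ba.
Qed.

Lemma pure_balanced : balanced (@pure M).
Proof. by split; [exact: pureDl|exact: pureDr|exact: pureM]. Qed.

Definition tscale (h : H) : tens M -> tens M := tmap ( *%R h) id.

End TensorModule.

Section TensorMapTheory.
Variables (M N : dgmod A) (u : H -> H) (v : M -> N).
Hypothesis uv : forall (Z : zmodType) (b : H -> N -> Z), balanced b ->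
  balanced (fun h m => b (u h) (v m)).

Lemma tmapD : {morph tmap u v : x y / x + y}.
Proof.
move=> x y; case: (tcls_surj x) => s ->; case: (tcls_surj y) => t ->.
by rewrite -tclsD !(tmapE uv) map_cat tclsD.
Qed.

Lemma tmap0 : tmap u v 0 = 0.
Proof. by apply: (addrI (tmap u v 0)); rewrite -tmapD !addr0. Qed.

Lemma tmap_pure h m : tmap u v (pure h m) = pure (u h) (v m).
Proof. exact: (tmapE uv). Qed.

End TensorMapTheory.

Section TensorDG.
Variable M : dgmod A.

Lemma tscale_pure h0 h (m : M) : tscale h0 (pure h m) = pure (h0 * h) m.
Proof. exact: (tmap_pure (@balanced_mul M h0)). Qed.
Lemma tscaleD : right_distributive (@tscale M) +%R.
Proof. by move=> h0; apply: (tmapD (@balanced_mul M h0)). Qed.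
Lemma tscale0 h0 : tscale h0 (0 : tens M) = 0.
Proof. exact: (tmap0 (@balanced_mul M h0)). Qed.

Lemma tscaleA a b (x : tens M) : tscale a (tscale b x) = tscale (a * b) x.
Proof.
elim/(@tens_ind M): x => [|x y IH IH'|h m]; first by rewrite !tscale0.
  by rewrite !tscaleD IH IH'.
by rewrite !tscale_pure mulrA.
Qed.
Lemma tscale1 : left_id 1 (@tscale M).
Proof.
elim/(@tens_ind M) => [|x y IH IH'|h m]; first by rewrite tscale0.
  by rewrite tscaleD IH IH'.
by rewrite tscale_pure mul1r.
Qed.
Lemma tscaleDl (x : tens M) : {morph (@tscale M)^~ x : a b / a + b}.
Proof.
move=> a b; elim/(@tens_ind M): x => [|x y IH IH'|h m].
- by rewrite !tscale0 addr0.
- by rewrite !tscaleD IH IH' addrACA.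
by rewrite !tscale_pure mulrDl pureDl.
Qed.
HB.instance Definition _ := GRing.Zmodule_isLmodule.Build H (tens M)
  tscaleA tscale1 tscaleD tscaleDl.

Lemma balanced_cmp n (Z : zmodType) (b : H -> M -> Z) :
  balanced b -> balanced (fun h m => b h (cmp (dgm_st M) n m)).
Proof.
move=> bb; have [bl br ba] := bb; split=> [h h' m|h m m'|h a m] //.
  by rewrite raddfD br.
elim/(homog_ind (s := dgr_st A)): a => [|a a' IH IH'|i a ha].
- by rewrite drh0 mulr0 scale0r raddf0 balanced0l // balanced0r.
- by rewrite drhD mulrDr bl IH IH' scalerDl raddfD /= br.
have [i0|i0] := eqVneq i 0.
  by move: (dgm_cmpZ n m ha); rewrite i0 add0r => ->; apply: ba.
rewrite -[n](subrKC i) (dgm_cmpZ _ _ ha) -ba (piH_homog ha) //.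
by rewrite mulr0 !balanced0l.
Qed.

Lemma balanced_dif (Z : zmodType) (b : H -> M -> Z) :
  balanced b -> balanced (fun h m => b h (dif (dgm_st M) m)).
Proof.
move=> bb; have [bl br ba] := bb; split=> [h h' m|h m m'|h a m] //.
  by rewrite raddfD br.
elim/(homog_ind (s := dgr_st A)): a => [|a a' IH IH'|i a ha].
- by rewrite drh0 mulr0 scale0r raddf0 balanced0l // balanced0r.
- by rewrite drhD mulrDr bl IH IH' scalerDl raddfD /= br.
rewrite (dgm_leibniz _ ha) br -ba drh_dif mulr0 balanced0l // add0r.
rewrite scale_sign; have [i0|i0] := eqVneq i 0; first by rewrite i0 /= ba.
have b0 : b h (a *: dif (dgm_st M) m) = 0.
  by rewrite -ba (piH_homog ha) // mulr0 balanced0l.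
have bN x : b h (- x) = - b h x.
  by apply/eqP; rewrite -addr_eq0 -br addNr balanced0r.
by rewrite (piH_homog ha) // mulr0 balanced0l //; case: ifP; rewrite ?bN b0 ?oppr0.
Qed.

Definition tens_cmp n : tens M -> tens M := tmap id (cmp (dgm_st M) n).
Definition tens_dif : tens M -> tens M := tmap id (dif (dgm_st M)).

Lemma tens_cmp_pure n h m : tens_cmp n (pure h m) = pure h (cmp (dgm_st M) n m).
Proof. exact: (tmap_pure (@balanced_cmp n)). Qed.
Lemma tens_cmpD n : {morph tens_cmp n : x y / x + y}.
Proof. exact: (tmapD (@balanced_cmp n)). Qed.
Lemma tens_cmp0 n : tens_cmp n 0 = 0.
Proof. exact: (tmap0 (@balanced_cmp n)). Qed.
Lemma tens_dif_pure h m : tens_dif (pure h m) = pure h (dif (dgm_st M) m).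
Proof. exact: (tmap_pure balanced_dif). Qed.
Lemma tens_difD : {morph tens_dif : x y / x + y}.
Proof. exact: (tmapD balanced_dif). Qed.
Lemma tens_dif0 : tens_dif 0 = 0.
Proof. exact: (tmap0 balanced_dif). Qed.
Let pure0 h : pure h (0 : M) = 0.
Proof. exact: balanced0r (pure_balanced M). Qed.
Let pure_sum h (s : seq int) (f : int -> M) :
  pure h (\sum_(n <- s) f n) = \sum_(n <- s) pure h (f n).
Proof. by apply: (big_morph (pure h)); [apply: pureDr|apply: pure0]. Qed.

Lemma tens_cmp_cmp m n (x : tens M) :
  tens_cmp m (tens_cmp n x) = if m == n then tens_cmp n x else 0.
Proof.
elim/(@tens_ind M): x => [|x y IH IH'|h x].
- by rewrite !tens_cmp0 if_same.
- by rewrite !tens_cmpD IH IH'; case: eqP; rewrite ?addr0.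
by rewrite !tens_cmp_pure cmp_cmp; case: eqP; rewrite ?pure0.
Qed.

Definition tens_st : dgstruct (tens M).
Proof.
exists tens_cmp tens_dif.
- exact: tens_cmpD.
- exact: tens_cmp_cmp.
- elim/(@tens_ind M) => [|x y|h m]; first exact: fs0.
    exact: (fsD tens_cmpD tens_cmp_cmp).
  have [s [us em]] := cmp_sum (dgm_st M) m.
  exists s; split=> //; rewrite {1}em pure_sum; apply: eq_bigr => n _.
  by rewrite tens_cmp_pure.
- exact: tens_difD.
- move=> n; elim/(@tens_ind M) => [|x y IH IH'|h m].
  + by rewrite tens_cmp0 !tens_dif0 tens_cmp0.
  + by rewrite tens_cmpD !tens_difD tens_cmpD IH IH'.
  + by rewrite tens_cmp_pure !tens_dif_pure tens_cmp_pure dif_cmp.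
- elim/(@tens_ind M) => [|x y IH IH'|h m].
  + by rewrite !tens_dif0.
  + by rewrite !tens_difD IH IH' addr0.
  + by rewrite !tens_dif_pure dif_dif pure0.
Defined.

Lemma tscaleE h0 h (m : M) : h0 *: pure h m = pure (h0 * h) m.
Proof. exact: tscale_pure. Qed.

Lemma tens_cmpZ n (a : H) x : tens_cmp n (a *: x) = a *: tens_cmp n x.
Proof.
elim/(@tens_ind M): x => [|x y IH IH'|h m].
- by rewrite scaler0 tens_cmp0 scaler0.
- by rewrite scalerDr !tens_cmpD IH IH' scalerDr.
- by rewrite tens_cmp_pure !tscaleE tens_cmp_pure.
Qed.

Lemma tens_difZ (a : H) x : tens_dif (a *: x) = a *: tens_dif x.
Proof.
elim/(@tens_ind M): x => [|x y IH IH'|h m].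
- by rewrite scaler0 tens_dif0 scaler0.
- by rewrite scalerDr !tens_difD IH IH' scalerDr.
- by rewrite tens_dif_pure !tscaleE tens_dif_pure.
Qed.

Definition tens_dgmod : dgmod H :=
  @conc_dgmod _ (tens M) tens_st tens_cmpZ tens_difZ.

End TensorDG.

Section TensorFunctor.
Variables (M N : dgmod A) (f : dghom M N).

Lemma balanced_hom (Z : zmodType) (b : H -> N -> Z) :
  balanced b -> balanced (fun h m => b h (f m)).
Proof.
case=> [bl br ba]; split=> *; first exact: bl.
- by rewrite dmhD br.
- by rewrite dmhZ ba.
Qed.

Definition tens_fun : tens M -> tens N := tmap id f.

Lemma tens_fun_pure h m : tens_fun (pure h m) = pure h (f m).
Proof. exact: (tmap_pure balanced_hom). Qed.
Lemma tens_funD : {morph tens_fun : x y / x + y}.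
Proof. exact: (tmapD balanced_hom). Qed.
Lemma tens_fun0 : tens_fun 0 = 0.
Proof. exact: (tmap0 balanced_hom). Qed.

Lemma tens_funZ (a : H) x : tens_fun (a *: x) = a *: tens_fun x.
Proof.
elim/(@tens_ind M): x => [|x y IH IH'|h m].
- by rewrite scaler0 tens_fun0 scaler0.
- by rewrite scalerDr !tens_funD IH IH' scalerDr.
- by rewrite tens_fun_pure !tscaleE tens_fun_pure.
Qed.

Lemma tens_fun_cmp n x : tens_fun (tens_cmp n x) = tens_cmp n (tens_fun x).
Proof.
elim/(@tens_ind M): x => [|x y IH IH'|h m].
- by rewrite tens_cmp0 tens_fun0 tens_cmp0.
- by rewrite tens_cmpD !tens_funD tens_cmpD IH IH'.
- by rewrite tens_cmp_pure !tens_fun_pure tens_cmp_pure dmh_cmp.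
Qed.

Lemma tens_fun_dif x : tens_fun (tens_dif x) = tens_dif (tens_fun x).
Proof.
elim/(@tens_ind M): x => [|x y IH IH'|h m].
- by rewrite tens_dif0 tens_fun0 tens_dif0.
- by rewrite tens_difD !tens_funD tens_difD IH IH'.
- by rewrite tens_dif_pure !tens_fun_pure tens_dif_pure dmh_dif.
Qed.

Definition tens_hom : dghom (tens_dgmod M) (tens_dgmod N) :=
  @DGHom H (tens_dgmod M) (tens_dgmod N) tens_fun
    tens_funD tens_funZ tens_fun_cmp tens_fun_dif.

End TensorFunctor.

Definition extension : functor (dgmod_cat A) (dgmod_cat H).
Proof.
apply: (@Functor (dgmod_cat A) (dgmod_cat H) tens_dgmod tens_hom) => /=.
- move=> M N f g fg; elim/(@tens_ind M) => [|x y IH IH'|h m].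
  + by rewrite !tens_fun0.
  + by rewrite !tens_funD IH IH'.
  + by rewrite !tens_fun_pure fg.
- move=> M; elim/(@tens_ind M) => [|x y IH IH'|h m].
  + exact: tens_fun0.
  + by rewrite tens_funD IH IH'.
  + exact: tens_fun_pure.
- move=> M N P g f; elim/(@tens_ind M) => [|x y IH IH'|h m] /=.
  + by rewrite !tens_fun0.
  + by rewrite !tens_funD IH IH'.
  + by rewrite !tens_fun_pure.
Defined.

End Tensor.

(* Hom_A(H^0(A), M), graded by (Hom_A(H^0(A), M))^n = Hom_A(H^0(A), M^n): as
   H^0(A) is concentrated in degree 0, there is no sign in A-linearity and the
   differential is composition with that of M; as H^0(A) is generated by 1,
   every A-linear map is the sum of finitely many homogeneous ones. The left
   action of H^0(A) comes from its right action on itself. *)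

Section Coinduction.
Variable A : dgring.
Local Notation H := (H0 A).

Section CoindObject.
Variable M : dgmod A.
Local Notation sM := (dgm_st M).

Definition A_linear (f : H -> M) : Prop :=
  {morph f : x y / x + y} /\ forall (a : A) h, f (piH A a * h) = a *: f h.

Definition coind_pred : {pred H -> M} := fun f => `[< A_linear f >].

Lemma coind_zmod : zmod_closed coind_pred.
Proof.
split=> [|f g /asboolP[fD fZ] /asboolP[gD gZ]]; apply/asboolP; split.
- by move=> x y; rewrite [RHS]addr0.
- by move=> a h; rewrite [RHS]scaler0.
- by move=> x y; rewrite -[LHS]/(f (x + y) - g (x + y)) fD gD opprD addrACA.
- by move=> a h; rewrite -[LHS]/(f (_ * h) - g (_ * h)) fZ gZ -scalerBr.
Qed.

Definition coind : Type := {f : H -> M | f \in coind_pred}.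
HB.instance Definition _ := [isSub for (@sval (H -> M) _ : coind -> (H -> M))].
HB.instance Definition _ := [Choice of coind by <:].
HB.instance Definition _ :=
  GRing.SubChoice_isSubZmodule.Build (H -> M) coind_pred coind coind_zmod.

Definition Coind (f : H -> M) (Hf : A_linear f) : coind :=
  exist _ f (asboolT Hf).

Definition coind_fun (f : coind) : H -> M := val f.

Lemma coindP (f : coind) : A_linear (coind_fun f).
Proof. exact/asboolP/(valP f). Qed.

Lemma coind_ext (f g : coind) : coind_fun f =1 coind_fun g -> f = g.
Proof. by move=> fg; apply: val_inj; apply/funext. Qed.

Lemma coind_funD f g h : coind_fun (f + g) h = coind_fun f h + coind_fun g h.
Proof. by []. Qed.

Lemma coind_fun0 h : coind_fun 0 h = 0.
Proof. by []. Qed.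

Lemma A_linear_vanish (f : H -> M) (a : A) h :
  A_linear f -> piH A a = 0 -> a *: f h = 0.
Proof.
move=> [fD fZ] a0; rewrite -fZ a0 mul0r.
by apply: (addrI (f 0)); rewrite -fD !addr0.
Qed.

Lemma A_linear_cmp n f : A_linear f -> A_linear (fun h => cmp sM n (f h)).
Proof.
move=> lf; have [fD fZ] := lf; split=> [x y|a h]; first by rewrite fD raddfD.
rewrite fZ.
elim/(homog_ind (s := dgr_st A)): a => [|a a' IH IH'|i a ha].
- by rewrite !scale0r raddf0.
- by rewrite !scalerDl raddfD /= IH IH'.
rewrite -(dgm_cmpZ n _ ha); have [->|i0] := eqVneq i 0; first by rewrite add0r.
by rewrite (A_linear_vanish h lf (piH_homog ha i0)) !raddf0.
Qed.

Lemma A_linear_dif f : A_linear f -> A_linear (fun h => dif sM (f h)).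
Proof.
move=> lf; have [fD fZ] := lf; split=> [x y|a h]; first by rewrite fD raddfD.
rewrite fZ.
elim/(homog_ind (s := dgr_st A)): a => [|a a' IH IH'|i a ha].
- by rewrite !scale0r raddf0.
- by rewrite !scalerDl raddfD /= IH IH'.
have := dgm_leibniz (f h) ha.
rewrite (A_linear_vanish h lf (drh_dif (piH A) a)) add0r => E.
rewrite E; have [->|i0] := eqVneq i 0; first by rewrite expr0 scale1r.
move: E; rewrite (A_linear_vanish h lf (piH_homog ha i0)) raddf0 scale_sign.
by case: ifP => // _ /esym/eqP; rewrite oppr_eq0 => /eqP->; rewrite oppr0.
Qed.

Lemma A_linear_act (a : H) f : A_linear f -> A_linear (fun h => f (h * a)).
Proof.
move=> [fD fZ]; split=> [x y|b h]; first by rewrite mulrDl fD.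
by rewrite -mulrA fZ.
Qed.

Definition coind_cmp n (f : coind) : coind := Coind (A_linear_cmp n (coindP f)).
Definition coind_dif (f : coind) : coind := Coind (A_linear_dif (coindP f)).
Definition coind_scale (a : H) (f : coind) : coind :=
  Coind (A_linear_act a (coindP f)).

Lemma coind_scaleA a b f :
  coind_scale a (coind_scale b f) = coind_scale (a * b) f.
Proof. by apply: coind_ext => h; rewrite /coind_fun /= mulrA. Qed.
Lemma coind_scale1 : left_id 1 coind_scale.
Proof. by move=> f; apply: coind_ext => h; rewrite /coind_fun /= mulr1. Qed.
Lemma coind_scaleDr : right_distributive coind_scale +%R.
Proof. by move=> a f g; apply: coind_ext. Qed.
Lemma coind_scaleDl f : {morph coind_scale^~ f : a b / a + b}.
Proof.
move=> a b; apply: coind_ext => h.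
by rewrite coind_funD /coind_fun /= mulrDr; apply: (coindP f).1.
Qed.
HB.instance Definition _ := GRing.Zmodule_isLmodule.Build H coind
  coind_scaleA coind_scale1 coind_scaleDr coind_scaleDl.

Lemma coind_cmp_cmp m n f :
  coind_cmp m (coind_cmp n f) = if m == n then coind_cmp n f else 0.
Proof.
by apply: coind_ext => h; rewrite /coind_fun /= cmp_cmp; case: eqP.
Qed.

Lemma coind_cmpD n : {morph coind_cmp n : f g / f + g}.
Proof. by move=> f g; apply: coind_ext => h; apply: cmpD. Qed.

Lemma coind_sum (s : seq int) (F : int -> coind) h :
  coind_fun (\sum_(n <- s) F n) h = \sum_(n <- s) coind_fun (F n) h.
Proof. by apply: (big_morph (fun f => coind_fun f h)). Qed.

Lemma coind_cmp_sum f :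
  exists s : seq int, uniq s /\ f = \sum_(n <- s) coind_cmp n f.
Proof.
have [s [us e1]] := cmp_sum sM (coind_fun f 1); exists s; split=> //.
have fE h : exists2 a : A, homog (dgr_st A) 0 a &
    forall g, A_linear g -> g h = a *: g 1.
  have [a ha ->] := piH_surj h; exists a => // g [_ gZ].
  by rewrite -gZ mulr1.
apply: coind_ext => h; have [a ha aE] := fE h.
rewrite coind_sum (aE _ (coindP f)) {1}e1 scaler_sumr.
by apply: eq_bigr => n _; rewrite (aE _ (coindP (coind_cmp n f))).
Qed.

Definition coind_st : dgstruct coind.
Proof.
exists coind_cmp coind_dif.
- exact: coind_cmpD.
- exact: coind_cmp_cmp.
- exact: coind_cmp_sum.
- by move=> f g; apply: coind_ext => h; apply: difD.
- by move=> n f; apply: coind_ext => h; apply: dif_cmp.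
- by move=> f; apply: coind_ext => h; apply: dif_dif.
Defined.

Lemma coind_cmpZ n (a : H) f : coind_cmp n (a *: f) = a *: coind_cmp n f.
Proof. by apply: coind_ext. Qed.
Lemma coind_difZ (a : H) f : coind_dif (a *: f) = a *: coind_dif f.
Proof. by apply: coind_ext. Qed.

Definition coind_dgmod : dgmod H :=
  @conc_dgmod _ coind coind_st coind_cmpZ coind_difZ.

End CoindObject.

Section CoindFunctor.
Variables (M N : dgmod A) (f : dghom M N).

Lemma A_linear_comp (g : H -> M) : A_linear g -> A_linear (f \o g).
Proof.
move=> [gD gZ]; split=> [x y|a h] /=; first by rewrite gD dmhD.
by rewrite gZ dmhZ.
Qed.

Definition coind_map (g : coind M) : coind N := Coind (A_linear_comp (coindP g)).

Lemma coind_mapD : {morph coind_map : x y / x + y}.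
Proof. by move=> x y; apply: coind_ext => h; apply: dmhD. Qed.
Lemma coind_mapZ (a : H) x : coind_map (a *: x) = a *: coind_map x.
Proof. by apply: coind_ext. Qed.
Lemma coind_map_cmp n x : coind_map (coind_cmp n x) = coind_cmp n (coind_map x).
Proof. by apply: coind_ext => h; apply: dmh_cmp. Qed.
Lemma coind_map_dif x : coind_map (coind_dif x) = coind_dif (coind_map x).
Proof. by apply: coind_ext => h; apply: dmh_dif. Qed.

Definition coind_hom : dghom (coind_dgmod M) (coind_dgmod N) :=
  @DGHom H (coind_dgmod M) (coind_dgmod N) coind_map
    coind_mapD coind_mapZ coind_map_cmp coind_map_dif.

End CoindFunctor.

Definition coextension : functor (dgmod_cat A) (dgmod_cat H).
Proof.
apply: (@Functor (dgmod_cat A) (dgmod_cat H) coind_dgmod coind_hom) => /=.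
- by move=> M N f g fg x; apply: coind_ext => h; apply: fg.
- by move=> M x; apply: coind_ext.
- by move=> M N P g f x; apply: coind_ext.
Defined.

End Coinduction.

(* F is a model of the reduction functor H^0(A) (x)^L_A -. *)
Definition is_reduction (A : dgring) (F : functor (Dcat A) (Dcat (H0 A))) : Prop :=
  left_derived (extension A) F.

(* G is a model of the coreduction functor RHom_A(H^0(A), -). *)
Definition is_coreduction (A : dgring) (G : functor (Dcat A) (Dcat (H0 A))) : Prop :=
  right_derived (coextension A) G.

Definition dg_commutative (A : dgring) : Prop :=
  (forall i j (a b : A), homog (dgr_st A) i a -> homog (dgr_st A) j b ->
     a * b = (-1) ^+ `|(i * j)%R|%N * (b * a)) /\
  (forall i (a : A), homog (dgr_st A) i a -> odd `|i|%N -> a * a = 0).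

Definition noetherian_ring (R : pzRingType) : Prop :=
  forall I : R -> Prop,
    I 0 -> (forall x y, I x -> I y -> I (x + y)) ->
    (forall a x, I x -> I (a * x)) ->
    exists (k : nat) (g : 'I_k -> R),
      forall x, I x <-> exists c : 'I_k -> R, x = \sum_(i < k) c i * g i.

(* H^n(A) is a finitely generated H^0(A)-module; the action of H^0(A) on it is
   induced by multiplication of cocycles by elements of Z^0(A) = A^0. *)
Definition coh_fg (A : dgring) (n : int) : Prop :=
  exists (k : nat) (g : 'I_k -> A),
    (forall i, cocycle (dgr_st A) n (g i)) /\
    forall z, cocycle (dgr_st A) n z ->
      exists c : 'I_k -> A, (forall i, homog (dgr_st A) 0 (c i)) /\
        coboundary (dgr_st A) n (z - \sum_(i < k) c i * g i).

Definition dg_noetherian (A : dgring) : Prop :=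
  noetherian_ring (H0_car A) /\ forall n, coh_fg A n.

Definition bounded_cohomology (A : dgring) : Prop :=
  exists N : int, forall n, n < N -> coh_zero (dgr_st A) n.

(* Main.v *)
(* Write pi : A -> H for the projection onto H = H^0(A) and J for its kernel; pi is
   a quasi-isomorphism iff H^n(A) = 0 for n < 0. If this holds, J is acyclic, so
   P -> H (x)_A P is a quasi-isomorphism for P semi-free, since the coefficients of
   an element of JP can be killed one generator at a time; it follows that S is
   fully faithful, and then so are F and G, computed on resolutions.

   Conversely, F kills the inclusion of J into A, and G kills the projection of a
   K-injective I onto I / {x | J x = 0}; fullness of F and G provides one-sided
   inverses of A -> S H, respectively of S (coind I) -> I, which are impossible as
   H^n(A) acts trivially on the cohomology of H-modules for n < 0. If S is full and
   H^k(A) = 0 for m < k < 0, the connecting morphism from S H to the shift of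
   H^m(A) comes from a morphism of complexes of H-modules starting at H in degree
   0, so it is zero; as H^m(A) is killed by J, this forces H^m(A) = 0.

   The functor S is faithful when the differential of A vanishes, because pi then
   has a section. It is not faithful when there are x, y in H with x^2 = x y = 0 and
   a nontrivial Massey product <y, x, x> in H^-1(A): this product is the obstruction
   to lifting the complex H -x-> H -x-> H -y-> H to A, and the corresponding map
   from this complex to H[3], nonzero in D(H), becomes zero in D(A). *)

From HB Require Import structures.
From mathcomp Require Import all_boot all_order all_algebra.
From mathcomp Require Import zify ring.
From mathcomp Require Import generic_quotient boolp functions.
Require Import Defs.

Set Implicit Arguments.
Unset Strict Implicit.
Unset Printing Implicit Defensive.

Import Order.TTheory GRing.Theory Num.Theory.
Local Open Scope ring_scope.

(** * Abelian groups *)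

(** A morphism of D(A) is a formal word in maps and inverted quasi-isomorphisms, with no calculus of
    fractions to normalize it. Two devices replace one. A word that starts at a K-projective or ends
    at a K-injective module is represented by an honest map, by induction on the word. Morphisms are
    separated by functors that turn quasi-isomorphisms into bijections: cocycles up to coboundaries,
    and homotopy classes of maps out of a K-projective module. F and G are known only through the
    axioms of a derived functor, that is, by naturality and invertibility on suitable resolutions;
    K-projective resolutions are constructed, while the K-injective ones are those supplied with G.
    In the converse for S, the target of the connecting morphism must lie in the image of S, so the
    shift of H^m(A), being killed by J, is embedded into a coinduced module. In the second
    counterexample, any A-module quasi-isomorphic to the complex can serve to see a morphism die in
    D(A), while K-projectivity over H shows that it was nonzero. *)

Section AbelianGroupNormalization.
Variable V : zmodType.

Inductive gexp := GZero | GVar of nat | GAdd of gexp & gexp | GOpp of gexp.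

Fixpoint geval (e : seq V) (t : gexp) : V :=
  match t with
  | GZero => 0
  | GVar i => nth 0 e i
  | GAdd t u => geval e t + geval e u
  | GOpp t => - geval e t
  end.

Fixpoint gcoef (t : gexp) (i : nat) : int :=
  match t with
  | GZero => 0
  | GVar j => if i == j then 1 else 0
  | GAdd t u => gcoef t i + gcoef u i
  | GOpp t => - gcoef t i
  end.

Lemma gevalE e t : geval e t = \sum_(i < size e) nth 0 e i *~ gcoef t i.
Proof.
elim: t => /= [|j|t -> u ->|t ->].
- by rewrite big1 // => i _; rewrite mulr0z.
- have [lt_j|le_j] := ltnP j (size e).
    rewrite (bigD1 (Ordinal lt_j)) //= eqxx mulr1z big1 ?addr0 // => i.
    by rewrite -val_eqE /= => /negPf ->; rewrite mulr0z.
  rewrite nth_default // big1 // => i _.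
  by have /ltn_eqF -> := ssrnat.leq_trans (ltn_ord i) le_j; rewrite mulr0z.
- by rewrite -big_split; apply: eq_bigr => i _; rewrite mulrzDr.
- by rewrite -sumrN; apply: eq_bigr => i _; rewrite mulrNz.
Qed.

(** By [gevalE] both sides are integer combinations of the same atoms, so equality is a finite check
    on coefficients, which can be computed. *)
Lemma geval_eq e t u :
  all (fun i => gcoef t i == gcoef u i) (iota 0 (size e)) -> geval e t = geval e u.
Proof.
move=> /allP tu; rewrite !gevalE; apply: eq_bigr => i _; congr (_ *~ _); apply/eqP.
by apply: tu; rewrite mem_iota add0n ltn_ord.
Qed.

End AbelianGroupNormalization.

Ltac abel_atom e x :=
  match e with
  | cons x _ => constr:(0%N)
  | cons ?y _ => let _ := match goal with _ => unify x y end in constr:(0%N)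
  | cons _ ?e' => let n := abel_atom e' x in constr:(S n)
  end.

Ltac abel_mem e x :=
  match e with
  | nil => constr:(false)
  | _ => let n := abel_atom e x in constr:(true)
  | _ => constr:(false)
  end.

Ltac abel_add e x :=
  lazymatch abel_mem e x with
  | true => e
  | false => constr:(cons x e)
  end.

Ltac abel_env e t :=
  lazymatch t with
  | (?x + ?y)%R => let e1 := abel_env e x in abel_env e1 y
  | (- ?x)%R => abel_env e x
  | 0%R => e
  | ?x => abel_add e x
  end.

Ltac abel_quote e t :=
  lazymatch t with
  | (?x + ?y)%R => let a := abel_quote e x in let b := abel_quote e y in constr:(GAdd a b)
  | (- ?x)%R => let a := abel_quote e x in constr:(GOpp a)
  | 0%R => constr:(GZero)
  | ?x => let n := abel_atom e x in constr:(GVar n)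
  end.

(* Linear identities in an abelian group; atoms are compared up to conversion. *)
Ltac abel :=
  lazymatch goal with
  | |- @eq ?T ?x ?y =>
    let e0 := constr:(@nil T) in
    let e1 := abel_env e0 x in let e := abel_env e1 y in
    let a := abel_quote e x in let b := abel_quote e y in
    refine (@geval_eq _ e a b _); vm_compute; reflexivity
  end.

(** * Categories and localizations *)

Section CategoryTheory.
Variable C : category.
Implicit Types x y z : C.

Lemma cancel_invl x y z (g : hom y z) (g' : hom z y) (f : hom x y) :
  heq (ccomp g' g) (idm y) -> heq (ccomp g' (ccomp g f)) f.
Proof.
move=> gg; apply: heq_trans (ccomp_idl f).
by apply: heq_trans (ccompA _ _ _) _; apply: ccomp_heq (heq_refl _).
Qed.

Lemma cancel_invr x y z (g : hom x y) (g' : hom y x) (f : hom y z) :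
  heq (ccomp g g') (idm y) -> heq (ccomp (ccomp f g) g') f.
Proof.
move=> gg; apply: heq_trans (ccomp_idr f).
apply: heq_trans (heq_sym (ccompA _ _ _)) _.
by apply: ccomp_heq gg; apply: heq_refl.
Qed.

Lemma compl x y z (g : hom y z) (f f' : hom x y) :
  heq f f' -> heq (ccomp g f) (ccomp g f').
Proof. by apply: ccomp_heq; apply: heq_refl. Qed.

Lemma compr x y z (g g' : hom y z) (f : hom x y) :
  heq g g' -> heq (ccomp g f) (ccomp g' f).
Proof. by move=> gg; apply: ccomp_heq gg _; apply: heq_refl. Qed.

Lemma iso_mono x y z (g : hom y z) (f f' : hom x y) :
  is_iso g -> heq (ccomp g f) (ccomp g f') -> heq f f'.
Proof.
case=> g' [gg _] e; apply: heq_trans (heq_sym (cancel_invl f gg)) _.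
by apply: heq_trans (cancel_invl f' gg); apply: compl.
Qed.

Lemma iso_epi x y z (g : hom x y) (f f' : hom y z) :
  is_iso g -> heq (ccomp f g) (ccomp f' g) -> heq f f'.
Proof.
case=> g' [_ gg] e; apply: heq_trans (heq_sym (cancel_invr f gg)) _.
by apply: heq_trans (cancel_invr f' gg); apply: compr.
Qed.

Lemma iso_sym x y (f : hom x y) : is_iso f ->
  exists2 g : hom y x, is_iso g & heq (ccomp g f) (idm x) /\ heq (ccomp f g) (idm y).
Proof. by case=> g [gf fg]; exists g => //; exists f. Qed.

Lemma iso_heq x y (f f' : hom x y) : heq f f' -> is_iso f -> is_iso f'.
Proof.
move=> ff [g [gf fg]]; exists g; split.
  by apply: heq_trans gf; apply: compl; apply: heq_sym.
by apply: heq_trans fg; apply: compr; apply: heq_sym.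
Qed.

Lemma iso_comp x y z (g : hom y z) (f : hom x y) :
  is_iso g -> is_iso f -> is_iso (ccomp g f).
Proof.
case=> g' [g1 g2] [f' [f1 f2]]; exists (ccomp f' g'); split.
  apply: heq_trans f1; apply: heq_trans (heq_sym (ccompA _ _ _)) _.
  by apply: compl; apply: cancel_invl.
apply: heq_trans g2; apply: heq_trans (heq_sym (ccompA _ _ _)) _.
apply: compl; exact: cancel_invl.
Qed.

Lemma iso_cancelr x y z (g : hom y z) (f : hom x y) :
  is_iso f -> is_iso (ccomp g f) -> is_iso g.
Proof.
move=> jf igf; have [f' ifi [_ ff]] := iso_sym jf.
by apply: iso_heq (cancel_invr g ff) _; apply: iso_comp.
Qed.

End CategoryTheory.

Section FunctorTheory.
Variables (C D : category) (F : functor C D).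

Lemma fmap_iso x y (f : hom x y) : is_iso f -> is_iso (fmap F f).
Proof.
case=> g [gf fg]; exists (fmap F g); split.
  apply: heq_trans (heq_sym (fmap_comp F g f)) _.
  by apply: heq_trans (fmap_id F x); apply: fmap_heq.
by apply: heq_trans (heq_sym (fmap_comp F f g)) _; apply: heq_trans (fmap_id F y); apply: fmap_heq.
Qed.

Variable K : C -> Prop.
Hypothesis Kiso : forall x, exists (x' : C) (p : hom x' x), K x' /\ is_iso p.

(** Conjugation by isomorphisms transports preimages, so only objects of [K] matter; for derived
    functors [K] will consist of well-behaved resolutions. *)
Lemma full_on_iso :
  (forall x y, K x -> K y -> forall g : hom (F x) (F y), exists f, heq (fmap F f) g) ->
  full F.
Proof.
move=> FK x y g; have [x' [p [Kx ip]]] := Kiso x; have [y' [q [Ky iq]]] := Kiso y.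
have [q' [q1 q2]] := fmap_iso iq; have [p' [p1 p2]] := ip.
have [f fe] := FK _ _ Kx Ky (ccomp q' (ccomp g (fmap F p))).
exists (ccomp q (ccomp f p')).
apply: heq_trans (fmap_comp F _ _) _; apply: heq_trans (compl _ (fmap_comp F _ _)) _.
apply: heq_trans (compl _ (compr _ fe)) _.
apply: heq_trans (compl _ (heq_sym (ccompA _ _ _))) _.
apply: heq_trans (cancel_invl _ q2) _; apply: cancel_invr.
apply: heq_trans (heq_sym (fmap_comp F _ _)) _.
by apply: heq_trans (fmap_id F _); apply: fmap_heq.
Qed.

Lemma faithful_on_iso :
  (forall x y, K x -> K y -> forall f g : hom x y,
     heq (fmap F f) (fmap F g) -> heq f g) ->
  faithful F.
Proof.
move=> FK x y f g fg; have [x' [p [Kx ip]]] := Kiso x; have [y' [q [Ky iq]]] := Kiso y.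
have [q' iq' [q1 q2]] := iso_sym iq.
apply: (iso_epi ip); apply: (iso_mono iq'); apply: FK => //.
apply: heq_trans (fmap_comp F _ _) _; apply: heq_trans (compl _ (fmap_comp F _ _)) _.
apply: heq_sym.
apply: heq_trans (fmap_comp F _ _) _; apply: heq_trans (compl _ (fmap_comp F _ _)) _.
by apply: compl; apply: compr; apply: heq_sym.
Qed.

End FunctorTheory.

(* A functor from C to setoids that turns the elements of W into bijections
   extends to the localization; this is how morphisms of D(A) are told apart. *)
Section LocalizationAction.
Variables (C : category) (W : forall x y : C, hom x y -> Prop).
Variables (E : C -> Type) (eqE : forall x, E x -> E x -> Prop).
Variable act : forall x y : C, hom x y -> E x -> E y.
Hypotheses (eq_refl : forall x (a : E x), eqE a a)
  (eq_sym : forall x (a b : E x), eqE a b -> eqE b a)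
  (eq_trans : forall x (a b c : E x), eqE a b -> eqE b c -> eqE a c).
Hypotheses
  (act_eq : forall x y (f g : hom x y) a b, heq f g -> eqE a b -> eqE (act f a) (act g b))
  (act_id : forall x (a : E x), eqE (act (idm x) a) a)
  (act_comp : forall x y z (g : hom y z) (f : hom x y) a,
     eqE (act (ccomp g f) a) (act g (act f a))).
Hypotheses
  (act_inj : forall x y (w : hom x y), W w ->
     forall a b, eqE (act w a) (act w b) -> eqE a b)
  (act_surj : forall x y (w : hom x y), W w -> forall b, exists a, eqE (act w a) b).

Definition inv_act x y (w : hom x y) (Ww : W w) (b : E y) : E x :=
  projT1 (cid (act_surj Ww b)).

Lemma inv_actK x y (w : hom x y) (Ww : W w) b : eqE (act w (inv_act Ww b)) b.
Proof. exact: projT2 (cid (act_surj Ww b)). Qed.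

Fixpoint loc_act x y (f : lhom W x y) : E x -> E y :=
  match f with
  | lof _ _ f => act f
  | linv _ _ _ Ww => inv_act Ww
  | lcomp _ _ _ g f => fun a => loc_act g (loc_act f a)
  end.

Lemma loc_act_eq x y (f : lhom W x y) a b : eqE a b -> eqE (loc_act f a) (loc_act f b).
Proof.
elim: f a b => {x y} /= [x y f|x y w Ww|x y z g IHg f IHf] a b ab.
- by apply: act_eq ab; apply: heq_refl.
- apply: (act_inj Ww); apply: eq_trans (inv_actK _ _) _.
  by apply: eq_trans ab _; apply: eq_sym; apply: inv_actK.
- by apply: IHg; apply: IHf.
Qed.

Lemma loc_act_leq x y (f g : lhom W x y) : leq f g -> forall a, eqE (loc_act f a) (loc_act g a).
Proof.
elim=> {x y f g} /=.
- by [].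
- by move=> x y f g _ fg a; apply: eq_sym.
- by move=> x y f g h _ fg _ gh a; apply: eq_trans (fg a) (gh a).
- move=> x y z g g' f f' _ gg _ ff a; apply: eq_trans (gg _) _.
  exact: loc_act_eq.
- by move=> x y f a; apply: act_id.
- by move=> x y f a; apply: loc_act_eq; apply: act_id.
- by [].
- by move=> x y f g fg a; apply: act_eq.
- by move=> x y z g f a; apply: act_comp.
- move=> x y w Ww a; apply: eq_trans (eq_sym (act_id _)).
  by apply: (act_inj Ww); apply: inv_actK.
- by move=> x y w Ww a; apply: eq_trans (inv_actK _ _) (eq_sym (act_id _)).
Qed.

End LocalizationAction.

Lemma loc_iso (C : category) (W : forall x y : C, hom x y -> Prop) (x y : C) (w : hom x y) :
  W x y w -> @is_iso (loc_cat W) x y (lof W w).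
Proof. by move=> Ww; exists (linv Ww); split; [apply: leq_invl|apply: leq_invr]. Qed.

(** * Graded maps and homotopies *)

(** A Koszul sign depends only on parities. Encoded by a boolean, signs compose by exclusive or, and
    sign checks become case analysis. *)
Definition par (n : int) : bool := odd `|n|%N.

Lemma parD m n : par (m + n) = par m (+) par n.
Proof. by rewrite /par; lia. Qed.

Lemma parN n : par (- n) = par n.
Proof. by rewrite /par abszN. Qed.

Lemma parM m n : par (m * n) = par m && par n.
Proof. by rewrite /par abszM oddM. Qed.

Definition sgn (V : zmodType) (b : bool) (x : V) : V := if b then - x else x.

Section Sign.
Variables (V : zmodType).
Implicit Types (x y : V) (b c : bool).

Lemma sgnD b x y : sgn b (x + y) = sgn b x + sgn b y.
Proof. by case: b => //=; rewrite opprD. Qed.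

Lemma sgnN b x : sgn b (- x) = - sgn b x.
Proof. by case: b. Qed.

Lemma sgn0 b : sgn b 0 = 0 :> V.
Proof. by case: b => //=; rewrite oppr0. Qed.

Lemma sgn_sgn b c x : sgn b (sgn c x) = sgn (b (+) c) x.
Proof. by case: b; case: c => //=; rewrite opprK. Qed.

Lemma sgnK b : involutive (@sgn V b).
Proof. by move=> x; rewrite sgn_sgn addbb. Qed.

End Sign.

Lemma morph0 (V W : zmodType) (f : V -> W) : {morph f : x y / x + y} -> f 0 = 0.
Proof. by move=> fD; apply: (addrI (f 0)); rewrite -fD !addr0. Qed.

Lemma morphN (V W : zmodType) (f : V -> W) : {morph f : x y / x + y} -> {morph f : x / - x}.
Proof. by move=> fD x; apply/eqP; rewrite -addr_eq0 -fD addNr (morph0 fD). Qed.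

Lemma morphB (V W : zmodType) (f : V -> W) :
  {morph f : x y / x + y} -> {morph f : x y / x - y}.
Proof. by move=> fD x y; rewrite fD morphN. Qed.

Lemma morph_sgn (V W : zmodType) (f : V -> W) b x :
  {morph f : x y / x + y} -> f (sgn b x) = sgn b (f x).
Proof. by move=> fD; rewrite /sgn; case: b; rewrite // morphN. Qed.

Section GradedGroups.
Variables (V : zmodType) (s : dgstruct V).

Lemma cmp0 n : cmp s n 0 = 0. Proof. by rewrite morph0 //; apply: cmpD. Qed.
Lemma cmpN n x : cmp s n (- x) = - cmp s n x.
Proof. by rewrite morphN //; apply: cmpD. Qed.
Lemma cmp_sgn n b x : cmp s n (sgn b x) = sgn b (cmp s n x).
Proof. by case: b => //=; rewrite cmpN. Qed.
Lemma dif0 : dif s 0 = 0. Proof. by rewrite morph0 //; apply: difD. Qed.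
Lemma difN x : dif s (- x) = - dif s x.
Proof. by rewrite morphN //; apply: difD. Qed.
Lemma difB x y : dif s (x - y) = dif s x - dif s y.
Proof. by rewrite difD difN. Qed.
Lemma dif_sgn b x : dif s (sgn b x) = sgn b (dif s x).
Proof. by case: b => //=; rewrite difN. Qed.

Lemma eq_cmp x y : (forall n, cmp s n x = cmp s n y) -> x = y.
Proof.
move=> xy; apply/eqP; rewrite -subr_eq0; apply/eqP.
have [r [_ ->]] := cmp_sum s (x - y).
by rewrite big1 // => n _; rewrite cmpD cmpN xy subrr.
Qed.

Lemma homog0 n : homog s n 0. Proof. exact: cmp0. Qed.
Lemma homogB n x y : homog s n x -> homog s n y -> homog s n (x - y).
Proof. by move=> hx hy; apply: homogD => //; apply: homogN. Qed.
Lemma homog_sgn n b x : homog s n x -> homog s n (sgn b x).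
Proof. by case: b => //=; apply: homogN. Qed.

Lemma coboundary0 n : coboundary s n 0.
Proof. by exists 0; rewrite ?dif0 //; apply: homog0. Qed.
Lemma coboundaryD n x y : coboundary s n x -> coboundary s n y -> coboundary s n (x + y).
Proof.
by move=> [x' hx ->] [y' hy ->]; exists (x' + y'); rewrite ?difD //; apply: homogD.
Qed.
Lemma coboundaryN n x : coboundary s n x -> coboundary s n (- x).
Proof. by move=> [x' hx ->]; exists (- x'); rewrite ?difN //; apply: homogN. Qed.
Lemma coboundaryB n x y : coboundary s n x -> coboundary s n y -> coboundary s n (x - y).
Proof. by move=> bx b_y; apply: coboundaryD => //; apply: coboundaryN. Qed.
Lemma coboundary_cocycle n x : coboundary s n x -> cocycle s n x.
Proof.
by move=> [y hy ->]; split; [rewrite -[n](subrK 1); apply: homog_dif|rewrite dif_dif].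
Qed.
Lemma coboundary_eq n x y : coboundary s n (x - y) -> coboundary s n y -> coboundary s n x.
Proof. by move=> bxy b_y; rewrite -[x](subrK y); apply: coboundaryD. Qed.
Lemma coboundary_dif n y : homog s (n - 1) y -> coboundary s n (dif s y).
Proof. by exists y. Qed.

Lemma cocycle0 n : cocycle s n 0. Proof. by split; [apply: homog0|apply: dif0]. Qed.
Lemma cocycleB n x y : cocycle s n x -> cocycle s n y -> cocycle s n (x - y).
Proof. by move=> [hx dx] [hy dy]; split; [apply: homogB|rewrite difB dx dy subrr]. Qed.

End GradedGroups.

Section Twist.
Variable A : dgring.
Local Notation sA := (dgr_st A).

(** The degrees occurring in an element are only known to exist, so the twisted element is built by
    induction on homogeneous sums and then chosen; [eq_cmp] makes it unique. *)
Fact twist_ex (a : A) : exists b, forall n, cmp sA n b = sgn (par n) (cmp sA n a).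
Proof.
elim/(homog_ind (s := sA)): a => [|a b [a' ea] [b' eb]|i a ha].
- by exists 0 => n; rewrite cmp0 sgn0.
- by exists (a' + b') => n; rewrite !cmpD ea eb sgnD.
exists (sgn (par i) a) => n; rewrite cmp_sgn.
by have [->//|ni] := eqVneq n i; rewrite (homog_neq ha ni) !sgn0.
Qed.

(* The automorphism a |-> (-1)^|a| a, or the identity if b is false. *)
Definition twist (b : bool) (a : A) : A := if b then projT1 (cid (twist_ex a)) else a.
Arguments twist : simpl never.

Lemma cmp_twist b n a : cmp sA n (twist b a) = sgn (b && par n) (cmp sA n a).
Proof. by rewrite /twist; case: b => //=; apply: (projT2 (cid (twist_ex a))). Qed.

Lemma twist_homog b i a : homog sA i a -> twist b a = sgn (b && par i) a.
Proof.
move=> ha; apply: (eq_cmp (s := sA)) => n; rewrite cmp_twist cmp_sgn.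
by have [->//|ni] := eqVneq n i; rewrite (homog_neq ha ni) !sgn0.
Qed.

Lemma twist_cmp b n a : twist b (cmp sA n a) = cmp sA n (twist b a).
Proof. by rewrite (twist_homog b (homog_cmp _ n a)) cmp_twist. Qed.

Lemma twist_par0 a : twist (par 0) a = a. Proof. by []. Qed.

Lemma twistD b : {morph twist b : x y / x + y}.
Proof.
by move=> x y; apply: (eq_cmp (s := sA)) => n; rewrite cmpD !cmp_twist cmpD sgnD.
Qed.

Lemma twist0 b : twist b 0 = 0.
Proof. exact: morph0 (twistD b). Qed.

Lemma twistM b : {morph twist b : x y / x * y}.
Proof.
move=> x y; elim/(homog_ind (s := sA)): x => [|x x' IH IH'|i x hx].
- by rewrite mul0r twist0 mul0r.
- by rewrite mulrDl !twistD IH IH' mulrDl.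
elim/(homog_ind (s := sA)): y => [|y y' IH IH'|j y hy].
- by rewrite mulr0 twist0 mulr0.
- by rewrite mulrDr !twistD IH IH' mulrDr.
rewrite (twist_homog _ hx) (twist_homog _ hy) (twist_homog _ (dgr_mul hx hy)).
by rewrite parD; case: b (par i) (par j) => - [] [] //=; rewrite ?mulrNN ?mulrN ?mulNr.
Qed.

Lemma twist1 b : twist b 1 = 1.
Proof. by rewrite (twist_homog _ (dgr_1 A)) andbF. Qed.

Lemma twist_twist b c a : twist b (twist c a) = twist (b (+) c) a.
Proof.
apply: (eq_cmp (s := sA)) => n; rewrite !cmp_twist sgn_sgn.
by case: b c (par n) => - [] [].
Qed.

Lemma twistK b : involutive (twist b).
Proof. by move=> a; rewrite twist_twist addbb. Qed.

Lemma dif_twist b a : dif sA (twist b a) = sgn b (twist b (dif sA a)).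
Proof.
apply: (eq_cmp (s := sA)) => n.
rewrite dif_cmpE cmp_sgn !cmp_twist dif_sgn dif_cmpE sgn_sgn; congr (sgn _ _).
by rewrite parD parN; case: b (par n) => - [].
Qed.

(** The twist absorbs the sign (-1)^|a|, which frees the Leibniz rule from homogeneity; coefficients
    in free modules can then be differentiated as they are. *)
Lemma leibniz (M : dgmod A) (a : A) (m : M) :
  dif (dgm_st M) (a *: m) = dif sA a *: m + twist true a *: dif (dgm_st M) m.
Proof.
elim/(homog_ind (s := sA)): a => [|a b IH IH'|i a ha].
- by rewrite scale0r !dif0 twist0 !scale0r addr0.
- by rewrite scalerDl !difD IH IH' twistD !scalerDl addrACA.
rewrite (dgm_leibniz _ ha) (twist_homog _ ha) scale_sign /= /sgn /par.
by case: ifP; rewrite ?scaleNr.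
Qed.

(** The sign only affects odd degrees, and [piH] sees only degree 0. *)
Lemma piH_twist b (a : A) : piH A (twist b a) = piH A a.
Proof.
elim/(homog_ind (s := sA)): a => [|a a' IH IH'|i a ha].
- by rewrite twist0.
- by rewrite twistD !drhD IH IH'.
rewrite (twist_homog _ ha); have [->|i0] := eqVneq i 0; first by rewrite andbF.
by rewrite !(@piH_homog _ i) //; apply: homog_sgn.
Qed.

End Twist.
Arguments twist : simpl never.

Section GradedHoms.
Variables (A : dgring) (M N : dgmod A).
Local Notation sA := (dgr_st A).
Local Notation sM := (dgm_st M).
Local Notation sN := (dgm_st N).

Lemma scale_sgn b (a : A) (x : M) : a *: sgn b x = sgn b (a *: x).
Proof. by rewrite /sgn; case: b; rewrite // scalerN. Qed.

Lemma sgn_scale b (a : A) (x : M) : sgn b a *: x = sgn b (a *: x).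
Proof. by rewrite /sgn; case: b; rewrite // scaleNr. Qed.

(** The conditions are restated for arbitrary elements: the degree becomes commutation with the
    projections and the Koszul sign becomes a twist. Most later verifications go through this
    form. *)
Lemma graded_homP n (f : M -> N) : graded_hom n f <->
  [/\ {morph f : x y / x + y}, forall k x, cmp sN (k + n) (f x) = f (cmp sM k x)
    & forall a x, f (a *: x) = twist (par n) a *: f x].
Proof.
split=> -[fD fh fZ].
  split=> // [k x|a x].
    elim/(homog_ind (s := sM)): x => [|x y IH IH'|j x hx].
    - by rewrite cmp0 morph0 ?cmp0.
    - by rewrite fD !cmpD IH IH' fD.
    have [->|kj] := eqVneq k j; first by rewrite hx; apply: fh.
    rewrite (homog_neq hx kj) (homog_neq (fh _ _ hx)) ?morph0 //.
    by rewrite (inj_eq (addIr n)).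
  elim/(homog_ind (s := sA)): a => [|a b IH IH'|i a ha].
  - by rewrite twist0 !scale0r morph0.
  - by rewrite twistD !scalerDl fD IH IH'.
  rewrite (fZ _ _ _ ha) (twist_homog _ ha) scale_sign -/(par (i * n)) parM andbC.
  by rewrite /sgn; case: ifP; rewrite ?scaleNr.
split=> // [k x hx|i a x ha]; first by rewrite /homog fh hx.
rewrite fZ (twist_homog _ ha) scale_sign -/(par (i * n)) parM andbC.
by rewrite /sgn; case: ifP; rewrite ?scaleNr.
Qed.

Lemma hom_difE n (f : M -> N) x : hom_dif n f x = dif sN (f x) - sgn (par n) (f (dif sM x)).
Proof. by rewrite /hom_dif scale_sign. Qed.

Section GHom.
Variables (n : int) (f : M -> N).
Hypothesis hf : graded_hom n f.
Lemma ghD : {morph f : x y / x + y}. Proof. by case/graded_homP: hf. Qed.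
Lemma gh0 : f 0 = 0. Proof. exact: morph0 ghD. Qed.
Lemma ghN x : f (- x) = - f x. Proof. exact: (morphN ghD). Qed.
Lemma gh_cmp k x : f (cmp sM k x) = cmp sN (k + n) (f x).
Proof. by case/graded_homP: hf. Qed.
Lemma ghZ a x : f (a *: x) = twist (par n) a *: f x.
Proof. by case/graded_homP: hf. Qed.
Lemma gh_homog k x : homog sM k x -> homog sN (k + n) (f x).
Proof. by case: hf => _ h _; apply: h. Qed.
End GHom.

Lemma graded_homD n f g : graded_hom n f -> graded_hom n g ->
  graded_hom n (fun x : M => f x + g x : N).
Proof.
move=> hf hg; apply/graded_homP; split=> [x y|k x|a x].
- by rewrite (ghD hf) (ghD hg) addrACA.
- by rewrite cmpD (gh_cmp hf) (gh_cmp hg).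
- by rewrite (ghZ hf) (ghZ hg) scalerDr.
Qed.

Lemma graded_hom_sgn n b f : graded_hom n f -> graded_hom n (fun x : M => sgn b (f x) : N).
Proof.
move=> hf; apply/graded_homP; split=> [x y|k x|a x].
- by rewrite (ghD hf) sgnD.
- by rewrite cmp_sgn (gh_cmp hf).
- by rewrite (ghZ hf); case: (b); rewrite /= ?scalerN.
Qed.

Lemma graded_hom0 n : graded_hom n (fun _ : M => 0 : N).
Proof.
apply/graded_homP; split=> [x y|k x|a x]; first by rewrite addr0.
  by rewrite cmp0.
by rewrite scaler0.
Qed.

Lemma hom_difD n f g x : graded_hom n f -> graded_hom n g ->
  hom_dif n (fun x : M => f x + g x : N) x = hom_dif n f x + hom_dif n g x.
Proof. by move=> hf hg; rewrite !hom_difE difD sgnD opprD addrACA. Qed.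

Lemma hom_dif_sgn n b f x : graded_hom n f ->
  hom_dif n (fun x : M => sgn b (f x) : N) x = sgn b (hom_dif n f x).
Proof.
by move=> hf; rewrite !hom_difE dif_sgn sgnD sgnN !sgn_sgn addbC.
Qed.

Lemma dghom_graded (f : dghom M N) : graded_hom 0 f.
Proof.
apply/graded_homP; split=> [||a x]; first exact: dmhD.
  by move=> k x; rewrite addr0 dmh_cmp.
by rewrite dmhZ.
Qed.

Lemma dghom_cocycle (f : dghom M N) x : hom_dif 0 f x = 0.
Proof. by rewrite hom_difE dmh_dif subrr. Qed.

Definition dghom_of (f : M -> N) (hf : graded_hom 0 f)
  (df : forall x, hom_dif 0 f x = 0) : dghom M N.
Proof.
exists f.
- exact: ghD hf.
- by move=> a x; rewrite (ghZ hf).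
- by move=> k x; rewrite (gh_cmp hf) addr0.
- by move=> x; apply/esym/eqP; rewrite -subr_eq0 -[X in _ - X]/(sgn (par 0) _) -hom_difE df.
Defined.

Lemma dmh0 (f : dghom M N) : f 0 = 0. Proof. exact: morph0 (dmhD f). Qed.
Lemma dmhN (f : dghom M N) x : f (- x) = - f x. Proof. exact: (morphN (dmhD f)). Qed.
Lemma dmhB (f : dghom M N) x y : f (x - y) = f x - f y.
Proof. exact: (morphB (dmhD f)). Qed.
Lemma dmh_sgn (f : dghom M N) b x : f (sgn b x) = sgn b (f x).
Proof. exact: (morph_sgn b x (dmhD f)). Qed.
Lemma dmh_homog (f : dghom M N) n x : homog sM n x -> homog sN n (f x).
Proof. by move=> hx; rewrite /homog -dmh_cmp hx. Qed.
Lemma dmh_cocycle (f : dghom M N) n x : cocycle sM n x -> cocycle sN n (f x).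
Proof. by case=> hx dx; split; [apply: dmh_homog|rewrite -dmh_dif dx dmh0]. Qed.
Lemma dmh_coboundary (f : dghom M N) n x : coboundary sM n x -> coboundary sN n (f x).
Proof. by case=> y hy ->; exists (f y); [apply: dmh_homog|rewrite dmh_dif]. Qed.

Definition homotopic (f g : dghom M N) : Prop :=
  exists2 h : M -> N, graded_hom (-1) h & forall x, f x - g x = hom_dif (-1) h x.

Lemma hom_difN1 (h : M -> N) x : hom_dif (-1) h x = dif sN (h x) + h (dif sM x).
Proof. by rewrite hom_difE /= opprK. Qed.

Lemma homotopic_eq (f g : dghom M N) : f =1 g -> homotopic f g.
Proof.
move=> fg; exists (fun=> 0); first exact: graded_hom0.
by move=> x; rewrite hom_difN1 dif0 addr0 fg subrr.
Qed.

Lemma homotopic_sym f g : homotopic f g -> homotopic g f.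
Proof.
case=> h hh e; exists (fun x => sgn true (h x)); first exact: graded_hom_sgn.
by move=> x; rewrite hom_dif_sgn // -e /= opprB.
Qed.

Lemma homotopic_trans f g k : homotopic f g -> homotopic g k -> homotopic f k.
Proof.
case=> h hh e [h' hh' e']; exists (fun x => h x + h' x); first exact: graded_homD.
by move=> x; rewrite hom_difD // -e -e' addrA subrK.
Qed.

Lemma homotopic_coboundary f g n x : homotopic f g -> cocycle sM n x ->
  coboundary sN n (f x - g x).
Proof.
case=> h hh e [hx dx]; exists (h x); first exact: gh_homog hh _ _ hx.
by rewrite e hom_difN1 dx (gh0 hh) addr0.
Qed.

End GradedHoms.

Lemma graded_hom_post (A : dgring) (M N P : dgmod A) (g : dghom N P) n (f : M -> N) :
  graded_hom n f -> graded_hom n (fun x => g (f x)).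
Proof.
move=> hf; apply/graded_homP; split=> [x y|k x|a x].
- by rewrite (ghD hf) dmhD.
- by rewrite (gh_cmp hf) dmh_cmp.
- by rewrite (ghZ hf) dmhZ.
Qed.

Lemma graded_hom_pre (A : dgring) (M N P : dgmod A) (f : dghom M N) n (g : N -> P) :
  graded_hom n g -> graded_hom n (fun x => g (f x)).
Proof.
move=> hg; apply/graded_homP; split=> [x y|k x|a x].
- by rewrite dmhD (ghD hg).
- by rewrite dmh_cmp (gh_cmp hg).
- by rewrite dmhZ (ghZ hg).
Qed.

Lemma hom_dif_post (A : dgring) (M N P : dgmod A) (g : dghom N P) n (f : M -> N) x :
  hom_dif n (fun x => g (f x)) x = g (hom_dif n f x).
Proof. by rewrite !hom_difE dmhB dmh_sgn dmh_dif. Qed.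

Lemma hom_dif_pre (A : dgring) (M N P : dgmod A) (f : dghom M N) n (g : N -> P) x :
  hom_dif n (fun x => g (f x)) x = hom_dif n g (f x).
Proof. by rewrite !hom_difE dmh_dif. Qed.

Lemma homotopic_post (A : dgring) (M N P : dgmod A) (g : dghom N P) (f f' : dghom M N) :
  homotopic f f' -> homotopic (dghom_comp g f) (dghom_comp g f').
Proof.
case=> h hh e; exists (fun x => g (h x)); first exact: graded_hom_post.
by move=> x; rewrite hom_dif_post -e /= dmhB.
Qed.

Lemma homotopic_pre (A : dgring) (M N P : dgmod A) (f : dghom M N) (g g' : dghom N P) :
  homotopic g g' -> homotopic (dghom_comp g f) (dghom_comp g' f).
Proof.
case=> h hh e; exists (fun x => h (f x)); first exact: graded_hom_pre.
by move=> x; rewrite hom_dif_pre -e.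
Qed.

Section QuasiIso.
Variable A : dgring.

Lemma qis_cancelr (M N P : dgmod A) (g : dghom N P) (f : dghom M N) :
  dg_qis f -> dg_qis (dghom_comp g f) -> dg_qis g.
Proof.
move=> qf qgf n; split=> [y cy b_y|z cz].
  have [x cx bx] := (qf n).2 _ cy.
  apply: (coboundary_eq bx); apply: dmh_coboundary; apply: (qgf n).1 => //=.
  rewrite -[X in coboundary _ _ X](subKr (g y)) -(dmhB g).
  by apply: coboundaryB => //; apply: (dmh_coboundary g).
have [x cx bx] := (qgf n).2 _ cz.
by exists (f x) => //; apply: dmh_cocycle.
Qed.

Lemma qis_eq (M N : dgmod A) (f g : dghom M N) : f =1 g -> dg_qis f -> dg_qis g.
Proof.
move=> fg qf n; split=> [x|y cy]; first by rewrite -fg; apply: (qf n).1.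
by have [x cx bx] := (qf n).2 _ cy; exists x => //; rewrite -fg.
Qed.

End QuasiIso.

(** The second hypothesis says that the kernel of [t] is acyclic, so this is the long exact sequence
    of kernel, [X] and [Y], done by a diagram chase. *)
Lemma surj_acyclic_ker_qis (A : dgring) (X Y : dgmod A) (t : dghom X Y) :
  (forall y, exists x, y = t x) ->
  (forall n x, cocycle (dgm_st X) n x -> t x = 0 ->
    exists z, [/\ homog (dgm_st X) (n - 1) z, t z = 0 & x = dif (dgm_st X) z]) ->
  dg_qis t.
Proof.
move=> tsurj tker n; split=> [x cx [y hy ey]|y [hy dy]].
  (* A preimage may be inhomogeneous, but its component of the right degree still maps to [y]. *)
  have [m em] := tsurj y; pose m' := cmp (dgm_st X) (n - 1) m.
  have c1 : cocycle (dgm_st X) n (x - dif (dgm_st X) m').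
    by apply: cocycleB => //; apply/coboundary_cocycle/coboundary_dif/homog_cmp.
  have [|z [hz _ ez]] := tker _ _ c1.
    by rewrite dmhB ey dmh_dif dmh_cmp -em hy subrr.
  exists (z + m'); first by apply: homogD => //; apply: homog_cmp.
  by rewrite difD -ez subrK.
have [m em] := tsurj y; pose m' := cmp (dgm_st X) n m.
have em' : t m' = y by rewrite dmh_cmp -em hy.
have c1 : cocycle (dgm_st X) (n + 1) (dif (dgm_st X) m').
  by split; [apply: homog_dif; apply: homog_cmp|apply: dif_dif].
have [|z [hz z0 ez]] := tker _ _ c1; first by rewrite dmh_dif em'.
rewrite addrK in hz.
exists (m' - z).
  by split; [apply: homogB => //; apply: homog_cmp|rewrite difB ez subrr].
by rewrite dmhB em' z0 subr0 subrr; apply: coboundary0.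
Qed.

(** * Cones, K-projective and K-injective DG-modules *)

Lemma fs_transfer (V W : zmodType) (s : dgstruct V) (c : int -> W -> W) (j : V -> W) (k : int) :
  {morph j : x y / x + y} -> (forall n x, c n (j x) = j (cmp s (n + k) x)) ->
  forall x, exists r : seq int, uniq r /\ j x = \sum_(n <- r) c n (j x).
Proof.
move=> jD cj x; have [r [ur er]] := cmp_sum s x.
exists [seq n - k | n <- r]; split.
  by rewrite map_inj_uniq // => m n /addIr.
rewrite big_map {1}er (big_morph j jD (morph0 jD)).
by apply: eq_bigr => n _; rewrite cj subrK.
Qed.

Section DirectSum.
Variables (A : dgring) (M N : dgmod A).

Definition dsum_cmp n (x : M * N) : M * N := (cmp (dgm_st M) n x.1, cmp (dgm_st N) n x.2).
Definition dsum_dif (x : M * N) : M * N := (dif (dgm_st M) x.1, dif (dgm_st N) x.2).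

Fact dsum_cmpD n : {morph dsum_cmp n : x y / x + y}.
Proof. by move=> x y; congr pair; apply: cmpD. Qed.

Fact dsum_cmp_cmp m n x : dsum_cmp m (dsum_cmp n x) = if m == n then dsum_cmp n x else 0.
Proof. by rewrite /dsum_cmp /= !cmp_cmp; case: ifP. Qed.

Definition dsum_st : dgstruct (M * N)%type.
Proof.
exists dsum_cmp dsum_dif.
- exact: dsum_cmpD.
- exact: dsum_cmp_cmp.
- move=> [x y]; have -> : (x, y) = (x, 0) + (0, y) by congr pair; rewrite /= ?addr0 ?add0r.
  apply: (fsD dsum_cmpD dsum_cmp_cmp).
    apply: (@fs_transfer _ _ (dgm_st M) _ (fun x => (x, 0)) 0) => [u v|n u].
      by congr pair; rewrite /= addr0.
    by rewrite /dsum_cmp /= cmp0 addr0.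
  apply: (@fs_transfer _ _ (dgm_st N) _ (fun x => (0, x)) 0) => [u v|n u].
    by congr pair; rewrite /= addr0.
  by rewrite /dsum_cmp /= cmp0 addr0.
- by move=> x y; congr pair; apply: difD.
- by move=> n x; rewrite /dsum_cmp /= !dif_cmp.
- by move=> x; rewrite /dsum_dif /= !dif_dif.
Defined.

Definition dsum : dgmod A.
Proof.
exists (M * N)%type dsum_st.
- by move=> i j a [x y] ha [hx hy]; congr pair; apply: dgm_scale.
- by move=> i a [x y] ha; congr pair; apply: dgm_leibniz.
Defined.

Definition dsum_pair (X : dgmod A) (f : dghom X M) (g : dghom X N) : dghom X dsum.
Proof.
exists (fun x => (f x, g x) : dsum) => [x y|a x|n x|x].
- by rewrite !dmhD.
- by rewrite !dmhZ.
- by rewrite !dmh_cmp.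
- by rewrite !dmh_dif.
Defined.

End DirectSum.

Definition dghom_opp (A : dgring) (M N : dgmod A) (f : dghom M N) : dghom M N.
Proof.
exists (fun x => - f x) => [x y|a x|n x|x].
- by rewrite dmhD opprD.
- by rewrite dmhZ scalerN.
- by rewrite dmh_cmp cmpN.
- by rewrite dmh_dif difN.
Defined.

Definition dghom0 (A : dgring) (M N : dgmod A) : dghom M N.
Proof.
exists (fun _ => 0) => [x y|a x|n x|x]; rewrite ?addr0 ?scaler0 ?cmp0 ?dif0 //.
Defined.

Section Cone.
Variables (A : dgring) (X Y : dgmod A) (w : dghom X Y).
Local Notation sX := (dgm_st X).
Local Notation sY := (dgm_st Y).

Definition cone_car : Type := (X * Y)%type.
HB.instance Definition _ := GRing.Zmodule.on cone_car.

(** The first summand is the shift X[1], where moving [a] past the shift costs the sign (-1)^|a|. *)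
Definition cone_scale (a : A) (z : cone_car) : cone_car := (twist true a *: z.1, a *: z.2).

Fact cone_scaleA a b z : cone_scale a (cone_scale b z) = cone_scale (a * b) z.
Proof. by rewrite /cone_scale /= !scalerA twistM. Qed.
Fact cone_scale1 : left_id 1 cone_scale.
Proof. by move=> [x y]; rewrite /cone_scale /= twist1 !scale1r. Qed.
Fact cone_scaleDr : right_distributive cone_scale +%R.
Proof. by move=> a x y; congr pair; apply: scalerDr. Qed.
Fact cone_scaleDl z : {morph cone_scale^~ z : a b / a + b}.
Proof. by move=> a b; congr pair; rewrite /= ?twistD scalerDl. Qed.
HB.instance Definition _ := GRing.Zmodule_isLmodule.Build A cone_car
  cone_scaleA cone_scale1 cone_scaleDr cone_scaleDl.

Definition cone_cmp n (z : cone_car) : cone_car := (cmp sX (n + 1) z.1, cmp sY n z.2).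
Definition cone_dif (z : cone_car) : cone_car := (- dif sX z.1, w z.1 + dif sY z.2).

Fact cone_cmpD n : {morph cone_cmp n : x y / x + y}.
Proof. by move=> x y; congr pair; apply: cmpD. Qed.

Fact cone_cmp_cmp m n x : cone_cmp m (cone_cmp n x) = if m == n then cone_cmp n x else 0.
Proof. by rewrite /cone_cmp /= !cmp_cmp (inj_eq (addIr 1)); case: ifP. Qed.

Definition cone_st : dgstruct cone_car.
Proof.
exists cone_cmp cone_dif.
- exact: cone_cmpD.
- exact: cone_cmp_cmp.
- move=> [x y]; have -> : (x, y) = (x, 0) + (0, y) :> cone_car.
    by congr pair; rewrite /= ?addr0 ?add0r.
  apply: (fsD cone_cmpD cone_cmp_cmp).
    apply: (@fs_transfer _ _ sX _ (fun x => (x, 0) : cone_car) 1) => [u v|n u].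
      by congr pair; rewrite /= addr0.
    by rewrite /cone_cmp /= cmp0.
  apply: (@fs_transfer _ _ sY _ (fun x => (0, x) : cone_car) 0) => [u v|n u].
    by congr pair; rewrite /= addr0.
  by rewrite /cone_cmp /= cmp0 addr0.
- move=> x y; congr pair; rewrite /= ?difD ?dmhD ?opprD //.
  by rewrite addrACA.
- by move=> n x; rewrite /cone_cmp /cone_dif /= cmpN cmpD !dif_cmp -dmh_cmp.
- move=> x; congr pair; rewrite /= ?difN ?difD !dif_dif ?oppr0 // dmhN dmh_dif addr0.
  by rewrite addNr.
Defined.

Definition cone : dgmod A.
Proof.
exists cone_car cone_st.
- move=> i j a [x y] ha [hx hy]; congr pair => /=; last exact: dgm_scale.
  by rewrite -addrA; apply: dgm_scale hx; rewrite (twist_homog _ ha); apply: homog_sgn.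
- move=> i a [x y] ha; rewrite scale_sign -/(sgn (par i) _).
  have tE (M : dgmod A) (m : M) : sgn (par i) (a *: m) = twist true a *: m.
    by rewrite (twist_homog _ ha) sgn_scale.
  have -> : sgn (par i) (a *: cone_dif (x, y)) =
      (sgn (par i) (twist true a *: - dif sX x), sgn (par i) (a *: (w x + dif sY y))) :> cone_car.
    by rewrite /sgn; case: (par i).
  congr pair; rewrite /= !leibniz.
    rewrite (twist_homog _ ha) -(twist_homog true ha) twistK dif_twist /= scaleNr.
    rewrite (twist_homog _ ha) sgn_scale sgnK opprD opprK; congr (_ + _).
    by rewrite scalerN.
  by rewrite tE dmhZ scalerDr addrCA.
Defined.

Definition cone_in : dghom Y cone.
Proof.
exists (fun y => (0, y) : cone) => [x y|a x|n x|x].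
- by congr pair; rewrite /= addr0.
- by congr pair; rewrite /= scaler0.
- by congr pair; rewrite /= cmp0.
- by congr pair; rewrite /= ?dif0 ?oppr0 // dmh0 add0r.
Defined.

Lemma cone_acyclic : dg_qis w -> acyclic (dgm_st cone).
Proof.
move=> qw n [x y] [[hx hy] [dx dy]].
have {}dx : dif sX x = 0 by apply/eqP; rewrite -oppr_eq0 dx.
have cx : cocycle sX (n + 1) x by [].
have [x' hx' ex] : coboundary sX (n + 1) x.
  apply: (qw (n + 1)).1 => //; exists (- y).
    by apply: homogN; rewrite addrK.
  by rewrite difN; apply/eqP; rewrite -addr_eq0 dy.
rewrite addrK in hx'.
have cy : cocycle sY n (y + w x').
  split; first by apply: homogD => //; apply: dmh_homog.
  by rewrite difD -dmh_dif -ex addrC dy.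
have [x2 [hx2 dx2] [y' hy' ey]] := (qw n).2 _ cy.
(* [x'] bounds [x], so [y + w x'] is a cocycle; it equals [w x2] up to the boundary of [y']. *)
exists (x2 - x', y').
  congr pair => //; change (homog sX (n - 1 + 1) (x2 - x')); rewrite subrK.
  exact: homogB.
congr pair; rewrite /= ?difB ?dx2 ?sub0r ?opprK //.
by rewrite -ey dmhB addrC addrA subrK addrK.
Qed.

Section MapsToCone.
Variable P : dgmod A.

Lemma cone_pair_graded n (f : P -> X) (g : P -> Y) :
  graded_hom (n + 1) f -> graded_hom n g -> graded_hom n (fun x => (f x, g x) : cone).
Proof.
move=> hf hg; apply/graded_homP; split=> [x y|k x|a x]; congr pair => /=.
- exact: ghD hf _ _.
- exact: ghD hg _ _.
- by rewrite (gh_cmp hf) addrA.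
- by rewrite (gh_cmp hg).
- by rewrite (ghZ hf) twist_twist parD addbC.
- by rewrite (ghZ hg).
Qed.

Lemma cone_fst_graded n (h : P -> cone) :
  graded_hom n h -> graded_hom (n + 1) (fun x => (h x).1 : X).
Proof.
move=> hh; apply/graded_homP; split=> [x y|k x|a x].
- by rewrite (ghD hh).
- by rewrite (gh_cmp hh) addrA.
- by rewrite (ghZ hh) /= twist_twist parD addbC.
Qed.

Lemma cone_snd_graded n (h : P -> cone) :
  graded_hom n h -> graded_hom n (fun x => (h x).2 : Y).
Proof.
move=> hh; apply/graded_homP; split=> [x y|k x|a x].
- by rewrite (ghD hh).
- by rewrite (gh_cmp hh).
- by rewrite (ghZ hh).
Qed.

End MapsToCone.

Section MapsFromCone.
Variable I : dgmod A.

Lemma cone_copair_graded n (f : X -> I) (g : Y -> I) :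
  graded_hom (n - 1) f -> graded_hom n g -> graded_hom n (fun z : cone => f z.1 + g z.2).
Proof.
move=> hf hg; apply/graded_homP; split=> [x y|k x|a x] /=.
- by rewrite (ghD hf) (ghD hg) addrACA.
- by rewrite cmpD (gh_cmp hf) (gh_cmp hg); congr (cmp _ _ _ + _); lia.
- by rewrite (ghZ hf) (ghZ hg) twist_twist parD parN addbK scalerDr.
Qed.

Lemma cone_inl_graded n (h : cone -> I) :
  graded_hom n h -> graded_hom (n - 1) (fun x => h (x, 0)).
Proof.
move=> hh; apply/graded_homP; split=> [x y|k x|a x].
- by rewrite -(ghD hh); congr h; congr pair; rewrite /= addr0.
- have := gh_cmp hh (k - 1) (x, 0); rewrite /= /cone_cmp /= cmp0 subrK => ->.
  by congr (cmp _ _ _); lia.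
- have := ghZ hh (twist true a) (x, 0).
  rewrite twist_twist /GRing.scale /= /cone_scale /= twistK scaler0 => ->.
  by rewrite parD parN addbC.
Qed.

Lemma cone_inr_graded n (h : cone -> I) :
  graded_hom n h -> graded_hom n (fun x => h (0, x)).
Proof. exact: (@graded_hom_pre _ _ _ _ cone_in). Qed.

End MapsFromCone.
End Cone.

Section Projective.
Variables (A : dgring) (P : dgmod A).
Hypothesis KP : K_projective P.
Variables (X Y : dgmod A) (w : dghom X Y).
Hypothesis qw : dg_qis w.

(** Followed by the inclusion of [Y] in the acyclic cone, [f] is null-homotopic. The [X] component
    of the null-homotopy is the lift and its [Y] component is the homotopy. *)
Lemma Kproj_lift (f : dghom P Y) : exists g : dghom P X, homotopic (dghom_comp w g) f.
Proof.
pose phi := dghom_comp (cone_in w) f.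
have [h hh eh] := KP (cone_acyclic qw) (dghom_graded phi) (dghom_cocycle phi).
rewrite sub0r in hh eh.
have h1 := cone_fst_graded hh; have h2 := cone_snd_graded hh.
rewrite addNr in h1.
have e1 x : hom_dif 0 (fun x : P => (h x).1 : X) x = 0.
  have /(congr1 fst) := eh x; rewrite hom_difN1 /= => e.
  by move/eqP: e; rewrite eq_sym addrC subr_eq0 hom_difE /= => /eqP ->; rewrite subrr.
exists (dghom_of h1 e1); apply: homotopic_sym; exists (fun x => (h x).2 : Y) => // x.
have /(congr1 snd) := eh x; rewrite !hom_difN1 /= => ->.
by abel.
Qed.

(** A homotopy [s] between [w f] and [w g] makes [(f - g, - s)] a closed map of degree -1 into the
    acyclic cone; the [X] component of a primitive is, up to sign, a homotopy between [f] and
    [g]. *)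
Lemma Kproj_mono (f g : dghom P X) :
  homotopic (dghom_comp w f) (dghom_comp w g) -> homotopic f g.
Proof.
move=> [s hs es].
pose th x : cone w := (f x - g x, - s x).
have hth : graded_hom (-1) th.
  apply: cone_pair_graded; last by have := graded_hom_sgn true hs.
  rewrite addNr; apply: graded_homD; first exact: dghom_graded.
  exact: (dghom_graded (dghom_opp g)).
have dth x : hom_dif (-1) th x = 0.
  rewrite hom_difN1; congr pair => /=; rewrite ?difB ?dmh_dif ?addNr //.
  by have := es x; rewrite hom_difN1 /= difN dmhB => ->; abel.
have [h hh eh] := KP (cone_acyclic qw) hth dth.
have h1 := cone_fst_graded hh; rewrite subrK in h1.
exists (fun x => sgn true ((h x).1 : X)); first exact: graded_hom_sgn.
move=> x; rewrite hom_dif_sgn //; have /(congr1 fst) := eh x.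
by rewrite hom_difN1 hom_difE /= => ->; rewrite opprD.
Qed.

End Projective.

Section Injective.
Variables (A : dgring) (I : dgmod A).
Hypothesis KI : K_injective I.
Variables (X Y : dgmod A) (w : dghom X Y).
Hypothesis qw : dg_qis w.

(** Dual to [Kproj_lift]: [f] becomes a closed map on the acyclic cone that vanishes on [Y], and a
    primitive restricts on [Y], up to sign, to the extension. Arbitrary degrees are allowed because
    classes in H^n(I) will be treated as maps of degree n from A. *)
Lemma Kinj_extend n (f : X -> I) : graded_hom n f -> (forall x, hom_dif n f x = 0) ->
  exists g : Y -> I, [/\ graded_hom n g, forall y, hom_dif n g y = 0 &
    exists2 s : X -> I, graded_hom (n - 1) s & forall x, g (w x) - f x = hom_dif (n - 1) s x].
Proof.
move=> hf df.
(* The summand 0 is the zero map on [Y], in the shape required by [cone_copair_graded]. *)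
pose phi (z : cone w) := f z.1 + 0 : I.
have hphi : graded_hom (n + 1) phi.
  apply: (@cone_copair_graded _ _ _ w I (n + 1) f (fun=> 0)); first by rewrite addrK.
  exact: graded_hom0.
have dphi z : hom_dif (n + 1) phi z = 0.
  have := df z.1; rewrite !hom_difE /phi /= !addr0 parD addbT (ghN hf).
  by case: (par n); rewrite /= ?opprK.
have [h hh eh] := KI (cone_acyclic qw) hphi dphi; rewrite addrK in hh eh.
have h1 := cone_inl_graded hh; have h2 := cone_inr_graded hh.
exists (fun y => sgn (~~ par n) (h (0, y))); split.
- exact: graded_hom_sgn.
- move=> y; rewrite hom_dif_sgn //.
  have := hom_dif_pre (cone_in w) n h y; rewrite -eh /phi /= => ->.
  by rewrite (gh0 hf) addr0 sgn0.
exists (fun x => sgn true (h (x, 0))); first exact: graded_hom_sgn.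
move=> x; rewrite hom_dif_sgn //; have := eh (x, 0); rewrite /phi /= addr0 => ->.
rewrite !hom_difE /= parD addbT.
have -> : h (cone_dif w (x, 0)) = h (0, w x) - h (dif (dgm_st X) x, 0).
  rewrite -(ghN hh) -(ghD hh); congr h; congr pair; rewrite /= ?add0r //.
  by rewrite dif0 addr0 subr0.
by case: (par n); rewrite /= ?opprD ?opprK ?opprB; abel.
Qed.

(** The map [g] together with a primitive of [g w] is a closed map on the cone; a primitive of it
    restricts on [Y] to a primitive of [g]. *)
Lemma Kinj_epi n (g : Y -> I) (s : X -> I) : graded_hom n g -> (forall y, hom_dif n g y = 0) ->
  graded_hom (n - 1) s -> (forall x, g (w x) = hom_dif (n - 1) s x) ->
  exists2 t : Y -> I, graded_hom (n - 1) t & forall y, g y = hom_dif (n - 1) t y.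
Proof.
move=> hg dg hs es.
pose phi (z : cone w) := sgn (par n) (s z.1) + g z.2 : I.
have hphi : graded_hom n phi.
  apply: (@cone_copair_graded _ _ _ w I n (fun x => sgn (par n) (s x)) g) => //.
  exact: graded_hom_sgn.
have dphi z : hom_dif n phi z = 0.
  rewrite hom_difE /phi /= difD dif_sgn sgnD sgn_sgn addbb /= (ghD hg) (ghN hs) sgnD es.
  have /eqP := dg z.2; rewrite !hom_difE subr_eq0 => /eqP ->.
  rewrite parD addbT sgnD sgnN sgn_sgn.
  by case: (par n); rewrite /= ?opprK ?opprD ?opprK; abel.
have [h hh eh] := KI (cone_acyclic qw) hphi dphi.
exists (fun y => h (0, y)); first exact: cone_inr_graded.
move=> y; rewrite (hom_dif_pre (cone_in w)) -eh /phi /=.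
by rewrite (gh0 hs) sgn0 add0r.
Qed.

End Injective.

(** * Morphisms in the derived category *)

Section Cylinder.
Variables (A : dgring) (M : dgmod A).

(** A map out of this cone is a pair of maps from [M] with a homotopy between them; the opposite
    identity in the second component produces their difference. *)
Definition cylinder : dgmod A :=
  cone (dsum_pair (dghom_id M) (dghom_opp (dghom_id M))).

Definition cyl0 : dghom M cylinder :=
  dghom_comp (cone_in _) (dsum_pair (dghom_id M) (dghom0 M M)).
Definition cyl1 : dghom M cylinder :=
  dghom_comp (cone_in _) (dsum_pair (dghom0 M M) (dghom_id M)).

Definition cyl_map (N : dgmod A) (f g : dghom M N) (h : M -> N)
  (hh : graded_hom (-1) h) (fg : forall x, f x - g x = hom_dif (-1) h x) :
  dghom cylinder N.
Proof.
exists (fun z => h z.1 + (f z.2.1 + g z.2.2)) => [x y|a x|n x|x] /=.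
- by rewrite (ghD hh) !dmhD; abel.
- by rewrite (ghZ hh) twist_twist /= !dmhZ -!scalerDr.
- by rewrite (gh_cmp hh) addrK !dmh_cmp -!cmpD.
- rewrite (ghN hh) !dmhD dmhN !dmh_dif !difD.
  have := fg x.1; rewrite hom_difN1 => /eqP; rewrite subr_eq => /eqP ->.
  abel.
Defined.

Lemma homotopic_cyl (N : dgmod A) (f g : dghom M N) : homotopic f g ->
  exists k : dghom cylinder N, dghom_comp k cyl0 =1 f /\ dghom_comp k cyl1 =1 g.
Proof.
move=> [h hh fg]; exists (cyl_map hh fg); split=> x /=.
  by rewrite (gh0 hh) dmh0 add0r addr0.
by rewrite (gh0 hh) dmh0 !add0r.
Qed.

Fact cyl_proj_subproof (x : M) :
  dghom_id M x - dghom_id M x = hom_dif (-1) (fun _ : M => 0 : M) x.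
Proof. by rewrite hom_difN1 subrr dif0 addr0. Qed.

Definition cyl_proj : dghom cylinder M :=
  cyl_map (graded_hom0 M M (-1)) cyl_proj_subproof.

Lemma cyl_proj_qis : dg_qis cyl_proj.
Proof.
move=> n; split=> [[c [a b]]|y cy]; last first.
  exists (cyl0 y); first exact: dmh_cocycle.
  rewrite (_ : y - _ = 0); first exact: coboundary0.
  by rewrite /= add0r addr0 subrr.
case=> -[hc ha hb] [dc da db] [e /= he ed].
have {}da : c = - dif (dgm_st M) a by apply/eqP; rewrite -addr_eq0 da.
have {}db : c = dif (dgm_st M) b by apply/esym/eqP; rewrite -subr_eq0 addrC db.
exists (- b, (e, 0)).
  congr pair => /=; first by rewrite subrK; apply: homogN.
  by congr pair; rewrite //= cmp0.
congr pair => /=; first by rewrite difN opprK.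
congr pair; rewrite /= ?dif0 ?addr0 ?opprK //.
by rewrite -ed add0r addrC addrK.
Qed.

End Cylinder.

Section DerivedCategory.
Variable A : dgring.
Implicit Types M N P I : dgmod A.

Definition Dl M N (f : dghom M N) : @hom (Dcat A) M N := fmap (Dloc A) f.

Lemma Dl_eq M N (f g : dghom M N) : f =1 g -> heq (Dl f) (Dl g).
Proof. exact: (@leq_of (dgmod_cat A) (@dg_qis A)). Qed.

Lemma Dl_comp M N P (g : dghom N P) (f : dghom M N) :
  heq (Dl (dghom_comp g f)) (ccomp (Dl g) (Dl f)).
Proof. exact: (@leq_of_comp (dgmod_cat A) (@dg_qis A)). Qed.

Lemma Dl_id M : heq (Dl (dghom_id M)) (idm (M : Dcat A)).
Proof. exact: heq_refl. Qed.

Lemma Dl_iso M N (f : dghom M N) : dg_qis f -> is_iso (Dl f).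
Proof. exact: (@loc_iso (dgmod_cat A)). Qed.

(** Both ends of the cylinder are sections of [cyl_proj], which is invertible in D(A), so they
    coincide there. *)
Lemma Dl_homotopic M N (f g : dghom M N) : homotopic f g -> heq (Dl f) (Dl g).
Proof.
move=> /homotopic_cyl[k [k0 k1]].
have ip := Dl_iso (@cyl_proj_qis _ M).
have e01 : heq (Dl (cyl0 M)) (Dl (cyl1 M)).
  apply: (iso_mono ip); apply: heq_trans (Dl_comp _ _); apply: heq_sym.
  apply: heq_trans (Dl_comp _ _); apply: Dl_eq => x /=.
  by rewrite !add0r !addr0.
apply: heq_trans (Dl_eq k1); apply: heq_trans (heq_sym (Dl_eq k0)) _.
apply: heq_trans (Dl_comp k (cyl0 M)) _; apply: heq_sym.
by apply: heq_trans (Dl_comp k (cyl1 M)) _; apply: compl; apply: heq_sym.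
Qed.

(** Induction on the word, for its composite with a map [h] from [P]: the intermediate objects are
    arbitrary but the source stays K-projective, so formal inverses are realized by lifting. *)
Lemma Dl_rep_Kproj P N (phi : @hom (Dcat A) P N) : K_projective P ->
  exists f : dghom P N, heq phi (Dl f).
Proof.
move=> KP; suff H : forall X Y (psi : @hom (Dcat A) X Y) (h : dghom P X),
    exists f, heq (ccomp psi (Dl h)) (Dl f).
  have [f fe] := H _ _ phi (dghom_id P); exists f; apply: heq_trans fe.
  exact: heq_sym (ccomp_idr _).
move=> X Y; elim=> {X Y} [X Y f|X Y w qw|X Y Z g IHg f IHf] h.
- by exists (dghom_comp f h); apply: heq_sym; apply: Dl_comp.
- have [f ef] := Kproj_lift KP qw h; exists f.
  apply: (iso_mono (Dl_iso qw)); apply: heq_sym.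
  apply: heq_trans (heq_sym (Dl_comp _ _)) _; apply: heq_trans (Dl_homotopic ef) _.
  by apply: heq_sym; apply: cancel_invl; apply: leq_invr.
- have [k ek] := IHf h; have [l el] := IHg k; exists l; apply: heq_trans el.
  apply: heq_trans (heq_sym (ccompA _ _ _)) _.
  exact: (@compl (Dcat A)).
Qed.

Lemma Dl_rep_Kinj M I (phi : @hom (Dcat A) M I) : K_injective I ->
  exists f : dghom M I, heq phi (Dl f).
Proof.
move=> KI; suff H : forall X Y (psi : @hom (Dcat A) X Y) (h : dghom Y I),
    exists f, heq (ccomp (Dl h) psi) (Dl f).
  have [f fe] := H _ _ phi (dghom_id I); exists f; apply: heq_trans fe.
  exact: heq_sym (ccomp_idl _).
move=> X Y; elim=> {X Y} [X Y f|X Y w qw|X Y Z g IHg f IHf] h.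
- by exists (dghom_comp h f); apply: heq_sym; apply: Dl_comp.
- have [g [hg dg [s hs es]]] := Kinj_extend KI qw (dghom_graded h) (dghom_cocycle h).
  rewrite sub0r in hs es; pose k := dghom_of hg dg; exists k.
  have ek : homotopic (dghom_comp k w) h by exists s.
  apply: (iso_epi (Dl_iso qw)); apply: heq_sym.
  apply: heq_trans (heq_sym (Dl_comp _ _)) _; apply: heq_trans (Dl_homotopic ek) _.
  by apply: heq_sym; apply: cancel_invr; apply: leq_invl.
- have [k ek] := IHg h; have [l el] := IHf k; exists l; apply: heq_trans el.
  apply: heq_trans (ccompA _ _ _) _.
  exact: (@compr (Dcat A)).
Qed.

Section HomotopyClasses.
Variables (P : dgmod A) (KP : K_projective P).

Let ho_act M N (f : @hom (dgmod_cat A) M N) (g : dghom P M) : dghom P N := dghom_comp f g.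

Let ho_act_eq M N (f f' : @hom (dgmod_cat A) M N) (g g' : dghom P M) :
  heq f f' -> homotopic g g' -> homotopic (ho_act f g) (ho_act f' g').
Proof.
move=> ff gg; apply: homotopic_trans (homotopic_post f gg) _.
by apply: homotopic_eq => x; apply: ff.
Qed.

Let ho_act_id M (g : dghom P M) : homotopic (ho_act (@idm (dgmod_cat A) M) g) g.
Proof. exact: homotopic_eq. Qed.

Let ho_act_comp M N N' (f' : @hom (dgmod_cat A) N N') (f : @hom (dgmod_cat A) M N)
  (g : dghom P M) : homotopic (ho_act (ccomp f' f) g) (ho_act f' (ho_act f g)).
Proof. exact: homotopic_eq. Qed.

Let ho_act_inj M N (w : @hom (dgmod_cat A) M N) : dg_qis w ->
  forall f g, homotopic (ho_act w f) (ho_act w g) -> homotopic f g.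
Proof. by move=> qw f g; apply: (Kproj_mono KP qw). Qed.

Let ho_act_surj M N (w : @hom (dgmod_cat A) M N) : dg_qis w ->
  forall f, exists g, homotopic (ho_act w g) f.
Proof. by move=> qw f; apply: (Kproj_lift KP qw). Qed.

(** Maps from [P] up to homotopy form a functor that inverts quasi-isomorphisms, so equal morphisms
    act equally on it; evaluate at the identity of [P]. *)
Lemma Dl_inj_Kproj N (f g : dghom P N) : heq (Dl f) (Dl g) -> homotopic f g.
Proof.
move=> fg; have := @loc_act_leq (dgmod_cat A) _ (fun M => dghom P M) (@homotopic A P)
  ho_act (fun M f => homotopic_eq (fun x => erefl (f x))) (@homotopic_sym A P)
  (@homotopic_trans A P) ho_act_eq ho_act_id ho_act_comp ho_act_inj ho_act_surj
  P N _ _ fg (dghom_id P).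
move=> e; apply: homotopic_trans (homotopic_trans e _); exact: homotopic_eq.
Qed.

End HomotopyClasses.

Section CohomologyAction.
Variable n : int.

Definition cocycles M : Type := {x : M | cocycle (dgm_st M) n x}.
Definition cohomologous M (x y : cocycles M) : Prop :=
  coboundary (dgm_st M) n (sval x - sval y).

Definition coc_act M N (f : @hom (dgmod_cat A) M N) (x : cocycles M) : cocycles N :=
  exist _ (dmh f (sval x)) (dmh_cocycle f (proj2_sig x)).

Lemma cohomologous_refl M (x : cocycles M) : cohomologous x x.
Proof. by rewrite /cohomologous subrr; apply: coboundary0. Qed.
Lemma cohomologous_sym M (x y : cocycles M) : cohomologous x y -> cohomologous y x.
Proof. by move=> /coboundaryN; rewrite opprB. Qed.
Lemma cohomologous_trans M (x y z : cocycles M) :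
  cohomologous x y -> cohomologous y z -> cohomologous x z.
Proof. by move=> xy /(coboundaryD xy); rewrite addrA subrK. Qed.

Let coc_act_eq M N (f g : @hom (dgmod_cat A) M N) (x y : cocycles M) :
  heq f g -> cohomologous x y -> cohomologous (coc_act f x) (coc_act g y).
Proof.
move=> fg xy; rewrite /cohomologous /= -(fg (sval y)) -dmhB.
exact: dmh_coboundary.
Qed.

Let coc_act_id M (x : cocycles M) :
  cohomologous (coc_act (@idm (dgmod_cat A) M) x) x.
Proof. by rewrite /cohomologous /= subrr; apply: coboundary0. Qed.

Let coc_act_comp M N P (g : @hom (dgmod_cat A) N P) (f : @hom (dgmod_cat A) M N)
  (x : cocycles M) : cohomologous (coc_act (ccomp g f) x) (coc_act g (coc_act f x)).
Proof. by rewrite /cohomologous /= subrr; apply: coboundary0. Qed.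

Let coc_act_inj M N (w : @hom (dgmod_cat A) M N) : dg_qis w ->
  forall x y, cohomologous (coc_act w x) (coc_act w y) -> cohomologous x y.
Proof.
move=> qw x y; rewrite /cohomologous /= -dmhB; apply: (qw n).1.
exact: cocycleB (proj2_sig x) (proj2_sig y).
Qed.

Let coc_act_surj M N (w : @hom (dgmod_cat A) M N) : dg_qis w ->
  forall y, exists x, cohomologous (coc_act w x) y.
Proof.
move=> qw [y cy]; have [x cx bx] := (qw n).2 _ cy; exists (exist _ x cx).
by rewrite /cohomologous /= -opprB; apply: coboundaryN.
Qed.

(** The action on H^n, kept at the level of cocycles up to coboundaries so that no quotient group
    has to be formed. *)
Definition coh M N (phi : @hom (Dcat A) M N) : cocycles M -> cocycles N :=
  @loc_act (dgmod_cat A) _ cocycles cohomologous coc_act coc_act_surj M N phi.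

Lemma coh_heq M N (phi psi : @hom (Dcat A) M N) x :
  heq phi psi -> cohomologous (coh phi x) (coh psi x).
Proof.
move=> e; exact: (@loc_act_leq (dgmod_cat A) _ cocycles cohomologous coc_act
  cohomologous_refl cohomologous_sym cohomologous_trans
  coc_act_eq coc_act_id coc_act_comp coc_act_inj coc_act_surj M N _ _ e).
Qed.

Lemma coh_cohomologous M N (phi : @hom (Dcat A) M N) x y :
  cohomologous x y -> cohomologous (coh phi x) (coh phi y).
Proof.
exact: (@loc_act_eq (dgmod_cat A) _ cocycles cohomologous coc_act
  cohomologous_sym cohomologous_trans coc_act_eq coc_act_inj coc_act_surj M N).
Qed.

End CohomologyAction.

Lemma Dl_coh M N (f g : dghom M N) n x : heq (Dl f) (Dl g) ->
  cocycle (dgm_st M) n x -> coboundary (dgm_st N) n (f x - g x).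
Proof. by move=> fg cx; apply: (coh_heq (exist _ x cx) fg). Qed.

End DerivedCategory.

(** * Semi-free resolutions *)

Lemma cmp_scale_homog (A : dgring) (M : dgmod A) k j (a : A) (m : M) :
  homog (dgm_st M) j m -> cmp (dgm_st M) k (a *: m) = cmp (dgr_st A) (k - j) a *: m.
Proof.
move=> hm; elim/(homog_ind (s := dgr_st A)): a => [|a b IH IH'|i a ha].
- by rewrite cmp0 !scale0r cmp0.
- by rewrite scalerDl !cmpD IH IH' scalerDl.
have ham := dgm_scale ha hm; have [e|ne] := eqVneq k (i + j).
  by rewrite e ham addrK ha.
rewrite (homog_neq ham ne) (homog_neq ha) ?scale0r //.
by apply: contraNneq ne => <-; rewrite subrK.
Qed.

Lemma hom_dif_graded (A : dgring) (M N : dgmod A) n (h : M -> N) :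
  graded_hom n h -> graded_hom (n + 1) (hom_dif n h).
Proof.
move=> hh; apply/graded_homP; split=> [x y|k x|a x]; rewrite !hom_difE.
- by rewrite difD (ghD hh) !difD (ghD hh) sgnD; abel.
- have -> : h (dif (dgm_st M) (cmp (dgm_st M) k x)) =
      cmp (dgm_st N) (k + (n + 1)) (h (dif (dgm_st M) x)).
    by rewrite -dif_cmp (gh_cmp hh); congr (cmp _ _ _); lia.
  by rewrite cmpD cmpN cmp_sgn addrA dif_cmp -(gh_cmp hh).
- rewrite leibniz (ghD hh) !(ghZ hh) leibniz dif_twist sgn_scale !twist_twist sgnD.
  rewrite parD addbC scalerBr opprD addrACA subrr add0r; congr (_ - _).
  by rewrite -scale_sgn.
Qed.

Section Semifree.
Variables (A : dgring) (P : dgmod A) (G : Type) (e : G -> P) (deg : G -> int) (rk : G -> nat).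

(** A basis described through maps out of [P]: values on generators extend uniquely to graded maps,
    and [sf_rank] says, without naming coefficients, that the differential of a generator involves
    only generators of smaller rank. *)
Record semifree : Prop := Semifree {
  sf_homog : forall g, homog (dgm_st P) (deg g) (e g);
  sf_ext : forall (N : dgmod A) n (v : G -> N),
    (forall g, homog (dgm_st N) (deg g + n) (v g)) ->
    exists2 f : P -> N, graded_hom n f & forall g, f (e g) = v g;
  sf_eq : forall (N : dgmod A) n (f f' : P -> N), graded_hom n f -> graded_hom n f' ->
    (forall g, f (e g) = f' (e g)) -> f =1 f';
  sf_rank : forall g (N : dgmod A) n (f f' : P -> N), graded_hom n f -> graded_hom n f' ->
    (forall g', (rk g' < rk g)%N -> f (e g') = f' (e g')) ->
    f (dif (dgm_st P) (e g)) = f' (dif (dgm_st P) (e g))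
}.

Hypothesis sf : semifree.

Section Homotopy.
Variables (N : dgmod A) (acN : acyclic (dgm_st N)) (n : int) (f : P -> N).
Hypotheses (hf : graded_hom n f) (df : forall x, hom_dif n f x = 0).

Let partial r : Type := {h : P -> N | graded_hom (n - 1) h /\
  forall g, (rk g < r)%N -> f (e g) = hom_dif (n - 1) h (e g)}.

Let hf' : graded_hom (n - 1 + 1) f. Proof. by rewrite subrK. Qed.

(** On a generator of rank r the homotopy equation prescribes the differential of its new value; the
    prescribed element is a cocycle, hence a boundary in [N]. Values at smaller ranks are kept. *)
Let step r (h : partial r) :
  exists h' : partial r.+1, forall g, (rk g < r)%N -> sval h' (e g) = sval h (e g).
Proof.
case: h => h [hh eh] /=; have hdh := hom_dif_graded hh.
have ex g : exists y : N, homog (dgm_st N) (deg g + (n - 1)) y /\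
    (rk g = r -> dif (dgm_st N) y = f (e g) + sgn (par (n - 1)) (h (dif (dgm_st P) (e g)))).
  have [eg|ng] := eqVneq (rk g) r; last first.
    by exists 0; split; [apply: homog0|move=> /eqP; rewrite (negPf ng)].
  set z := f _ + _.
  have cz : cocycle (dgm_st N) (deg g + n) z.
    split.
      apply: homogD; first exact: gh_homog hf _ _ (sf_homog sf g).
      apply: homog_sgn; have -> : deg g + n = deg g + 1 + (n - 1) by lia.
      exact: gh_homog hh _ _ (homog_dif (sf_homog sf g)).
    (* The differential of a generator of rank r only sees smaller ranks, where [f] already equals
       the differential of [h]. *)
    have fE : f (dif (dgm_st P) (e g)) = dif (dgm_st N) (h (dif (dgm_st P) (e g))).
      rewrite (sf_rank sf hf' hdh) => [|g']; last by rewrite eg; apply: eh.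
      by rewrite hom_difE dif_dif (gh0 hh) sgn0 subr0.
    rewrite difD dif_sgn -fE; have /eqP := df (e g); rewrite hom_difE subr_eq0 => /eqP ->.
    by rewrite parD addbT; case: (par n); rewrite /= ?subrr ?addNr.
  have [y hy ey] := acN cz; exists y; split=> //.
  by rewrite addrA.
pose v g := if (rk g < r)%N then h (e g) else projT1 (cid (ex g)).
have [|h' hh' eh'] := sf_ext sf (n := n - 1) (v := v).
  move=> g; rewrite /v; case: ifP => _; first exact: gh_homog hh _ _ (sf_homog sf g).
  by case: (cid _) => y [].
have h'E g : (rk g < r)%N -> h' (e g) = h (e g) by move=> lt; rewrite eh' /v lt.
suff ph g : (rk g < r.+1)%N -> f (e g) = hom_dif (n - 1) h' (e g).
  by exists (exist _ h' (conj hh' ph)).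
rewrite ltnS => le_g.
have dE : h' (dif (dgm_st P) (e g)) = h (dif (dgm_st P) (e g)).
  apply: (sf_rank sf hh' hh) => g' lt; apply: h'E; exact: ssrnat.leq_trans lt le_g.
rewrite hom_difE dE; have [lt|ge] := ltnP (rk g) r.
  by rewrite h'E // eh // hom_difE.
rewrite eh' /v ltnNge ge /=; case: (cid _) => y [hy ->] /=; first by rewrite addrK.
by apply/eqP; rewrite eqn_leq le_g ge.
Qed.

Let base : partial 0.
Proof. by exists (fun=> 0); split=> //; apply: graded_hom0. Qed.

Let Fixpoint tower r : partial r :=
  match r with
  | 0 => base
  | r.+1 => projT1 (cid (step (tower r)))
  end.

Let towerE r g : (rk g < r)%N -> sval (tower r) (e g) = sval (tower (rk g).+1) (e g).
Proof.
elim: r => // r IH; rewrite ltnS leq_eqVlt => /orP[/eqP <- //|lt].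
by rewrite -(IH lt) [tower r.+1]/=; case: (cid _) => h' /= ->.
Qed.

Lemma semifree_homotopy :
  exists2 h : P -> N, graded_hom (n - 1) h & forall x, f x = hom_dif (n - 1) h x.
Proof.
(* The stages stabilize: the value at [e g] is fixed from stage [(rk g).+1] on, the first one that
   treats rank [rk g]. *)
have [|h hh eh] := sf_ext sf (n := n - 1) (v := fun g => sval (tower (rk g).+1) (e g)).
  move=> g; case: (tower _) => k [hk _] /=; exact: gh_homog hk _ _ (sf_homog sf g).
exists h => //; apply: (sf_eq sf hf' (hom_dif_graded hh)) => g.
have [hk ek] := proj2_sig (tower (rk g).+1).
rewrite ek // !hom_difE eh; congr (_ - sgn _ _).
apply: (sf_rank sf hk hh) => g' lt; rewrite eh towerE //.
exact: ltnW.
Qed.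

End Homotopy.

Lemma semifree_Kprojective : K_projective P.
Proof. by move=> N acN n f hf df; apply: semifree_homotopy. Qed.

End Semifree.

Section SelfModule.
Variable A : dgring.

Definition self : dgmod A.
Proof.
exists (A^o : lmodType A) (dgr_st A).
- exact: dgr_mul.
- move=> i a m ha; rewrite /GRing.scale /=; exact: dgr_leibniz.
Defined.

Lemma dif1 : dif (dgr_st A) 1 = 0.
Proof. exact/dif_homog0/dgr_1. Qed.

Lemma self_semifree : @semifree A self unit (fun=> 1 : A) (fun=> 0) (fun=> 0%N).
Proof.
have s1 (a : self) : a = a *: (1 : self) by rewrite /GRing.scale /= mulr1.
split=> //=.
- by move=> _; apply: dgr_1.
- move=> N n v hv; have := hv tt; rewrite add0r => hvt.
  exists (fun a : A => twist (par n) a *: v tt) => [|[]]; last by rewrite twist1 scale1r.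
  apply/graded_homP; split=> [x y|k x|a x].
  + by rewrite twistD scalerDl.
  + by rewrite (cmp_scale_homog _ _ hvt) addrK -twist_cmp.
  + by rewrite -[a *: x]/(a * x : A) twistM -scalerA.
- move=> N n f f' hf hf' ff a; rewrite (s1 a) (ghZ hf) (ghZ hf').
  by congr (_ *: _); apply: (ff tt).
- by move=> _ N n f f' hf hf' _; rewrite dif1 (gh0 hf) (gh0 hf').
Qed.

Lemma self_Kprojective : K_projective self.
Proof. exact: semifree_Kprojective self_semifree. Qed.

Definition self_map (M : dgmod A) (m : M) (cm : cocycle (dgm_st M) 0 m) : dghom self M.
Proof.
exists (fun a : A => a *: m) => [x y|a x|n x|x].
- exact: scalerDl.
- by rewrite scalerA.
- by rewrite (cmp_scale_homog _ _ cm.1) subr0.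
- by rewrite leibniz cm.2 scaler0 addr0.
Defined.

Lemma self_mapE (M : dgmod A) (f : dghom self M) (a : A) : f a = a *: f 1.
Proof. by rewrite -dmhZ /GRing.scale /= mulr1. Qed.

End SelfModule.

Section FreeModule.
Variables (A : dgring) (G : choiceType).

Definition free_pred : {pred G -> A} :=
  fun f => `[< exists s : seq G, forall g, g \notin s -> f g = 0 >].

Lemma free_zmod : zmod_closed free_pred.
Proof.
split=> [|f f' /asboolP[s hs] /asboolP[s' hs']]; apply/asboolP; first by exists [::].
exists (s ++ s') => g; rewrite mem_cat negb_or => /andP[gs gs'].
by rewrite -[LHS]/(f g - f' g) hs // hs' // subrr.
Qed.

Definition free : Type := {f : G -> A | f \in free_pred}.
HB.instance Definition _ := [isSub for (@sval (G -> A) _ : free -> (G -> A))].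
HB.instance Definition _ := [Choice of free by <:].
HB.instance Definition _ :=
  GRing.SubChoice_isSubZmodule.Build (G -> A) free_pred free free_zmod.

Definition coef (f : free) : G -> A := val f.

Definition Free (f : G -> A) (hf : exists s : seq G, forall g, g \notin s -> f g = 0) : free :=
  exist _ f (asboolT hf).

Lemma free_ext (f f' : free) : coef f =1 coef f' -> f = f'.
Proof. by move=> ff; apply: val_inj; apply/funext. Qed.

Lemma coef_supp (f : free) : exists s : seq G, forall g, g \notin s -> coef f g = 0.
Proof. exact/asboolP/(valP f). Qed.

Lemma coefD f f' g : coef (f + f') g = coef f g + coef f' g. Proof. by []. Qed.
Lemma coef0 g : coef 0 g = 0. Proof. by []. Qed.

(** A chosen finite set outside which [f] vanishes. It may contain zeros of [f], so [fsumE] compares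
    two such sets through the nonzero coefficients. *)
Definition supp (f : free) : seq G := undup (projT1 (cid (coef_supp f))).
Lemma supp_uniq f : uniq (supp f). Proof. exact: undup_uniq. Qed.
Lemma suppP f g : g \notin supp f -> coef f g = 0.
Proof. rewrite mem_undup; exact: (projT2 (cid (coef_supp f))). Qed.

Fact free_map_subproof (F : G -> A -> A) f : (forall g, F g 0 = 0) ->
  exists s : seq G, forall g, g \notin s -> F g (coef f g) = 0.
Proof. by move=> F0; exists (supp f) => g /suppP ->. Qed.

Definition free_map (F : G -> A -> A) (F0 : forall g, F g 0 = 0) (f : free) : free :=
  Free (free_map_subproof f F0).

Definition free_scale (a : A) : free -> free := @free_map (fun=> *%R a) (fun=> mulr0 a).

Fact free_scaleA a b x : free_scale a (free_scale b x) = free_scale (a * b) x.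
Proof. by apply: free_ext => g; rewrite /coef /= mulrA. Qed.
Fact free_scale1 : left_id 1 free_scale.
Proof. by move=> x; apply: free_ext => g; rewrite /coef /= mul1r. Qed.
Fact free_scaleDr : right_distributive free_scale +%R.
Proof. by move=> a x y; apply: free_ext => g; rewrite coefD /coef /= mulrDr. Qed.
Fact free_scaleDl x : {morph free_scale^~ x : a b / a + b}.
Proof. by move=> a b; apply: free_ext => g; rewrite coefD /coef /= mulrDl. Qed.
HB.instance Definition _ := GRing.Zmodule_isLmodule.Build A free
  free_scaleA free_scale1 free_scaleDr free_scaleDl.

Lemma coefZ a f g : coef (a *: f) g = a * coef f g. Proof. by []. Qed.

Fact fbase_subproof (a : A) g : exists s : seq G, forall g', g' \notin s ->
  (if g' == g then a else 0) = 0.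
Proof. by exists [:: g] => g'; rewrite inE => /negPf ->. Qed.

Definition fbase (a : A) (g : G) : free := Free (fbase_subproof a g).

Lemma coef_base a g g' : coef (fbase a g) g' = if g' == g then a else 0.
Proof. by []. Qed.

Lemma fbaseD a b g : fbase (a + b) g = fbase a g + fbase b g.
Proof. by apply: free_ext => g'; rewrite coefD !coef_base; case: eqP; rewrite ?addr0. Qed.

Lemma fbase0 g : fbase 0 g = 0.
Proof. by apply: free_ext => g'; rewrite coef_base if_same. Qed.

Lemma fbaseZ a b g : a *: fbase b g = fbase (a * b) g.
Proof. by apply: free_ext => g'; rewrite coefZ !coef_base; case: eqP; rewrite ?mulr0. Qed.

Section Sum.
Variables (V : zmodType) (F : G -> A -> V).
Hypothesis FD : forall g, {morph F g : a b / a + b}.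

Definition fsum (f : free) : V := \sum_(g <- supp f) F g (coef f g).

Lemma fsumE f s : uniq s -> (forall g, g \notin s -> coef f g = 0) ->
  fsum f = \sum_(g <- s) F g (coef f g).
Proof.
move=> us hs; have F0 g : F g 0 = 0 := morph0 (FD g).
have red t : uniq t -> (forall g, g \notin t -> coef f g = 0) ->
    \sum_(g <- t) F g (coef f g) = \sum_(g <- [seq g <- t | coef f g != 0]) F g (coef f g).
  move=> ut ht; rewrite big_filter [RHS]big_mkcond /=; apply: eq_bigr => g _.
  by case: eqP => //= ->.
rewrite /fsum (red _ (supp_uniq f) (@suppP f)) (red s) //.
apply: perm_big; apply: uniq_perm; rewrite ?filter_uniq ?supp_uniq // => g.
rewrite !mem_filter; case: eqP => //= /eqP ne.
have -> : g \in supp f by apply: contraNT ne => /suppP ->.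
by apply/esym; apply: contraNT ne => /hs ->.
Qed.

Lemma fsumD : {morph fsum : f f' / f + f'}.
Proof.
move=> f f'; pose s := undup (supp f ++ supp f').
have us : uniq s by apply: undup_uniq.
have hs g : g \notin s -> coef f g = 0 /\ coef f' g = 0.
  by rewrite mem_undup mem_cat negb_or => /andP[/suppP -> /suppP ->].
have hD g : g \notin s -> coef (f + f') g = 0.
  by move=> /hs[e e']; rewrite coefD e e' addr0.
rewrite (fsumE us hD) !(fsumE us) => [|g /hs[]|g /hs[]] //.
by rewrite -big_split; apply: eq_bigr => g _; rewrite coefD FD.
Qed.

Lemma fsum_base a g : fsum (fbase a g) = F g a.
Proof.
rewrite (@fsumE _ [:: g]) => [|//|g']; first by rewrite big_seq1 coef_base eqxx.
by rewrite inE coef_base => /negPf ->.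
Qed.

End Sum.

Lemma fsum_id f : fsum (fun g a => fbase a g) f = f.
Proof.
apply: free_ext => g; rewrite /fsum.
rewrite (big_morph (fun f => coef f g) (id1 := 0) (op1 := +%R)) //.
under eq_bigr do rewrite coef_base.
have [gs|gs] := boolP (g \in supp f).
  rewrite (bigD1_seq g) ?supp_uniq //= eqxx big1 ?addr0 // => g' ne.
  by rewrite eq_sym (negPf ne).
by rewrite big1_seq ?suppP // => g' /andP[_ g's]; case: eqP g's gs => // <- ->.
Qed.

Lemma free_ind (Q : free -> Prop) :
  Q 0 -> (forall x y, Q x -> Q y -> Q (x + y)) -> (forall a g, Q (fbase a g)) ->
  forall f, Q f.
Proof.
move=> Q0 QD Qb f; rewrite -(fsum_id f) /fsum.
by elim/big_ind: _ => // g _; apply: Qb.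
Qed.

End FreeModule.

Section FreeDGModule.
Variables (A : dgring) (G : choiceType) (deg : G -> int) (delta : G -> free A G).
Local Notation F := (free A G).
Local Notation sA := (dgr_st A).

Definition free_cmp (n : int) : F -> F :=
  @free_map A G (fun g => cmp sA (n - deg g)) (fun g => cmp0 sA (n - deg g)).

Lemma coef_cmp n f g : coef (free_cmp n f) g = cmp sA (n - deg g) (coef f g).
Proof. by []. Qed.

Lemma free_cmpD n : {morph free_cmp n : x y / x + y}.
Proof. by move=> x y; apply: free_ext => g; rewrite coefD !coef_cmp coefD cmpD. Qed.

Lemma free_cmp_base n a g : free_cmp n (fbase a g) = fbase (cmp sA (n - deg g) a) g.
Proof.
by apply: free_ext => g'; rewrite coef_cmp !coef_base; case: eqP => [->|]; rewrite ?cmp0.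
Qed.

Lemma free_cmp_cmp m n x :
  free_cmp m (free_cmp n x) = if m == n then free_cmp n x else 0.
Proof.
apply: free_ext => g; rewrite !coef_cmp cmp_cmp (inj_eq (addIr _)).
by case: ifP => // _; rewrite coef_cmp.
Qed.

Let dterm g (a : A) : F := fbase (dif sA a) g + twist true a *: delta g.

Let dtermD g : {morph dterm g : a b / a + b}.
Proof. by move=> a b; rewrite /dterm difD fbaseD twistD scalerDl addrACA. Qed.

Definition free_dif : F -> F := fsum dterm.

Lemma free_difD : {morph free_dif : x y / x + y}.
Proof. exact: fsumD dtermD. Qed.

Lemma free_dif_base a g : free_dif (fbase a g) = fbase (dif sA a) g + twist true a *: delta g.
Proof. exact: (fsum_base dtermD). Qed.

Lemma free_leibniz (a : A) x :
  free_dif (a *: x) = dif sA a *: x + twist true a *: free_dif x.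
Proof.
elim/free_ind: x => [|x y IH IH'|b g].
- by rewrite !scaler0 (morph0 free_difD) scaler0 addr0.
- by rewrite !scalerDr !free_difD !scalerDr IH IH' addrACA.
have lb := leibniz (M := self A) a b; rewrite /= in lb.
rewrite fbaseZ !free_dif_base [dif sA (a * b)]lb fbaseD twistM scalerDr scalerA.
by rewrite !fbaseZ addrA.
Qed.

Hypothesis delta_homog : forall g, free_cmp (deg g + 1) (delta g) = delta g.
Hypothesis delta_cocycle : forall g, free_dif (delta g) = 0.

Lemma free_cmpZ n (a : A) f m :
  free_cmp n f = f -> free_cmp m (a *: f) = cmp sA (m - n) a *: f.
Proof.
move=> hf; apply: free_ext => g; rewrite coef_cmp !coefZ.
have hfg : homog sA (n - deg g) (coef f g) by rewrite /homog -coef_cmp hf.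
rewrite [LHS](cmp_scale_homog (M := self A) _ _ hfg); congr (cmp sA _ a * _).
by lia.
Qed.

Definition free_st : dgstruct F.
Proof.
exists free_cmp free_dif.
- exact: free_cmpD.
- exact: free_cmp_cmp.
- elim/free_ind => [|x y|a g].
  + exact: fs0.
  + exact: (fsD free_cmpD free_cmp_cmp).
  apply: (@fs_transfer _ _ sA _ (fun a => fbase a g) (- deg g)) => [u v|n u].
    exact: fbaseD.
  exact: free_cmp_base.
- exact: free_difD.
- move=> n; elim/free_ind => [|x y IH IH'|a g].
  + by rewrite (morph0 (free_cmpD n)) !(morph0 free_difD) (morph0 (free_cmpD _)).
  + by rewrite free_cmpD !free_difD free_cmpD IH IH'.
  rewrite free_cmp_base !free_dif_base free_cmpD free_cmp_base addrAC dif_cmp.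
  by rewrite (free_cmpZ _ _ (delta_homog g)) opprD addrACA subrr addr0 twist_cmp.
- elim/free_ind => [|x y IH IH'|a g].
  + by rewrite !(morph0 free_difD).
  + by rewrite !free_difD IH IH' addr0.
  rewrite free_dif_base free_difD free_dif_base dif_dif fbase0 add0r free_leibniz.
  by rewrite delta_cocycle scaler0 addr0 dif_twist -scalerDl addrN scale0r.
Defined.

Definition free_dgmod : dgmod A.
Proof.
exists F free_st.
- move=> i j a m ha hm; rewrite /homog /= (free_cmpZ _ _ hm) addrK.
  by rewrite [cmp sA i a]ha.
- move=> i a m ha; rewrite [LHS]free_leibniz (twist_homog _ ha) scale_sign -/(par i) /sgn /=.
  by case: (par i); rewrite ?scaleNr.
Defined.

Definition gen (g : G) : free_dgmod := fbase 1 g.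

Lemma dif_gen g : dif free_st (gen g) = delta g.
Proof. by rewrite [LHS]free_dif_base dif1 fbase0 add0r twist1 scale1r. Qed.

Lemma gen_homog g : homog free_st (deg g) (gen g).
Proof. by rewrite /homog [LHS]free_cmp_base subrr [cmp _ _ _]dgr_1. Qed.

Definition free_lift (N : dgmod A) n (v : G -> N) : F -> N :=
  fsum (fun g a => twist (par n) a *: v g).

Section Lift.
Variables (N : dgmod A) (n : int) (v : G -> N).

Let lD g : {morph (fun a => twist (par n) a *: v g) : a b / a + b}.
Proof. by move=> a b; rewrite twistD scalerDl. Qed.

Lemma free_liftD : {morph free_lift n v : x y / x + y}.
Proof. exact: fsumD lD. Qed.

Lemma free_lift_base a g : free_lift n v (fbase a g) = twist (par n) a *: v g.
Proof. exact: (fsum_base lD). Qed.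

Lemma free_lift_gen g : free_lift n v (fbase 1 g) = v g.
Proof. by rewrite free_lift_base twist1 scale1r. Qed.

Lemma free_lift_graded : (forall g, homog (dgm_st N) (deg g + n) (v g)) ->
  graded_hom n (free_lift n v : free_dgmod -> N).
Proof.
move=> hv; apply/graded_homP; split=> [|k x|a x]; first exact: free_liftD.
  elim/free_ind: x => [|x y IH IH'|a g].
  - by rewrite cmp0 (morph0 free_liftD) cmp0.
  - by rewrite free_liftD !cmpD IH IH' free_liftD.
  rewrite [cmp _ k (fbase a g)]free_cmp_base !free_lift_base (cmp_scale_homog _ _ (hv g)).
  by rewrite twist_cmp; congr (cmp _ _ _ *: _); lia.
elim/free_ind: x => [|x y IH IH'|b g].
- by rewrite scaler0 (morph0 free_liftD) scaler0.
- by rewrite scalerDr !free_liftD IH IH' scalerDr.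
by rewrite fbaseZ !free_lift_base twistM scalerA.
Qed.

End Lift.

Lemma graded_hom_fbase (N : dgmod A) n (f : free_dgmod -> N) a g :
  graded_hom n f -> f (fbase a g) = twist (par n) a *: f (gen g).
Proof. by move=> hf; rewrite -(ghZ hf) [a *: _]fbaseZ mulr1. Qed.

Lemma free_semifree (rk : G -> nat) :
  (forall g g', coef (delta g) g' != 0 -> (rk g' < rk g)%N) ->
  semifree gen deg rk.
Proof.
move=> hrk; split=> [g|N n v hv|N n f f' hf hf' ff|g N n f f' hf hf' ff].
- exact: gen_homog.
- by exists (free_lift n v); [apply: free_lift_graded|apply: free_lift_gen].
- elim/free_ind => [|x y IH IH'|a g]; first by rewrite (gh0 hf) (gh0 hf').
    by rewrite (ghD hf) (ghD hf') IH IH'.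
  by rewrite (graded_hom_fbase _ _ hf) (graded_hom_fbase _ _ hf') ff.
rewrite dif_gen -(fsum_id (delta g)) /fsum.
rewrite (big_morph f (ghD hf) (gh0 hf)) (big_morph f' (ghD hf') (gh0 hf')).
apply: eq_bigr => g' _; rewrite (graded_hom_fbase _ _ hf) (graded_hom_fbase _ _ hf').
have [->|/hrk lt] := eqVneq (coef (delta g) g') 0; first by rewrite twist0 !scale0r.
by rewrite ff.
Qed.

End FreeDGModule.

(* A generator [ResGen n p m] of degree n is meant to satisfy d g = q and g |-> m
   for the element q = sum a_i g_i listed by p, provided that this is
   consistent, that is, q is a cocycle of degree n + 1 lying over d m; otherwise
   d g = 0 and g |-> 0. Thus every cocycle of the free module on these
   generators whose image is a coboundary gets killed. *)
Inductive resgen (A : dgring) (M : dgmod A) : Type :=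
  ResGen of int & seq (A * resgen M) & M.

Section Resolution.
Variables (A : dgring) (M : dgmod A).
Local Notation G := (resgen M).
Local Notation sM := (dgm_st M).

HB.instance Definition _ := gen_eqMixin G.
HB.instance Definition _ := gen_choiceMixin G.
Local Notation F := (free A G).

Definition rdeg (g : G) : int := let: ResGen n _ _ := g in n.

Definition rvalid (n : int) (q dq : F) (mq m : M) : Prop :=
  [/\ free_cmp rdeg (n + 1) q = q, dq = 0, homog sM n m & mq = dif sM m].

(** Differential and augmentation are computed by one recursion, because the validity test on a
    generator needs both on its constituents. Here [dq] and [mq] write out the differential and the
    image of [q], as [free_dif rdelta] cannot be invoked before [rdelta] exists. *)
Fixpoint rdata (g : G) : F * M :=
  let: ResGen n p m := g in
  let r := [seq (x, rdata x.2) | x <- p] in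
  let q := \sum_(y <- r) fbase y.1.1 y.1.2 in
  let dq := \sum_(y <- r) (fbase (dif (dgr_st A) y.1.1) y.1.2 + twist true y.1.1 *: y.2.1) in
  let mq := \sum_(y <- r) y.1.1 *: y.2.2 in
  if `[< rvalid n q dq mq m >] then (q, m) else (0, 0).

Fixpoint rdepth (g : G) : nat :=
  let: ResGen _ p _ := g in (foldr maxn 0 [seq rdepth x.2 | x <- p]).+1.

Definition rdelta (g : G) : F := (rdata g).1.
Definition raug (g : G) : M := (rdata g).2.
Local Notation rdif := (free_dif rdelta).

Definition rlist (p : seq (A * G)) : F := \sum_(x <- p) fbase x.1 x.2.

Lemma rdata_cases n p m :
  (rvalid n (rlist p) (rdif (rlist p)) (free_lift 0 raug (rlist p)) m /\
     rdelta (ResGen n p m) = rlist p /\ raug (ResGen n p m) = m) \/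
  (~ rvalid n (rlist p) (rdif (rlist p)) (free_lift 0 raug (rlist p)) m /\
     rdelta (ResGen n p m) = 0 /\ raug (ResGen n p m) = 0).
Proof.
rewrite /rdelta /raug /= !big_map /=.
have -> : rdif (rlist p) =
    \sum_(x <- p) (fbase (dif (dgr_st A) x.1) x.2 + twist true x.1 *: (rdata x.2).1).
  rewrite /rlist (big_morph _ (free_difD rdelta) (morph0 (free_difD rdelta))).
  by apply: eq_bigr => x _; rewrite free_dif_base.
have -> : free_lift 0 raug (rlist p) = \sum_(x <- p) x.1 *: (rdata x.2).2.
  rewrite /rlist (big_morph _ (free_liftD _ _) (morph0 (free_liftD 0 raug))).
  by apply: eq_bigr => x _; rewrite free_lift_base.
by case: asboolP => v; [left|right].
Qed.

Lemma rdelta_homog g : free_cmp rdeg (rdeg g + 1) (rdelta g) = rdelta g.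
Proof.
case: g => n p m; case: (rdata_cases n p m) => -[v [-> _]]; first by case: v.
exact: morph0 (free_cmpD _ _).
Qed.

Lemma rdelta_cocycle g : rdif (rdelta g) = 0.
Proof.
case: g => n p m; case: (rdata_cases n p m) => -[v [-> _]]; first by case: v.
exact: morph0 (free_difD _).
Qed.

Lemma raug_homog g : homog sM (rdeg g) (raug g).
Proof.
case: g => n p m; case: (rdata_cases n p m) => -[v [_ ->]]; first by case: v.
exact: homog0.
Qed.

Lemma raug_delta g : free_lift 0 raug (rdelta g) = dif sM (raug g).
Proof.
case: g => n p m; case: (rdata_cases n p m) => -[v [-> ->]]; first by case: v.
by rewrite (morph0 (free_liftD _ _)) dif0.
Qed.

Lemma rdelta_rank g g' : coef (rdelta g) g' != 0 -> (rdepth g' < rdepth g)%N.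
Proof.
case: g => n p m; case: (rdata_cases n p m) => -[v [-> _]]; last by rewrite eqxx.
rewrite /rlist {v} /= ltnS; elim: p => [|x p IH]; first by rewrite big_nil eqxx.
rewrite big_cons coefD coef_base /= leq_max.
  case: (eqVneq g' x.2) => [->|_]; first by rewrite leqnn.
by rewrite add0r => /IH ->; rewrite orbT.
Qed.

Definition resolution : dgmod A := free_dgmod rdelta_homog rdelta_cocycle.

Lemma free_lift_aug (x : F) : free_lift 0 raug (rdif x) = dif sM (free_lift 0 raug x).
Proof.
have l0 := morph0 (free_liftD 0 raug); elim/free_ind: x => [|x y IH IH'|a g].
- by rewrite l0 dif0 (morph0 (free_difD _)) l0.
- by rewrite free_liftD !free_difD !free_liftD difD IH IH'.
rewrite free_dif_base free_liftD !free_lift_base !twist_par0 leibniz -raug_delta.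
congr (_ + _); elim/free_ind: (rdelta g) => [|x y IH IH'|b h].
- by rewrite scaler0 l0 scaler0.
- by rewrite scalerDr !free_liftD IH IH' scalerDr.
- by rewrite fbaseZ !free_lift_base !twist_par0 scalerA.
Qed.

Fact res_aug_graded : graded_hom 0 (free_lift 0 raug : resolution -> M).
Proof. by apply: free_lift_graded => g; rewrite addr0; apply: raug_homog. Qed.

Fact res_aug_cocycle x : hom_dif 0 (free_lift 0 raug : resolution -> M) x = 0.
Proof. by rewrite hom_difE /= -[dif sM _]free_lift_aug subrr. Qed.

Definition res_aug : dghom resolution M := dghom_of res_aug_graded res_aug_cocycle.

Lemma res_augE x : res_aug x = free_lift 0 raug x.
Proof. by []. Qed.

Lemma resolution_semifree :
  semifree (gen rdelta_homog rdelta_cocycle) rdeg rdepth.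
Proof. exact: free_semifree rdelta_rank. Qed.

Lemma resolution_Kprojective : K_projective resolution.
Proof. exact: semifree_Kprojective resolution_semifree. Qed.

(** No colimit is taken: the inductive type of generators already contains one for each cocycle to
    be killed, including cocycles built on other such generators. *)
Lemma res_aug_qis : dg_qis res_aug.
Proof.
move=> n; split=> [x [hx dx] [m hm em]|m [hm dm]].
  (* The generator built on the list of coefficients of [x], with target [m], has differential
     [x]. *)
  pose p := [seq (coef x g, g) | g <- supp x].
  have px : rlist p = x by rewrite /rlist big_map; apply: fsum_id.
  have v : rvalid (n - 1) (rlist p) (rdif (rlist p)) (free_lift 0 raug (rlist p)) m.
    by rewrite px; split=> //; rewrite subrK.
  have [[_ [e _]]|[//]] := rdata_cases (n - 1) p m.
  exists (gen rdelta_homog rdelta_cocycle (ResGen (n - 1) p m)).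
    exact: (gen_homog rdelta_homog rdelta_cocycle (ResGen (n - 1) p m)).
  by rewrite [RHS](dif_gen rdelta_homog rdelta_cocycle) e.
(* A generator with empty list is a cocycle that maps to [m]. *)
have v : rvalid n (rlist [::]) (rdif (rlist [::])) (free_lift 0 raug (rlist [::])) m.
  rewrite /rlist big_nil; split=> //.
  - exact: morph0 (free_cmpD _ _).
  - exact: morph0 (free_difD _).
  - by rewrite dm (morph0 (free_liftD _ _)).
have [[_ [e e']]|[//]] := rdata_cases n [::] m.
exists (gen rdelta_homog rdelta_cocycle (ResGen n [::] m)).
  split; first exact: (gen_homog rdelta_homog rdelta_cocycle (ResGen n [::] m)).
  by rewrite (dif_gen rdelta_homog rdelta_cocycle) e /rlist big_nil.
rewrite res_augE (free_lift_gen 0 raug) e' subrr; exact: coboundary0.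
Qed.

End Resolution.

(** * Reduction *)

Lemma twist_conc (A : dgring) b (h : H0 A) : twist b h = h.
Proof.
apply: (eq_cmp (s := dgr_st (H0 A))) => n; rewrite cmp_twist /= /conc_cmp.
by case: eqP => [->|_]; rewrite ?andbF ?sgn0.
Qed.

(** * Equivalence with H^0(A) in terms of cohomology *)

Section CohomologicalCriterion.
Variable A : dgring.
Local Notation sA := (dgr_st A).

Lemma piH_coboundary n (a : A) : coboundary (dgr_st (H0 A)) n (piH A a) -> piH A a = 0.
Proof. by case. Qed.

Lemma piH_eq0 (a : A) : piH A a = 0 -> coboundary sA 0 (cmp sA 0 a).
Proof.
move=> a0; have : H0_eq (exist _ (cmp sA 0 a) (deg0_cmp a) : Z0 A) 0.
  by apply/H0_clsP; apply: a0.
by rewrite /H0_eq /= subr0.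
Qed.

Lemma piH_dif (a : A) : piH A (dif sA a) = 0.
Proof. exact: (drh_dif (piH A)). Qed.

Lemma equiv_H0P : equiv_H0 A <-> (forall n, n < 0 -> coh_zero sA n).
Proof.
split=> [q n n0 x cx|H n].
  apply: (q n).1 => //; rewrite (piH_homog cx.1) ?lt_eqF //; exact: coboundary0.
split=> [x cx /piH_coboundary x0|y [hy _]].
  have [n0|n0|n0] := ltgtP n 0; first exact: H.
    by rewrite (dgr_homog_pos n0 cx.1); apply: coboundary0.
  by rewrite n0 -[x](cx.1) n0; apply: piH_eq0.
have [a ha ey] := piH_surj y; have [n0|n0] := eqVneq n 0.
  exists a; last by rewrite ey subrr; apply: coboundary0.
  by rewrite n0; split=> //; apply: dif_homog0.
have -> : y = 0 by rewrite -hy /= /conc_cmp (negPf n0).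
exists 0; first exact: cocycle0.
by rewrite drh0 subrr; apply: coboundary0.
Qed.

(** In degrees n <= 0 a primitive has degree n - 1 < 0, hence lies in the kernel automatically; in
    positive degrees A is zero. *)
Lemma ker_piH_acyclic : equiv_H0 A -> forall n (a : A), cocycle sA n a -> piH A a = 0 ->
  exists b, [/\ homog sA (n - 1) b, piH A b = 0 & a = dif sA b].
Proof.
move=> q n a ca a0; have [n0|n0] := ltP 0 n.
  exists 0; split; [exact: homog0|exact: drh0|].
  by rewrite dif0; apply: dgr_homog_pos ca.1.
have [|b hb eb] := (q n).1 _ ca; first by rewrite a0; apply: coboundary0.
exists b; split=> //; apply: (piH_homog hb); lia.
Qed.

End CohomologicalCriterion.

(** * Extension of scalars and its adjunction *)

Section Extension.
Variable A : dgring.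
Local Notation H := (H0 A).
Local Notation S := (restr_dgmod (piH A)).

Section Lift.
Variables (M : dgmod A) (Z : zmodType) (b : H -> M -> Z).
Hypothesis bb : balanced b.

Definition tlift (c : tens M) : Z := tsum b (trep c).

Lemma tlift_cls s : tlift (tcls s) = tsum b s.
Proof. exact: trep_cls. Qed.

Lemma tlift_pure h m : tlift (pure h m) = b h m.
Proof. by rewrite tlift_cls /tsum big_seq1. Qed.

Lemma tliftD : {morph tlift : x y / x + y}.
Proof.
move=> x y; case: (tcls_surj x) => s ->; case: (tcls_surj y) => t ->.
by rewrite -tclsD !tlift_cls tsum_cat.
Qed.

End Lift.

Lemma pure_scale (M : dgmod A) (a : A) (m : M) : pure 1 (a *: m) = pure (piH A a) m.
Proof. by rewrite -pureM mul1r. Qed.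

Definition ext_unit (M : dgmod A) : dghom M (S (tens_dgmod M)).
Proof.
exists (fun m => pure 1 m) => [x y|a x|n x|x].
- exact: pureDr.
- by rewrite pure_scale -[in LHS](mulr1 (piH A a)) -tscaleE.
- by rewrite [RHS]tens_cmp_pure.
- by rewrite [RHS]tens_dif_pure.
Defined.

(** Since [piH] is onto, H (x)_A M is a quotient of M: every tensor is a single [pure 1 m], and
    identities need only be checked there. *)
Lemma ext_unit_surj (M : dgmod A) (y : tens M) : exists m, y = ext_unit M m.
Proof.
elim/tens_ind: y => [|x y [m ->] [m' ->]|h m].
- by exists 0; rewrite dmh0.
- by exists (m + m'); rewrite dmhD.
- by have [a _ ->] := piH_surj h; exists (a *: m); rewrite /= pure_scale.
Qed.

Section Adjunct.
Variables (M : dgmod A) (Y : dgmod H) (n : int) (f : M -> S Y).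
Hypothesis hf : graded_hom n f.

Let b (h : H) (m : M) : Y := h *: (f m : Y).

Let bb : balanced b.
Proof.
split=> [h h' m|h m m'|h a m]; rewrite /b ?scalerDl //.
  by rewrite (ghD hf) scalerDr.
by rewrite (ghZ hf) -scalerA; congr (_ *: _); rewrite -[RHS]/(piH A _ *: _) piH_twist.
Qed.

Definition adjunct : tens_dgmod M -> Y := tlift b.

Lemma adjunct_unit m : adjunct (ext_unit M m) = f m.
Proof. by rewrite /adjunct (tlift_pure bb) /b scale1r. Qed.

Lemma adjunct_graded : graded_hom n adjunct.
Proof.
apply/graded_homP; split=> [|k x|a x]; first exact: (tliftD bb).
  have [m ->] := ext_unit_surj x.
  by rewrite adjunct_unit -[cmp _ k _](dmh_cmp (ext_unit M)) adjunct_unit (gh_cmp hf).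
rewrite twist_conc; have [c _ ->] := piH_surj a; have [m ->] := ext_unit_surj x.
rewrite adjunct_unit -[_ *: _](dmhZ (ext_unit M)) adjunct_unit (ghZ hf).
by rewrite -[LHS]/(piH A _ *: _) piH_twist.
Qed.

Lemma adjunct_dif x : exists2 m, x = ext_unit M m & hom_dif n adjunct x = hom_dif n f m.
Proof.
have [m e] := ext_unit_surj x; exists m; rewrite // e !hom_difE.
by rewrite -[dif _ (ext_unit M m)](dmh_dif (ext_unit M)) !adjunct_unit.
Qed.

End Adjunct.

Section AdjunctHom.
Variables (M : dgmod A) (Y : dgmod H) (f : dghom M (S Y)).

Fact adjunct_cocycle x : hom_dif 0 (adjunct f) x = 0.
Proof.
by have [m _ ->] := adjunct_dif (dghom_graded f) x; rewrite dghom_cocycle.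
Qed.

Definition adjunct_hom : dghom (tens_dgmod M) Y :=
  dghom_of (adjunct_graded (dghom_graded f)) adjunct_cocycle.

Lemma adjunct_homE : dghom_comp (restr_hom (piH A) adjunct_hom) (ext_unit M) =1 f.
Proof. by move=> m; apply: (adjunct_unit (dghom_graded f)). Qed.

End AdjunctHom.

Lemma ext_unit_natural (M N : dgmod A) (f : dghom M N) :
  dghom_comp (restr_hom (piH A) (tens_hom f)) (ext_unit M) =1 dghom_comp (ext_unit N) f.
Proof. by move=> m; apply: tens_fun_pure. Qed.

(** Extension is left adjoint to restriction, and restriction preserves acyclicity. *)
Lemma tens_Kprojective (P : dgmod A) : K_projective P -> K_projective (tens_dgmod P).
Proof.
move=> KP Y acY n f hf df.
pose g : P -> S Y := fun m => f (ext_unit P m).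
have hg : graded_hom n g.
  apply/graded_homP; split=> [x y|k x|a x]; rewrite /g.
  - by rewrite dmhD (ghD hf).
  - by rewrite dmh_cmp (gh_cmp hf).
  - by rewrite dmhZ [LHS](ghZ hf) twist_conc -[RHS]/(piH A _ *: _) piH_twist.
have dg m : hom_dif n g m = 0.
  by rewrite hom_difE /g dmh_dif -[RHS](df (ext_unit P m)) hom_difE.
have [h hh eh] := KP (S Y) acY n g hg dg.
exists (adjunct h); first exact: adjunct_graded.
move=> x; have [m -> ->] := adjunct_dif hh x; exact: eh.
Qed.

Lemma adjunct_homotopic (P : dgmod A) (Y : dgmod H) (f g : dghom (tens_dgmod P) Y) :
  homotopic (dghom_comp (restr_hom (piH A) f) (ext_unit P))
            (dghom_comp (restr_hom (piH A) g) (ext_unit P)) -> homotopic f g.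
Proof.
move=> [h hh eh]; exists (adjunct h); first exact: adjunct_graded.
move=> x; have [m -> ->] := adjunct_dif hh x; exact: eh.
Qed.

Lemma tens_homotopic (M N : dgmod A) (f g : dghom M N) :
  homotopic f g -> homotopic (tens_hom f) (tens_hom g).
Proof.
move=> fg; apply: adjunct_homotopic.
apply: homotopic_trans (homotopic_eq (ext_unit_natural f)) _.
apply: homotopic_trans (homotopic_post _ fg) _.
by apply: homotopic_sym; apply: homotopic_eq; apply: ext_unit_natural.
Qed.

End Extension.

(** * Semi-free modules modulo J *)

Section FreeReduction.
Variables (A : dgring) (G : choiceType) (deg : G -> int) (delta : G -> free A G).
Hypothesis delta_homog : forall g, free_cmp deg (deg g + 1) (delta g) = delta g.
Hypothesis delta_cocycle : forall g, free_dif delta (delta g) = 0.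
Variable rk : G -> nat.
Hypothesis delta_rank : forall g g', coef (delta g) g' != 0 -> (rk g' < rk g)%N.
Local Notation P := (free_dgmod delta_homog delta_cocycle).
Local Notation sP := (free_st delta_homog delta_cocycle).
Local Notation sA := (dgr_st A).

(** The map sending [h] and [p] to [h * piH A (coef p g)] is balanced, so a vanishing tensor has all
    its coefficients in J. Conversely, each coefficient is moved across the tensor. *)
Lemma ext_unit_free_eq0 (x : P) :
  ext_unit P x = 0 <-> forall g, piH A (coef x g) = 0.
Proof.
split=> [x0 g|x0].
  pose b (h : H0 A) (p : P) : H0_car A := h * piH A (coef p g).
  have bb : balanced b.
    split=> [h h' p|h p p'|h a p]; rewrite /b ?mulrDl //.
      by rewrite coefD (drhD (piH A)) mulrDr.
    by rewrite coefZ (drhM (piH A)) mulrA.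
  have := tlift_pure bb 1 x; rewrite -[pure 1 x]/(ext_unit P x) x0.
  by rewrite (morph0 (tliftD bb)) /b mul1r.
rewrite -(fsum_id x) /fsum (big_morph _ (dmhD (ext_unit P)) (dmh0 _)) big1 // => g _.
have -> : fbase (coef x g) g = coef x g *: (fbase 1 g : P) by rewrite fbaseZ mulr1.
by rewrite dmhZ -[LHS]/(piH A _ *: _) x0 scale0r.
Qed.

(** A generator whose differential involves [g] has larger rank than [g], so it does not occur in
    [x]. *)
Lemma coef_dif_top (x : P) g : (forall g', coef x g' != 0 -> (rk g' <= rk g)%N) ->
  coef (free_dif delta x) g = dif sA (coef x g).
Proof.
move=> top; rewrite -{1}(fsum_id x) /fsum.
rewrite (big_morph _ (free_difD delta) (morph0 (free_difD delta))).
rewrite (big_morph (fun f => coef f g) (id1 := 0) (op1 := +%R)) //.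
have d0 g' : coef (twist true (coef x g') *: delta g') g = 0.
  rewrite coefZ; have [->|/top le] := eqVneq (coef x g') 0; first by rewrite twist0 mul0r.
  have [->|/delta_rank] := eqVneq (coef (delta g') g) 0; first by rewrite mulr0.
  by rewrite ltnNge le.
under eq_bigr do rewrite free_dif_base coefD d0 addr0 coef_base.
have [gs|gs] := boolP (g \in supp x).
  rewrite (bigD1_seq g) ?supp_uniq //= eqxx big1 ?addr0 // => g' ne.
  by rewrite eq_sym (negPf ne).
rewrite suppP // dif0 big1_seq // => g' /andP[_ g's].
by case: eqP g's gs => // <- ->.
Qed.

Hypothesis qA : equiv_H0 A.

Let ker_acyclic_below (p : pred G) := forall n (x : P),
  (forall g, coef x g != 0 -> p g) -> cocycle sP n x -> (forall g, piH A (coef x g) = 0) ->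
  exists z : P, [/\ homog sP (n - 1) z, forall g, piH A (coef z g) = 0 & x = dif sP z].

(** For a generator [g] of top rank, the coefficient of [x] is a cocycle in J by [coef_dif_top],
    hence has a primitive [b] in J. Subtracting the differential of [fbase b g] removes [g] and
    otherwise alters only coefficients of smaller rank. *)
Let ker_acyclic_step r (s : seq G) : ker_acyclic_below (fun g => (rk g < r)%N) ->
  ker_acyclic_below (fun g => (rk g < r)%N || (rk g == r) && (g \in s)).
Proof.
move=> base; elim: s => [|g s IH] n x xs cx x0.
  by apply: base => // g /xs; rewrite in_nil andbF orbF.
have [hx dx] := cx; have [eg|ng] := eqVneq (rk g) r; last first.
  apply: IH => // g' ne; have := xs g' ne; rewrite inE.
  by case: (g' =P g) => [->|//]; rewrite (negPf ng) /= orbF => ->.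
have hc : homog sA (n - deg g) (coef x g) by rewrite /homog -coef_cmp [free_cmp _ _ _]hx.
have dc : dif sA (coef x g) = 0.
  rewrite -coef_dif_top ?[free_dif _ _]dx // eg => g' /xs/orP[/ltnW //|/andP[/eqP -> //]].
have [b [hb b0 eb]] := ker_piH_acyclic qA (conj hc dc) (x0 g).
pose z1 : P := fbase b g.
have hz1 : homog sP (n - 1) z1.
  rewrite /homog [LHS]free_cmp_base; congr fbase; rewrite -[RHS]hb; congr (cmp _ _ _); lia.
have cE g' : coef (x - dif sP z1) g' =
    coef x g' - ((if g' == g then coef x g else 0) + twist true b * coef (delta g) g').
  by rewrite -[LHS]/(coef x g' - coef (free_dif delta (fbase b g)) g') free_dif_base -eb.
have [|||z [hz z0 ez]] := IH n (x - dif sP z1).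
- move=> g'; rewrite cE; have [->|ne] := eqVneq g' g.
    rewrite opprD addrA subrr sub0r; have [->|/delta_rank] := eqVneq (coef (delta g) g) 0.
      by rewrite mulr0 oppr0 eqxx.
    by rewrite ltnn.
  rewrite add0r; have [->|/delta_rank] := eqVneq (coef (delta g) g') 0.
    by rewrite mulr0 subr0 => /xs; rewrite inE (negPf ne).
  by rewrite eg => ->.
- apply: cocycleB => //; apply: coboundary_cocycle; exact: coboundary_dif.
- move=> g'; rewrite cE (morphB (drhD (piH A))) x0 (drhD (piH A)) (drhM (piH A)) piH_twist b0.
  by rewrite mul0r; case: eqP => _; rewrite ?x0 ?drh0 addr0 subr0.
exists (z1 + z); split; first exact: homogD.
  move=> g'; rewrite coefD (drhD (piH A)) z0 coef_base addr0.
  by case: eqP; rewrite ?b0 ?drh0.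
by rewrite difD -ez addrC subrK.
Qed.

Let ker_acyclic_rank r : ker_acyclic_below (fun g => (rk g < r)%N).
Proof.
elim: r => [|r IH] n x xs cx x0.
  exists 0; split; [exact: homog0|by move=> g; rewrite coef0 drh0|rewrite dif0].
  by apply: free_ext => g; rewrite coef0; apply/eqP; apply: contraT => /xs.
apply: (ker_acyclic_step IH (s := supp x)) cx x0 => g ne.
have -> : g \in supp x by apply: contraNT ne => /suppP ->.
by rewrite andbT orbC -leq_eqVlt -ltnS; apply: xs.
Qed.

Lemma free_ker_acyclic n (x : P) : cocycle sP n x -> (forall g, piH A (coef x g) = 0) ->
  exists z : P, [/\ homog sP (n - 1) z, forall g, piH A (coef z g) = 0 & x = dif sP z].
Proof.
apply: (@ker_acyclic_rank (\max_(g <- supp x) rk g).+1) => g ne; rewrite ltnS.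
have gs : g \in supp x by apply: contraNT ne => /suppP ->.
by rewrite (big_rem g) //= leq_maxl.
Qed.

Lemma ext_unit_free_qis : dg_qis (ext_unit P).
Proof.
apply: surj_acyclic_ker_qis => [y|n x cx /ext_unit_free_eq0 x0]; first exact: ext_unit_surj.
have [z [hz z0 ez]] := free_ker_acyclic cx x0.
by exists z; split=> //; apply/ext_unit_free_eq0.
Qed.

End FreeReduction.

Lemma resolution_unit_qis (A : dgring) (M : dgmod A) : equiv_H0 A ->
  dg_qis (ext_unit (resolution M)).
Proof.
exact: (@ext_unit_free_qis A _ _ _ (@rdelta_homog A M) (@rdelta_cocycle A M) _
  (@rdelta_rank A M)).
Qed.

(** * Full faithfulness of S *)

Section Forgetful.
Variable A : dgring.
Local Notation H := (H0 A).
Local Notation S := (forgetful A).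
Hypothesis qA : equiv_H0 A.

Section Counit.
Variable M : dgmod H.
Local Notation P := (resolution (restr_dgmod (piH A) M)).
Local Notation p := (res_aug (restr_dgmod (piH A) M)).

(** Composed with the quasi-isomorphism [ext_unit P] it is the resolution [p], and restriction
    leaves the underlying complexes unchanged. *)
Lemma counit_qis : dg_qis (adjunct_hom p).
Proof.
have q : dg_qis (dghom_comp (restr_hom (piH A) (adjunct_hom p)) (ext_unit P)).
  by apply: qis_eq (res_aug_qis _) => m; rewrite adjunct_homE.
exact: (qis_cancelr (resolution_unit_qis _ qA) q).
Qed.

Lemma counit_unit :
  heq (ccomp (fmap S (Dl (adjunct_hom p))) (Dl (ext_unit P))) (Dl p).
Proof.
apply: heq_trans (heq_sym (Dl_comp _ _)) _; apply: Dl_eq; exact: adjunct_homE.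
Qed.

End Counit.

(** On the resolution of S M the given morphism is a map [g]; its adjunct, composed with the inverse
    of the counit, is a preimage. *)
Lemma forgetful_full : full S.
Proof.
move=> M N phi; pose p := res_aug (restr_dgmod (piH A) M).
have [g eg] := Dl_rep_Kproj (ccomp phi (Dl p)) (@resolution_Kprojective _ _).
have [c' [c1 c2]] := Dl_iso (@counit_qis M).
exists (ccomp (Dl (adjunct_hom g)) c'); apply: (iso_epi (Dl_iso (@res_aug_qis _ _))).
apply: heq_trans (heq_sym eg).
apply: heq_trans (compr _ (fmap_comp S _ _)) _.
apply: heq_trans (compl _ (heq_sym (counit_unit M))) _.
apply: heq_trans (heq_sym (ccompA _ _ _)) _.
have e : heq (ccomp (fmap S c') (fmap S (Dl (adjunct_hom p)))) (idm (S (tens_dgmod _))).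
  apply: heq_trans (heq_sym (fmap_comp S _ _)) _.
  by apply: heq_trans (fmap_id S _); apply: fmap_heq.
apply: heq_trans (compl _ (cancel_invl _ e)) _.
apply: heq_trans (heq_sym (Dl_comp _ _)) _; apply: Dl_eq; exact: adjunct_homE.
Qed.

(** After composition with the counit, both morphisms are maps out of the K-projective H (x) P.
    Homotopies there come by adjunction from homotopies on P, which the hypothesis provides. *)
Lemma forgetful_faithful : faithful S.
Proof.
move=> M N phi psi e; pose p := res_aug (restr_dgmod (piH A) M).
have KP := @resolution_Kprojective _ (restr_dgmod (piH A) M).
have [a ea] := Dl_rep_Kproj (ccomp phi (Dl (adjunct_hom p))) (tens_Kprojective KP).
have [b eb] := Dl_rep_Kproj (ccomp psi (Dl (adjunct_hom p))) (tens_Kprojective KP).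
have E (chi : @hom (Dcat H) M N) (k : dghom _ N) : heq (ccomp chi (Dl (adjunct_hom p))) (Dl k) ->
    heq (Dl (dghom_comp (restr_hom (piH A) k) (ext_unit _))) (ccomp (fmap S chi) (Dl p)).
  move=> ek; apply: heq_trans (Dl_comp _ _) _.
  apply: heq_trans (compr _ (fmap_heq S (heq_sym ek))) _.
  apply: heq_trans (compr _ (fmap_comp S _ _)) _.
  apply: heq_trans (heq_sym (ccompA _ _ _)) _; apply: compl; exact: counit_unit.
apply: (iso_epi (Dl_iso (@counit_qis M))); apply: (heq_trans ea); apply: heq_sym.
apply: (heq_trans eb); apply: heq_sym; apply: Dl_homotopic; apply: adjunct_homotopic.
apply: (Dl_inj_Kproj KP); apply: heq_trans (E _ _ ea) _; apply: heq_sym.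
by apply: heq_trans (E _ _ eb) _; apply: compr; apply: heq_sym.
Qed.

End Forgetful.

(** * Full faithfulness of F *)

Section Reduction.
Variables (A : dgring) (F : functor (Dcat A) (Dcat (H0 A))).
Local Notation S := (forgetful A).
Local Notation T := tens_dgmod.
Variable eps : forall M : dgmod A, @hom (Dcat (H0 A)) (F M) (T M).
Hypothesis eps_natural : forall (M N : dgmod A) (f : dghom M N),
  heq (ccomp (eps N) (fmap F (Dl f))) (ccomp (Dl (tens_hom f)) (eps M)).
Hypothesis eps_resolution : forall M : dgmod A, exists (P : dgmod A) (p : dghom P M),
  [/\ K_projective P, dg_qis p & is_iso (eps P)].

(** The hypothesis supplies one good resolution for each module. A K-projective [X] is homotopy
    equivalent to it, and the tensor product preserves homotopies, so invertibility transfers. *)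
Lemma eps_iso (X : dgmod A) : K_projective X -> is_iso (eps X).
Proof.
move=> KX; have [P [p [KP qp iP]]] := eps_resolution X.
have [s es] := Kproj_lift KX qp (dghom_id X).
have sp : homotopic (dghom_comp s p) (dghom_id P).
  apply: (Kproj_mono KP qp).
  apply: homotopic_trans (homotopic_pre p es) _.
  exact: homotopic_eq.
have Tiso (U V : dgmod A) (f : dghom U V) (g : dghom V U) :
    homotopic (dghom_comp f g) (dghom_id V) ->
    heq (ccomp (Dl (tens_hom f)) (Dl (tens_hom g))) (idm (T V : Dcat (H0 A))).
  move=> fg; apply: heq_trans (heq_sym (Dl_comp _ _)) _.
  apply: heq_trans (Dl_homotopic _) (Dl_id _).
  apply: homotopic_trans (homotopic_trans (tens_homotopic fg) _).
    by apply: homotopic_eq => x; apply/esym/(fmap_comp (extension A)).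
  by apply: homotopic_eq => x; apply: (fmap_id (extension A)).
have ip : is_iso (Dl (tens_hom p)) by exists (Dl (tens_hom s)); split; apply: Tiso.
apply: (iso_cancelr (fmap_iso F (Dl_iso qp))).
by apply: iso_heq (heq_sym (eps_natural p)) _; apply: iso_comp.
Qed.

Let Kiso (qA : equiv_H0 A) (M : Dcat A) : exists (P : Dcat A) (p : hom P M),
  (K_projective P /\ dg_qis (ext_unit P)) /\ is_iso p.
Proof.
exists (resolution M), (Dl (res_aug M)); split; last exact/Dl_iso/res_aug_qis.
by split; [apply: resolution_Kprojective|apply: resolution_unit_qis].
Qed.

Lemma unit_square (P Q : dgmod A) (f : dghom P Q) :
  heq (ccomp (fmap S (Dl (tens_hom f))) (Dl (ext_unit P))) (ccomp (Dl (ext_unit Q)) (Dl f)).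
Proof.
apply: heq_trans (heq_sym (Dl_comp _ _)) _; apply: heq_trans (Dl_comp _ _).
apply: Dl_eq; exact: ext_unit_natural.
Qed.

(** Through [eps], F is the tensor product on these objects. The units P -> S T P are
    quasi-isomorphisms, so a morphism T P -> T Q gives one P -> Q, and faithfulness of S shows that
    its image is the given one. *)
Lemma reduction_full : equiv_H0 A -> full F.
Proof.
move=> qA; apply: (full_on_iso (Kiso qA)) => P Q [KP uP] [KQ uQ] g.
have iP := eps_iso KP; have iQ := eps_iso KQ; have [eP' [eP1 _]] := iP.
pose g' : @hom (Dcat (H0 A)) (T P) (T Q) := ccomp (eps Q) (ccomp g eP').
have [v [v1 v2]] := Dl_iso uQ.
have [f ef] := Dl_rep_Kproj (ccomp v (ccomp (fmap S g') (Dl (ext_unit P)))) KP.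
have ETf : heq (Dl (tens_hom f)) g'.
  apply: (forgetful_faithful qA); apply: (iso_epi (Dl_iso uP)).
  apply: heq_trans (unit_square f) _.
  apply: heq_trans (compl _ (heq_sym ef)) _; exact: cancel_invl.
exists (Dl f); apply: (iso_mono iQ).
apply: heq_trans (eps_natural f) _; apply: heq_trans (compr _ ETf) _.
apply: heq_trans (heq_sym (ccompA _ _ _)) _; apply: compl.
exact: cancel_invr.
Qed.

(** By the unit square, a map P -> Q is determined in D(A) by its tensor product. *)
Lemma reduction_faithful : equiv_H0 A -> faithful F.
Proof.
move=> qA; apply: (faithful_on_iso (Kiso qA)) => P Q [KP uP] [KQ uQ] f g fg.
have [a ea] := Dl_rep_Kproj f KP; have [b eb] := Dl_rep_Kproj g KP.
apply: (heq_trans ea); apply: heq_sym; apply: (heq_trans eb); apply: heq_sym.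
apply: (iso_mono (Dl_iso uQ)).
apply: heq_trans (heq_sym (unit_square a)) _; apply: heq_trans (unit_square b).
apply: compr; apply: fmap_heq; apply: (iso_epi (eps_iso KP)).
apply: heq_trans (heq_sym (eps_natural a)) _; apply: heq_trans (eps_natural b).
apply: compl; apply: heq_trans (fmap_heq F (heq_sym ea)) _.
by apply: heq_trans fg _; apply: fmap_heq.
Qed.

End Reduction.

(** * Sub-DG-modules and quotients *)

Record subdg (A : dgring) (M : dgmod A) := SubDG {
  insub :> M -> Prop;
  insub0 : insub 0;
  insubD : forall x y, insub x -> insub y -> insub (x + y);
  insubZ : forall (a : A) x, insub x -> insub (a *: x);
  insub_cmp : forall n x, insub x -> insub (cmp (dgm_st M) n x);
  insub_dif : forall x, insub x -> insub (dif (dgm_st M) x)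
}.

Lemma insubN (A : dgring) (M : dgmod A) (K : subdg M) x : K x -> K (- x).
Proof. by rewrite -scaleN1r; apply: insubZ. Qed.

Lemma insubB (A : dgring) (M : dgmod A) (K : subdg M) x y : K x -> K y -> K (x - y).
Proof. by move=> Kx Ky; apply: insubD => //; apply: insubN. Qed.

Section SubModule.
Variables (A : dgring) (M : dgmod A) (K : subdg M).
Local Notation sM := (dgm_st M).

Definition sub_pred : {pred M} := fun x => `[< K x >].

Lemma sub_zmod : zmod_closed sub_pred.
Proof.
split=> [|x y /asboolP Kx /asboolP Ky]; apply/asboolP; first exact: insub0.
exact: insubB.
Qed.

Definition sub_car : Type := {x : M | x \in sub_pred}.
HB.instance Definition _ := [isSub for (@sval M _ : sub_car -> M)].
HB.instance Definition _ := [Choice of sub_car by <:].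
HB.instance Definition _ := GRing.SubChoice_isSubZmodule.Build M sub_pred sub_car sub_zmod.

Lemma sub_carP (x : sub_car) : K (val x). Proof. exact/asboolP/(valP x). Qed.

Definition to_sub x (Kx : K x) : sub_car := exist _ x (asboolT Kx).

Definition sub_scale (a : A) (x : sub_car) : sub_car := to_sub (insubZ a (sub_carP x)).

Fact sub_scaleA a b x : sub_scale a (sub_scale b x) = sub_scale (a * b) x.
Proof. by apply: val_inj; apply: scalerA. Qed.
Fact sub_scale1 : left_id 1 sub_scale.
Proof. by move=> x; apply: val_inj; apply: scale1r. Qed.
Fact sub_scaleDr : right_distributive sub_scale +%R.
Proof. by move=> a x y; apply: val_inj; apply: scalerDr. Qed.
Fact sub_scaleDl x : {morph sub_scale^~ x : a b / a + b}.
Proof. by move=> a b; apply: val_inj; apply: scalerDl. Qed.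
HB.instance Definition _ := GRing.Zmodule_isLmodule.Build A sub_car
  sub_scaleA sub_scale1 sub_scaleDr sub_scaleDl.

Definition sub_cmp n (x : sub_car) : sub_car := to_sub (insub_cmp n (sub_carP x)).
Definition sub_dif (x : sub_car) : sub_car := to_sub (insub_dif (sub_carP x)).

Definition sub_st : dgstruct sub_car.
Proof.
exists sub_cmp sub_dif.
- by move=> n x y; apply: val_inj; apply: cmpD.
- by move=> m n x; apply: val_inj => /=; rewrite cmp_cmp; case: ifP.
- move=> x; have [s [us es]] := cmp_sum sM (val x); exists s; split=> //.
  apply: val_inj; rewrite {1}es (big_morph (val : sub_car -> M) (op1 := +%R) (id1 := 0)) //.
- by move=> x y; apply: val_inj; apply: difD.
- by move=> n x; apply: val_inj; apply: dif_cmp.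
- by move=> x; apply: val_inj; apply: dif_dif.
Defined.

Definition sub_dgmod : dgmod A.
Proof.
exists sub_car sub_st.
- move=> i j a m ha /(congr1 val) hm; apply: val_inj; exact: dgm_scale ha hm.
- move=> i a m ha; apply: val_inj; rewrite [LHS](dgm_leibniz _ ha).
  by rewrite !scale_sign; case: ifP.
Defined.

Definition sub_incl : dghom sub_dgmod M.
Proof. by exists (val : sub_dgmod -> M). Defined.

Lemma sub_cocycle n (x : sub_dgmod) : cocycle sM n (val x) -> cocycle sub_st n x.
Proof. by move=> [hx dx]; split; apply: val_inj. Qed.

End SubModule.

Section QuotientModule.
Variables (A : dgring) (M : dgmod A) (K : subdg M).
Local Notation sM := (dgm_st M).

Definition quo_eq (x y : M) : Prop := K (x - y).
Fact quo_refl x : quo_eq x x. Proof. by rewrite /quo_eq subrr; apply: insub0. Qed.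
Fact quo_sym x y : quo_eq x y -> quo_eq y x.
Proof. by move=> /insubN; rewrite opprB. Qed.
Fact quo_trans x y z : quo_eq x y -> quo_eq y z -> quo_eq x z.
Proof. by move=> xy /(insubD xy); rewrite addrA subrK. Qed.

Definition quo_car : Type := cquot quo_refl quo_sym quo_trans.
HB.instance Definition _ := Choice.on quo_car.
Definition qcls (x : M) : quo_car := cls _ _ _ x.
Local Notation qrep := (@rep _ _ quo_refl quo_sym quo_trans).

Lemma qclsP x y : qcls x = qcls y <-> K (x - y). Proof. exact: clsP. Qed.
Lemma qcls_surj c : exists x, c = qcls x. Proof. exact: cls_surj. Qed.
Lemma qrep_cls x : K (qrep (qcls x) - x).
Proof. exact: (@rep_cls _ _ quo_refl quo_sym quo_trans x). Qed.

Ltac q_elim c := let x := fresh "x" in case: (qcls_surj c) => x ->.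

Definition qadd (c e : quo_car) := qcls (qrep c + qrep e).
Definition qmap (f : M -> M) (c : quo_car) := qcls (f (qrep c)).

Lemma qaddE x y : qadd (qcls x) (qcls y) = qcls (x + y).
Proof. by apply/qclsP; rewrite opprD addrACA; apply: insubD; apply: qrep_cls. Qed.

Lemma qmapE (f : M -> M) x : {morph f : x y / x + y} -> (forall x, K x -> K (f x)) ->
  qmap f (qcls x) = qcls (f x).
Proof. by move=> fD fK; apply/qclsP; rewrite -(morphB fD); apply: fK; exact: (qrep_cls x). Qed.

Lemma qoppE x : qmap -%R (qcls x) = qcls (- x).
Proof. by apply: qmapE; [exact: opprD|exact: insubN]. Qed.

Fact qaddA : associative qadd.
Proof. by move=> a b c; q_elim a; q_elim b; q_elim c; rewrite !qaddE addrA. Qed.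
Fact qaddC : commutative qadd.
Proof. by move=> a b; q_elim a; q_elim b; rewrite !qaddE addrC. Qed.
Fact qadd0 : left_id (qcls 0) qadd.
Proof. by move=> a; q_elim a; rewrite qaddE add0r. Qed.
Fact qaddN : left_inverse (qcls 0) (qmap -%R) qadd.
Proof. by move=> a; q_elim a; rewrite qoppE qaddE addNr. Qed.
HB.instance Definition _ := GRing.isZmodule.Build quo_car qaddA qaddC qadd0 qaddN.

Lemma qclsD x y : qcls (x + y) = qcls x + qcls y. Proof. by rewrite -qaddE. Qed.

Definition qscale (a : A) := qmap ( *:%R a).

Lemma qscale_cls a x : qscale a (qcls x) = qcls (a *: x).
Proof. by apply: qmapE; [exact: scalerDr|exact: insubZ]. Qed.

Fact qscaleA a b x : qscale a (qscale b x) = qscale (a * b) x.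
Proof. by q_elim x; rewrite !qscale_cls scalerA. Qed.
Fact qscale1 : left_id 1 qscale.
Proof. by move=> x; q_elim x; rewrite qscale_cls scale1r. Qed.
Fact qscaleDr : right_distributive qscale +%R.
Proof. by move=> a x y; q_elim x; q_elim y; rewrite -qclsD !qscale_cls scalerDr qclsD. Qed.
Fact qscaleDl x : {morph qscale^~ x : a b / a + b}.
Proof. by move=> a b; q_elim x; rewrite !qscale_cls scalerDl qclsD. Qed.
HB.instance Definition _ := GRing.Zmodule_isLmodule.Build A quo_car
  qscaleA qscale1 qscaleDr qscaleDl.

Lemma qclsZ a x : qcls (a *: x) = a *: qcls x. Proof. by rewrite -qscale_cls. Qed.

Definition qcmp n := qmap (cmp sM n).
Definition qdif := qmap (dif sM).

Lemma qcmp_cls n x : qcmp n (qcls x) = qcls (cmp sM n x).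
Proof. by apply: qmapE; [exact: cmpD|exact: insub_cmp]. Qed.
Lemma qdif_cls x : qdif (qcls x) = qcls (dif sM x).
Proof. by apply: qmapE; [exact: difD|exact: insub_dif]. Qed.

Definition quo_st : dgstruct quo_car.
Proof.
exists qcmp qdif.
- by move=> n x y; q_elim x; q_elim y; rewrite -qclsD !qcmp_cls cmpD qclsD.
- move=> m n x; q_elim x; rewrite !qcmp_cls cmp_cmp; by case: ifP.
- move=> c; q_elim c; apply: (@fs_transfer _ _ sM _ qcls 0); first exact: qclsD.
  by move=> n y; rewrite qcmp_cls addr0.
- by move=> x y; q_elim x; q_elim y; rewrite -qclsD !qdif_cls difD qclsD.
- by move=> n x; q_elim x; rewrite qcmp_cls !qdif_cls qcmp_cls dif_cmp.
- by move=> x; q_elim x; rewrite !qdif_cls dif_dif.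
Defined.

Definition quo_dgmod : dgmod A.
Proof.
exists quo_car quo_st.
- move=> i j a m ha; q_elim m; rewrite /homog /= qcmp_cls => hx.
  rewrite -qclsZ qcmp_cls (dgm_cmpZ _ _ ha) !qclsZ hx; reflexivity.
- move=> i a m ha; q_elim m; rewrite /= -qclsZ !qdif_cls (dgm_leibniz _ ha) qclsD.
  by rewrite !qclsZ.
Defined.

Definition quo_proj : dghom M quo_dgmod.
Proof.
exists (qcls : M -> quo_dgmod).
- exact: qclsD.
- exact: qclsZ.
- by move=> n x; rewrite /= qcmp_cls.
- by move=> x; rewrite /= qdif_cls.
Defined.

Lemma quo_proj_eq0 x : quo_proj x = 0 <-> K x.
Proof. by rewrite -[X in K X](subr0 x); apply: qclsP. Qed.

Lemma quo_proj_surj y : exists x, y = quo_proj x. Proof. exact: qcls_surj. Qed.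

End QuotientModule.

Section KernelSubmodule.
Variable A : dgring.

Definition ker_piH : subdg (self A).
Proof.
exists (fun a : A => piH A a = 0).
- exact: drh0.
- by move=> a b a0 b0; rewrite drhD a0 b0 addr0.
- by move=> a b b0; rewrite (drhM (piH A) a b) b0 mulr0.
- by move=> n a a0; rewrite (drh_cmp (piH A)) a0 cmp0.
- by move=> a _; apply: piH_dif.
Defined.

Local Notation SH := (restr_dgmod (piH A) (self (H0 A))).

Definition piH_hom : dghom (self A) SH.
Proof.
exists (piH A : self A -> SH).
- exact: drhD.
- exact: drhM.
- exact: (drh_cmp (piH A)).
- exact: (drh_dif (piH A)).
Defined.

Lemma dif_mulr_cocycle (a c : A) : dif (dgr_st A) a = 0 ->
  a * dif (dgr_st A) c = dif (dgr_st A) (twist true a * c).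
Proof.
move=> da; have l := leibniz (M := self A) (twist true a) c.
by rewrite [RHS]l dif_twist da twist0 sgn0 twistK scale0r add0r.
Qed.

End KernelSubmodule.

(** * Converse statements for F *)

Section ReductionConverse.
Variables (A : dgring) (F : functor (Dcat A) (Dcat (H0 A))).
Local Notation S := (restr_dgmod (piH A)).
Local Notation T := tens_dgmod.
Local Notation sA := (dgr_st A).
Variable eps : forall M : dgmod A, @hom (Dcat (H0 A)) (F M) (T M).
Hypothesis eps_natural : forall (M N : dgmod A) (f : dghom M N),
  heq (ccomp (eps N) (fmap F (Dl f))) (ccomp (Dl (tens_hom f)) (eps M)).
Hypothesis eps_resolution : forall M : dgmod A, exists (P : dgmod A) (p : dghom P M),
  [/\ K_projective P, dg_qis p & is_iso (eps P)].

Let iA : is_iso (eps (self A)).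
Proof. exact: (eps_iso eps_natural eps_resolution (@self_Kprojective A)). Qed.

(* The inclusion of J = ker (A -> H^0(A)) into A is killed by F, and it is
   surjective on H^n for n < 0. *)
Lemma reduction_faithful_conv : faithful F -> equiv_H0 A.
Proof.
move=> Ff; apply/equiv_H0P => n n0 a ca.
pose i := sub_incl (ker_piH A); pose z := dghom0 (sub_dgmod (ker_piH A)) (self A).
have a0 : piH A a = 0 by apply: (piH_homog ca.1); rewrite lt_eqF.
have Ti : tens_hom i =1 tens_hom z.
  elim/tens_ind => [|x y IH IH'|h m]; first by rewrite !dmh0.
    by rewrite !dmhD IH IH'.
  rewrite /= !tens_fun_pure /= (balanced0r _ (pure_balanced _)).
  (* An element of J is a multiple of 1, so it moves across the tensor and becomes 0. *)
  have -> : pure h (val m : self A) = pure (h * piH A (val m)) (1 : self A).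
    by rewrite pureM; congr pure; rewrite -[RHS]/(val m * 1) mulr1.
  by rewrite (sub_carP m) mulr0 (balanced0l _ (pure_balanced _)).
have e : heq (Dl i) (Dl z).
  apply: Ff; apply: (iso_mono iA); apply: heq_trans (eps_natural i) _.
  apply: heq_sym; apply: heq_trans (eps_natural z) _; apply: compr; apply: heq_sym.
  exact: Dl_eq.
pose x : sub_dgmod (ker_piH A) := to_sub (a0 : ker_piH A a).
have cx : cocycle (sub_st (ker_piH A)) n x by apply: sub_cocycle.
by have := Dl_coh e cx; rewrite /= subr0.
Qed.

(* A preimage f : H^0(A) -> A of the counit makes f o pi an endomorphism of A with
   reduction the identity, hence right multiplication by a class equal to 1 in
   H^0(A); but f o pi factors through H^n(H^0(A)) = 0 on H^n. *)
Lemma reduction_full_conv : full F -> equiv_H0 A.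
Proof.
move=> Ff; apply/equiv_H0P => n n0 a ca.
pose H := H0 A; pose mu : dghom (T (S (self H))) (self H) := adjunct_hom (dghom_id _).
pose nu : dghom (T (self A)) (self H) := adjunct_hom (piH_hom A).
have c1 : cocycle (dgm_st (T (self A))) 0 (ext_unit (self A) 1).
  by apply: (dmh_cocycle (ext_unit (self A))); split; [apply: dgr_1|apply: dif1].
(* [nu] is the isomorphism from the tensor product with A onto H, and [nu'] is its inverse. *)
pose nu' : dghom (self H) (T (self A)) := self_map c1.
have nuE b : nu (ext_unit (self A) b) = piH A b := adjunct_homE (piH_hom A) b.
have nuK x : nu' (nu x) = x.
  have [b ->] := ext_unit_surj x; rewrite nuE -[LHS](dmhZ (ext_unit (self A)) b 1).
  by congr (ext_unit _ _); apply: mulr1.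
have muE x : mu (tens_hom (piH_hom A) x) = nu x.
  have [b ->] := ext_unit_surj x; rewrite nuE.
  have /= -> := ext_unit_natural (piH_hom A) b.
  exact: (adjunct_homE (dghom_id (S (self H))) (piH_hom A b)).
have [eA [eA1 eA2]] := iA.
pose g : hom (F (S (self H))) (F (self A)) :=
  ccomp eA (ccomp (Dl (dghom_comp nu' mu)) (eps (S (self H)))).
have [f ef] := Ff _ _ g.
have [r er] := Dl_rep_Kproj (ccomp f (Dl (piH_hom A))) (@self_Kprojective A).
have Tr : heq (Dl (tens_hom r)) (Dl (dghom_id (T (self A)))).
  apply: (iso_epi iA); apply: heq_trans (heq_sym (eps_natural r)) _.
  apply: heq_trans (compl _ (fmap_heq F (heq_sym er))) _.
  apply: heq_trans (compl _ (fmap_comp F _ _)) _.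
  apply: heq_trans (compl _ (compr _ ef)) _.
  apply: heq_trans (compl _ (heq_sym (ccompA _ _ _))) _.
  apply: heq_trans (cancel_invl _ eA2) _.
  apply: heq_trans (heq_sym (ccompA _ _ _)) _.
  apply: heq_trans (compl _ (eps_natural (piH_hom A))) _.
  apply: heq_trans (ccompA _ _ _) _; apply: compr.
  apply: heq_trans (heq_sym (Dl_comp _ _)) _; apply: Dl_eq => x.
  by rewrite /= -[X in _ = X]nuK -muE.
have [c hc ec] : coboundary sA 0 (r 1 - 1).
  have := dmh_coboundary nu (Dl_coh Tr c1).
  have trE : nu (tens_hom r (ext_unit (self A) 1)) = piH A (r 1).
    by rewrite -nuE; congr (nu _); apply: (ext_unit_natural r 1).
  rewrite dmhB trE nuE -(morphB (drhD (piH A))).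
  move=> /piH_coboundary /piH_eq0; have h0 : homog sA 0 (r 1 - 1).
    by apply: homogB; [apply: (dmh_homog r); apply: dgr_1|apply: dgr_1].
  by rewrite h0.
have cra : coboundary sA n (r a).
  have b0 : piH_hom A a = piH_hom A 0.
    by rewrite dmh0 [LHS](piH_homog ca.1) // lt_eqF.
  have e1 := coh_heq (exist _ a ca : cocycles n (self A)) er.
  have e2 := coh_heq (exist _ 0 (cocycle0 sA n) : cocycles n (self A)) er.
  have e3 : cohomologous (coh (ccomp f (Dl (piH_hom A))) (exist _ a ca))
    (coh (ccomp f (Dl (piH_hom A))) (exist _ 0 (cocycle0 sA n))).
    apply: (coh_cohomologous f); rewrite /cohomologous [X in X - _]b0 subrr; exact: coboundary0.
  have := cohomologous_trans (cohomologous_trans (cohomologous_sym e1) e3) e2.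
  by rewrite /cohomologous /= dmh0 subr0.
(* As [r] is right multiplication by [r 1 = 1 + d c], the elements [a] and [r a] differ by
   [a * d c], a boundary because [a] is a cocycle. *)
have -> : a = r a - a * dif sA c.
  by rewrite (self_mapE r a) -ec -[_ *: _]/(a * r 1) mulrBr mulr1 subKr.
apply: coboundaryB => //; rewrite (dif_mulr_cocycle _ ca.2).
apply: coboundary_dif; have -> : n - 1 = n + (0 - 1) by rewrite sub0r.
by apply: dgr_mul => //; rewrite (twist_homog _ ca.1); apply: homog_sgn; case: ca.
Qed.

End ReductionConverse.

(** * Coreduction *)

Lemma dif_scale_cocycle (A : dgring) (M : dgmod A) (a : A) (y : M) :
  dif (dgr_st A) a = 0 ->
  a *: dif (dgm_st M) y = dif (dgm_st M) (twist true a *: y).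
Proof.
by move=> da; rewrite leibniz dif_twist da twist0 sgn0 twistK scale0r add0r.
Qed.

Definition img (A : dgring) (M N : dgmod A) (f : dghom M N) : subdg N.
Proof.
exists (fun y => exists x, y = f x).
- by exists 0; rewrite dmh0.
- by move=> _ _ [x ->] [y ->]; exists (x + y); rewrite dmhD.
- by move=> a _ [x ->]; exists (a *: x); rewrite dmhZ.
- by move=> n _ [x ->]; exists (cmp (dgm_st M) n x); rewrite dmh_cmp.
- by move=> _ [x ->]; exists (dif (dgm_st M) x); rewrite dmh_dif.
Defined.

(** * Coextension of scalars and its adjunction *)

Section Coextension.
Variable A : dgring.
Local Notation H := (H0 A).
Local Notation S := (restr_dgmod (piH A)).
Local Notation C := coind_dgmod.

Definition coext_counit (M : dgmod A) : dghom (S (C M)) M.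
Proof.
exists (fun f : S (C M) => coind_fun (f : coind M) 1) => [//|a f|//|//].
by rewrite -[LHS]/(coind_fun f (1 * piH A a)) mul1r -[in LHS](mulr1 (piH A a)) (coindP f).2.
Defined.

Lemma coindE (M : dgmod A) (f : coind M) (a : A) : coind_fun f (piH A a) = a *: coind_fun f 1.
Proof. by rewrite -(coindP f).2 mulr1. Qed.

Lemma coind_ext1 (M : dgmod A) (f g : coind M) : coind_fun f 1 = coind_fun g 1 -> f = g.
Proof.
by move=> fg; apply: coind_ext => h; have [a _ ->] := piH_surj h; rewrite !coindE fg.
Qed.

Section CoindOf.
Variables (M : dgmod A) (m : M).
Hypothesis mJ : forall a : A, piH A a = 0 -> a *: m = 0.

Let lift (h : H) : A := projT1 (cid2 (piH_surj h)).
Let liftK h : piH A (lift h) = h. Proof. by rewrite /lift; case: (cid2 _). Qed.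
Let lift_eq a b : piH A a = piH A b -> a *: m = b *: m.
Proof.
move=> ab; apply/eqP; rewrite -subr_eq0 -scalerBl; apply/eqP/mJ.
by rewrite (morphB (drhD (piH A))) ab subrr.
Qed.

Fact coind_of_subproof : A_linear (fun h : H => lift h *: m).
Proof.
split=> [x y|a h]; rewrite -?scalerDl ?scalerA; apply: lift_eq.
  by rewrite drhD !liftK.
by rewrite (drhM (piH A)) !liftK.
Qed.

(** Evaluation at 1 identifies Hom_A(H^0(A), M) with the elements of M killed by J; this is the
    inverse. The section [lift] is merely set-theoretic, but scalars acting on [m] only matter
    modulo J. *)
Definition coind_of : coind M := Coind coind_of_subproof.

Lemma coind_ofE : coind_fun coind_of 1 = m.
Proof. by rewrite -[RHS]scale1r; apply: lift_eq; rewrite liftK drh1. Qed.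

End CoindOf.

Lemma coext_counitE (M : dgmod A) f : coext_counit M f = coind_fun (f : coind M) 1.
Proof. by []. Qed.

Lemma coind_cocycle (M : dgmod A) n (f : coind M) :
  cocycle (dgm_st M) n (coind_fun f 1) -> cocycle (coind_st M) n f.
Proof. by move=> [hf df]; split; apply: coind_ext1. Qed.

Lemma coext_counit_killed (M : dgmod A) f (a : A) : piH A a = 0 -> a *: coext_counit M f = 0.
Proof. by move=> a0; rewrite -dmhZ -[a *: f]/(piH A a *: (f : C M)) a0 scale0r dmh0. Qed.

Lemma conc_cmpZ (N : dgmod H) n (h : H) (x : N) :
  cmp (dgm_st N) n (h *: x) = h *: cmp (dgm_st N) n x.
Proof. by rewrite -[n in LHS]add0r; apply: dgm_cmpZ. Qed.

Lemma conc_difZ (N : dgmod H) (h : H) (x : N) :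
  dif (dgm_st N) (h *: x) = h *: dif (dgm_st N) x.
Proof. by rewrite leibniz twist_conc /= scale0r add0r. Qed.

Fact coext_unit_subproof (N : dgmod H) (x : N) : @A_linear A (S N) (fun h : H => h *: x).
Proof. by split=> [h h'|a h]; rewrite ?scalerDl // -scalerA. Qed.

Definition coext_unit (N : dgmod H) : dghom N (C (S N)).
Proof.
exists (fun x => Coind (coext_unit_subproof x) : C (S N)) => [x y|a x|n x|x];
  apply: coind_ext => h.
- exact: (@scalerDr H N).
- exact: (@scalerA H N).
- exact/esym/conc_cmpZ.
- exact/esym/conc_difZ.
Defined.

Lemma coext_unitK (N : dgmod H) x : coext_counit (S N) (coext_unit N x) = x.
Proof. exact: (@scale1r H N). Qed.

Lemma coext_triangle (M : dgmod A) x :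
  coext_unit (C M) (coind_hom (coext_counit M) x) = x.
Proof.
apply: coind_ext => h; apply: coind_ext1.
by rewrite -[LHS]/(coind_fun (coind_fun x (1 * h) : coind M) 1) mul1r.
Qed.

Lemma coext_counit_natural (M N : dgmod A) (f : dghom M N) :
  dghom_comp (coext_counit N) (restr_hom (piH A) (coind_hom f)) =1
  dghom_comp f (coext_counit M).
Proof. by []. Qed.

Section CounitInjective.
Variable I : dgmod A.
Hypothesis KI : K_injective I.
Hypothesis qA : equiv_H0 A.
Local Notation sI := (dgm_st I).
Local Notation SH := (S (self H)).

Let qpi : dg_qis (piH_hom A). Proof. exact: qA. Qed.

Let pi1 : piH_hom A 1 = 1 :> SH. Proof. exact: drh1 (piH A). Qed.

Let mul_map n (y : I) : homog sI n y ->
  exists2 f : self A -> I, graded_hom n f & f 1 = y.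
Proof.
move=> hy; have [|f hf ef] := sf_ext (@self_semifree A) (n := n) (v := fun=> y).
  by move=> _; rewrite add0r.
by exists f => //; apply: (ef tt).
Qed.

Let self_eq n (f g : self A -> I) : graded_hom n f -> graded_hom n g -> f 1 = g 1 -> f =1 g.
Proof. by move=> hf hg e; apply: (sf_eq (@self_semifree A) hf hg) => -[]. Qed.

Let gh_killed n (g : SH -> I) (a : A) : graded_hom n g -> piH A a = 0 -> a *: g 1 = 0.
Proof.
move=> hg a0; rewrite -[a in LHS](twistK (par n)) -(ghZ hg).
by rewrite -[_ *: _]/(piH A (twist (par n) a) * 1) mulr1 piH_twist a0 (gh0 hg).
Qed.

Let dif_gh n (f : self A -> I) : graded_hom n f -> hom_dif n f 1 = dif sI (f 1).
Proof. by move=> hf; rewrite hom_difE /= dif1 (gh0 hf) sgn0 subr0. Qed.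

Let dif_ghH n (f : SH -> I) h : graded_hom n f -> hom_dif n f h = dif sI (f h).
Proof. by move=> hf; rewrite hom_difE /= (gh0 hf) sgn0 subr0. Qed.

(** Evaluation at 1 is the map Hom_A(H, I) -> Hom_A(A, I) = I induced by [piH]. As [piH] is a
    quasi-isomorphism and [I] is K-injective, cocycles extend by [Kinj_extend] and primitives by
    [Kinj_epi]. *)
Lemma coext_counit_qis : dg_qis (coext_counit I).
Proof.
move=> n; split=> [x [hx dx] [y hy ey]|y [hy dy]].
  pose g (h : SH) := coind_fun (x : coind I) h.
  have hg : graded_hom n g.
    apply/graded_homP; split=> [h h'|k h|a h]; first exact: (coindP (x : coind I)).1.
      have hxh : homog sI n (g h) by have := congr1 (fun f => coind_fun f h) hx.
      rewrite /= /conc_cmp; have [->|k0] := eqVneq k 0; first by rewrite add0r.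
      rewrite [RHS](morph0 (coindP (x : coind I)).1); apply: (homog_neq hxh).
      by apply: contra_neq k0 => e; apply: (addIr n); rewrite e add0r.
    by rewrite /g -(coindP (x : coind I)).2 piH_twist.
  have dg h : hom_dif n g h = 0.
    by rewrite (dif_ghH _ hg); have := congr1 (fun f => coind_fun f h) dx.
  have [s hs es] := mul_map hy.
  have ge a : g (piH_hom A a) = hom_dif (n - 1) s a.
    move: a; apply: (@self_eq n); first exact: graded_hom_pre.
      by have := hom_dif_graded hs; rewrite subrK.
    by rewrite (dif_gh hs) es -ey pi1.
  have [t ht et] := Kinj_epi KI qpi hg dg hs ge.
  exists (coind_of (m := t 1) (fun a => gh_killed ht)).
    apply: coind_ext1; rewrite -[LHS]/(cmp sI (n - 1) (coind_fun _ 1)) coind_ofE.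
    by have := gh_homog ht (dgr_1 H); rewrite add0r.
  apply: coind_ext1; rewrite -[RHS]/(dif sI (coind_fun _ 1)) coind_ofE.
  by rewrite -(dif_ghH _ ht) -et.
have [f hf ef] := mul_map hy.
have df a : hom_dif n f a = 0.
  move: a; apply: (@self_eq (n + 1)); [exact: hom_dif_graded|exact: graded_hom0|].
  by rewrite (dif_gh hf) ef.
have [g [hg dg [s hs es]]] := Kinj_extend KI qpi hf df.
exists (coind_of (m := g 1) (fun a => gh_killed hg)).
  apply: coind_cocycle; rewrite coind_ofE; split; last by rewrite -(dif_ghH _ hg) dg.
  by have := gh_homog hg (dgr_1 H); rewrite add0r.
rewrite coext_counitE coind_ofE -opprB; apply: coboundaryN; exists (s 1).
  by have := gh_homog hs (dgr_1 A); rewrite add0r.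
by have := es 1; rewrite (dif_gh hs) ef pi1.
Qed.

End CounitInjective.
End Coextension.

(** * Full faithfulness of G and its converses *)

Section Coreduction.
Variables (A : dgring) (G : functor (Dcat A) (Dcat (H0 A))).
Local Notation H := (H0 A).
Local Notation S := (restr_dgmod (piH A)).
Local Notation S_ := (restr_hom (piH A)).
Local Notation FS := (forgetful A).
Local Notation C := coind_dgmod.
Local Notation sA := (dgr_st A).
Variable eta : forall M : dgmod A, @hom (Dcat H) (C M) (G M).
Hypothesis eta_natural : forall (M N : dgmod A) (f : dghom M N),
  heq (ccomp (fmap G (Dl f)) (eta M)) (ccomp (eta N) (Dl (coind_hom f))).
Hypothesis eta_resolution : forall M : dgmod A, exists (I : dgmod A) (i : dghom M I),
  [/\ K_injective I, dg_qis i & is_iso (eta I)].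

(** The K-injective modules with [eta] invertible come with G, and they represent every isomorphism
    class of D(A). *)
Let Kiso (M : Dcat A) : exists (I : Dcat A) (p : hom I M),
  (K_injective I /\ is_iso (eta I)) /\ is_iso p.
Proof.
have [I [i [KI qi iI]]] := eta_resolution M.
by have [p ip _] := iso_sym (Dl_iso qi); exists I, p.
Qed.

Lemma counit_square (M N : dgmod A) (f : dghom M N) :
  heq (ccomp (Dl (coext_counit N)) (fmap FS (Dl (coind_hom f))))
      (ccomp (Dl f) (Dl (coext_counit M))).
Proof.
apply: heq_trans (heq_sym (Dl_comp _ _)) _; apply: heq_trans (Dl_comp _ _).
apply: Dl_eq; exact: coext_counit_natural.
Qed.

Lemma coreduction_faithful : equiv_H0 A -> faithful G.
Proof.
move=> qA; apply: (faithful_on_iso Kiso) => I I' [KI iI] [KI' iI'] f g fg.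
have [a ea] := Dl_rep_Kinj f KI'; have [b eb] := Dl_rep_Kinj g KI'.
apply: (heq_trans ea); apply: heq_sym; apply: (heq_trans eb); apply: heq_sym.
apply: (iso_epi (Dl_iso (coext_counit_qis KI qA))).
apply: heq_trans (heq_sym (counit_square a)) _; apply: heq_trans (counit_square b).
apply: compl; apply: fmap_heq; apply: (iso_mono iI').
apply: heq_trans (heq_sym (eta_natural a)) _; apply: heq_trans (eta_natural b).
apply: compr; apply: heq_trans (fmap_heq G (heq_sym ea)) _.
by apply: heq_trans fg _; apply: fmap_heq.
Qed.

(** Dual to [reduction_full]: a morphism of coinduced modules is carried along the invertible
    counits to a morphism [I -> I'], and faithfulness of S identifies its image. *)
Lemma coreduction_full : equiv_H0 A -> full G.
Proof.
move=> qA; apply: (full_on_iso Kiso) => I I' [KI iI] [KI' iI'] g.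
have [e' [_ e2]] := iI'; have ic := Dl_iso (coext_counit_qis KI qA).
have [c' [c1 _]] := ic.
pose g' : @hom (Dcat H) (C I) (C I') := ccomp e' (ccomp g (eta I)).
have [f ef] := Dl_rep_Kinj (ccomp (ccomp (Dl (coext_counit I')) (fmap FS g')) c') KI'.
have Ef : heq (Dl (coind_hom f)) g'.
  apply: (forgetful_faithful qA).
  apply: (iso_mono (Dl_iso (coext_counit_qis KI' qA))).
  apply: heq_trans (counit_square f) _; apply: heq_trans (compr _ (heq_sym ef)) _.
  exact: cancel_invr.
exists (Dl f); apply: (iso_epi iI); apply: heq_trans (eta_natural f) _.
apply: heq_trans (compl _ Ef) _; exact: cancel_invl.
Qed.

(* For a K-injective resolution i : A -> I, the projection of I onto its quotient
   by the elements killed by J is killed by G; hence i 1 is cohomologous to an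
   element killed by J. *)
Lemma coreduction_faithful_conv : faithful G -> equiv_H0 A.
Proof.
move=> Gf; apply/equiv_H0P => n n0 a ca.
have [I [i [KI qi iI]]] := eta_resolution (self A).
pose K := img (coext_counit I); pose q := quo_proj K; pose z := dghom0 I (quo_dgmod K).
have e : heq (Dl q) (Dl z).
  apply: Gf; apply: (iso_epi iI); apply: heq_trans (eta_natural q) _.
  apply: heq_sym; apply: heq_trans (eta_natural z) _; apply: compl; apply: heq_sym.
  apply: Dl_eq => f; apply: coind_ext1; apply/quo_proj_eq0; by exists f.
have c1 : cocycle (dgm_st (self A)) 0 (1 : self A) by split; [exact: dgr_1|exact: dif1].
have := Dl_coh e (dmh_cocycle i c1); rewrite subr0 => -[y' hy' ey'].
have [y ey] := quo_proj_surj y'.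
have [f ef] : K (i 1 - dif (dgm_st I) (cmp (dgm_st I) (0 - 1) y)).
  by apply/quo_proj_eq0; rewrite dmhB dmh_dif dmh_cmp -ey [q _]ey' hy' subrr.
apply: (qi n).1 => //.
have -> : i a = a *: dif (dgm_st I) (cmp (dgm_st I) (0 - 1) y).
  have ai : i a = a *: i 1 by apply: (self_mapE i a).
  rewrite ai -[i 1](subrK (dif (dgm_st I) (cmp (dgm_st I) (0 - 1) y))) ef scalerDr.
  by rewrite coext_counit_killed ?add0r // (piH_homog ca.1) // lt_eqF.
rewrite (dif_scale_cocycle _ ca.2); apply: coboundary_dif.
have -> : n - 1 = n + (0 - 1) by rewrite sub0r.
apply: dgm_scale; last exact: homog_cmp.
by rewrite (twist_homog _ ca.1); apply: homog_sgn; case: ca.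
Qed.

Definition degree_below n (b : A) : Prop := forall k, n <= k -> cmp sA k b = 0.

Lemma degree_belowD n b c : degree_below n b -> degree_below n c -> degree_below n (b + c).
Proof. by move=> hb hc k nk; rewrite cmpD hb // hc // addr0. Qed.

Lemma degree_belowM n (c b : A) : degree_below n b -> degree_below n (c * b).
Proof.
move=> hb k nk; elim/(homog_ind (s := sA)): c => [|c c' IH IH'|i c hc].
- by rewrite mul0r cmp0.
- by rewrite mulrDl cmpD IH IH' addr0.
have [i0|i0] := ltP 0 i; first by rewrite (dgr_homog_pos i0 hc) mul0r cmp0.
have -> : k = i + (k - i) by rewrite addrCA subrr addr0.
rewrite [LHS](dgm_cmpZ (M := self A) _ _ hc) hb ?scaler0 //.
by lia.
Qed.

Lemma degree_below_homog n k b : homog sA k b -> k < n -> degree_below n b.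
Proof.
move=> hb kn l nl; apply: (homog_neq hb); apply: contraTneq nl => ->.
by rewrite -ltNge.
Qed.

(** This is A^{<n} + B^n. The quotient of A by it vanishes below degree n, so it has no boundaries
    in degree n, and a cocycle of degree n that dies in it is a boundary of A. *)
Definition trunc_sub (n : int) : subdg (self A).
Proof.
exists (fun b : A => exists2 x : A * A, degree_below n x.1 /\ degree_below n x.2 &
  b = x.1 + dif sA x.2).
- by exists (0, 0); rewrite /= ?dif0 ?addr0 //; split=> k _; apply: cmp0.
- move=> _ _ [[x y] [/= hx hy] ->] [[x' y'] [/= hx' hy'] ->]; exists (x + x', y + y') => /=.
    by split; apply: degree_belowD.
  by rewrite difD addrACA.
- move=> a _ [[x y] [/= hx hy] ->].
  (* By the Leibniz rule, [a * d y] is [d (twist true a * y) - d (twist true a) * y]. *)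
  exists (a * x - dif sA (twist true a) * y, twist true a * y) => /=.
    split; last exact: degree_belowM.
    apply: degree_belowD; first exact: degree_belowM.
    by rewrite -mulNr; apply: degree_belowM.
  rewrite [dif _ (_ * y)](leibniz (M := self A) (twist true a) y) twistK -[RHS]addrA.
  rewrite [- _ + _]addrA addNr add0r; exact: mulrDr.
- move=> k _ [[x y] [/= hx hy] ->].
  exists (cmp sA k x, cmp sA (k - 1) y) => /=; last by rewrite cmpD dif_cmpE.
  split=> l nl; rewrite cmp_cmp; case: eqP => // <-; [exact: hx|exact: hy].
- move=> _ [[x y] [/= hx hy] ->]; exists (0, x) => /=.
    by split=> // k _; apply: cmp0.
  by rewrite difD dif_dif addr0 add0r.
Defined.

Lemma trunc_sub_coboundary n (a : A) : homog sA n a -> trunc_sub n a -> coboundary sA n a.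
Proof.
move=> ha [[x y] [/= hx hy] e]; exists (cmp sA (n - 1) y); first exact: homog_cmp.
by rewrite -dif_cmpE -ha e cmpD hx // add0r.
Qed.

(** Components of [b] in negative degrees push [a] below degree n. The degree 0 component is some
    [d c], and [d c * a = d (c * a)] as [a] is a cocycle. *)
Lemma trunc_sub_killed n (a b : A) : cocycle sA n a -> piH A b = 0 -> trunc_sub n (b * a).
Proof.
move=> [ha da] /piH_eq0[c hc ec].
exists ((b - cmp sA 0 b) * a, c * a) => /=.
  split; last first.
    by apply: degree_below_homog (dgr_mul hc ha) _; lia.
  elim/(homog_ind (s := sA)): b {ec} => [|b b' IH IH'|i b hb].
  - by rewrite cmp0 subrr mul0r => k _; apply: cmp0.
  - by rewrite cmpD opprD addrACA mulrDl; apply: degree_belowD.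
  have [i0|i0] := eqVneq i 0.
    by rewrite i0 in hb; rewrite [cmp _ 0 b]hb subrr mul0r => k _; apply: cmp0.
  rewrite (homog_neq hb) 1?eq_sym // subr0.
  have [i1|i1] := ltP 0 i.
    by rewrite (dgr_homog_pos i1 hb) mul0r => k _; apply: cmp0.
  by apply: degree_below_homog (dgr_mul hb ha) _; lia.
rewrite [dif _ (c * a)](leibniz (M := self A) c a) /= da scaler0 addr0 -ec.
by rewrite -[_ *: _]/(_ * _) -mulrDl subrK.
Qed.

(* Let I be a K-injective resolution of A / (A^{<n} + B^n). A preimage f of the
   unit at coind I is a left inverse of coind I -> I. Now f kills the class of
   a * 1, because J acts by zero on coind I, while a * 1 lies in coind I. *)
Lemma coreduction_full_conv : full G -> equiv_H0 A.
Proof.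
move=> Gf; apply/equiv_H0P => n n0 a ca.
pose q := quo_proj (trunc_sub n).
have [I [i [KI qi iI]]] := eta_resolution (quo_dgmod (trunc_sub n)).
pose M := S (C I); pose c : dghom M I := coext_counit I.
have [I2 [j [KI2 qj iI2]]] := eta_resolution M.
have [e [e1 _]] := iI.
have [f ef] := Gf I M (ccomp (eta M) (ccomp (Dl (coext_unit (C I))) e)).
have hG : heq (ccomp (fmap G (ccomp f (Dl c))) (eta M)) (eta M).
  apply: heq_trans (compr _ (fmap_comp G _ _)) _.
  apply: heq_trans (heq_sym (ccompA _ _ _)) _.
  apply: heq_trans (compl _ (eta_natural c)) _.
  apply: heq_trans (ccompA _ _ _) _.
  apply: heq_trans (compr _ (compr _ ef)) _.
  apply: heq_trans (compr _ (heq_sym (ccompA _ _ _))) _.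
  apply: heq_trans (compr _ (compl _ (cancel_invr _ e1))) _.
  apply: heq_trans (heq_sym (ccompA _ _ _)) _.
  apply: heq_trans (compl _ _) (ccomp_idr _).
  apply: heq_trans (heq_sym (Dl_comp _ _)) _; apply: heq_trans (Dl_id _).
  by apply: Dl_eq; apply: coext_triangle.
(* A map out of the restricted module [M] is recovered from its coinduction by unit and counit. *)
have E (k : dghom M I2) : heq (Dl k)
    (ccomp (ccomp (Dl (coext_counit I2)) (fmap FS (Dl (coind_hom k))))
      (Dl (S_ (coext_unit (C I))))).
  apply: heq_trans (compr _ (Dl_comp _ _)).
  apply: heq_trans (Dl_comp _ _); apply: Dl_eq => x.
  by rewrite -[in LHS](coext_unitK (N := C I) x).
have fc : heq (ccomp f (Dl c)) (idm (M : Dcat A)).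
  apply: (iso_mono (Dl_iso qj)).
  (* In the K-injective [I2] the composite is an honest map [k]; by [hG] it has the same coinduction
     as [j], so [E] identifies the two. *)
  have [k ek] := Dl_rep_Kinj (ccomp (Dl j) (ccomp f (Dl c))) KI2.
  apply: (heq_trans ek); apply: heq_trans (heq_sym (ccomp_idr _)).
  have ekj : heq (Dl (coind_hom k)) (Dl (coind_hom j)).
    apply: (iso_mono iI2); apply: heq_trans (heq_sym (eta_natural k)) _.
    apply: heq_trans (eta_natural j).
    apply: heq_trans (compr _ (fmap_heq G (heq_sym ek))) _.
    apply: heq_trans (compr _ (fmap_comp G _ _)) _.
    by apply: heq_trans (heq_sym (ccompA _ _ _)) _; apply: compl.
  apply: heq_trans (E k) _; apply: heq_trans (heq_sym (E j)).
  by apply: compr; apply: compl; apply: fmap_heq.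
have [r er] := Dl_rep_Kproj (ccomp f (Dl (dghom_comp i q))) (@self_Kprojective A).
have a0 : piH A a = 0 by rewrite (piH_homog ca.1) // lt_eqF.
have ra : r a = 0.
  by rewrite (self_mapE r a) -[_ *: _]/(piH A a *: (r 1 : C I)) a0 scale0r.
have kill b : piH A b = 0 -> b *: i (q a) = 0.
  move=> b0; rewrite -dmhZ -(dmhZ q b a); have -> : q (b *: (a : self A)) = 0.
    by apply/quo_proj_eq0; apply: trunc_sub_killed.
  exact: dmh0.
pose w : M := coind_of kill.
have cqa : cocycle (dgm_st I) n (i (q a)) by apply/dmh_cocycle/dmh_cocycle.
have cw : cocycle (dgm_st M) n w by apply: coind_cocycle; rewrite coind_ofE.
have ew := coh_heq (exist _ w cw) fc.
have ea := coh_heq (exist _ a ca : cocycles n (self A)) er.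
have wa : cohomologous (coh (ccomp f (Dl c)) (exist _ w cw))
    (coh (ccomp f (Dl (dghom_comp i q))) (exist _ a ca)).
  apply: (coh_cohomologous f); rewrite /cohomologous /=.
  by rewrite [coind_fun _ _](coind_ofE kill) subrr; apply: coboundary0.
have := cohomologous_trans (cohomologous_trans (cohomologous_sym ew) wa) ea.
rewrite /cohomologous /= ra subr0 => /(dmh_coboundary c).
rewrite [c w](coind_ofE kill) => /((qi n).1 _ (dmh_cocycle q ca)) [y' hy' ey'].
have [y ey] := quo_proj_surj y'.
pose y0 := cmp sA (n - 1) y.
have hy0 : homog sA (n - 1) y0 by apply: homog_cmp.
apply: (@coboundary_eq _ _ _ _ (dif sA y0)); last by exists y0.
apply: trunc_sub_coboundary.
  by apply: homogB; [exact: ca.1|exact: (coboundary_cocycle (coboundary_dif hy0)).1].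
apply/(quo_proj_eq0 (trunc_sub n)); rewrite -/q.
rewrite [q _](dmhB q a (dif (dgm_st (self A)) (cmp (dgm_st (self A)) (n - 1) y))).
by rewrite dmh_dif dmh_cmp -[q y]ey ey' hy' subrr.
Qed.

End Coreduction.

(** * Fullness of the forgetful functor *)

Section KilledModule.
Variables (A : dgring) (Y : dgmod A).
Hypothesis kill : forall (a : A), piH A a = 0 -> forall y : Y, a *: y = 0.

(** Fullness of S applies only to targets of the form S N. A module killed by J embeds into such a
    target, its coinduction. *)
Definition killed_unit : dghom Y (restr_dgmod (piH A) (coind_dgmod Y)).
Proof.
exists (fun y => coind_of (fun a a0 => kill a0 y)) => [x y|a x|n x|x]; apply: coind_ext1.
- by rewrite coind_funD !coind_ofE.
- rewrite coind_ofE -[RHS]/(coind_fun _ (1 * piH A a)) mul1r coindE coind_ofE //.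
- by rewrite coind_ofE -[RHS]/(cmp _ n (coind_fun _ 1)) coind_ofE.
- by rewrite coind_ofE -[RHS]/(dif _ (coind_fun _ 1)) coind_ofE.
Defined.

Lemma killed_unit_eq0 y : killed_unit y = 0 -> y = 0.
Proof. by move=> /(congr1 (fun f => coind_fun f 1)); rewrite coind_ofE. Qed.

End KilledModule.

Section ForgetfulConverse.
Variable A : dgring.
Local Notation S := (restr_dgmod (piH A)).
Local Notation H := (H0 A).
Local Notation sA := (dgr_st A).
Hypothesis Sfull : full (forgetful A).

Section Step.
Variable m : int.
Hypothesis m0 : m < 0.
Hypothesis acm : forall k, m < k -> k < 0 -> coh_zero sA k.

(** Negative components of [b] move [j], which lives in degrees <= m, strictly below m. *)
Lemma cmp_mul_top (b j : A) : (forall k, m < k -> cmp sA k j = 0) ->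
  cmp sA m (b * j) = cmp sA 0 b * cmp sA m j.
Proof.
move=> hj; elim/(homog_ind (s := sA)): b => [|b c IH IH'|i b hb].
- by rewrite cmp0 !mul0r cmp0.
- by rewrite mulrDl !cmpD IH IH' mulrDl.
have -> : m = i + (m - i) by rewrite addrCA subrr addr0.
rewrite [LHS](dgm_cmpZ (M := self A) _ _ hb) -[_ *: _]/(_ * _).
have [i0|i0] := eqVneq i 0.
  by rewrite i0 in hb *; rewrite [cmp _ 0 b]hb add0r.
rewrite (homog_neq hb) 1?eq_sym // mul0r; have [i1|i1] := ltP 0 i.
  by rewrite (dgr_homog_pos i1 hb) mul0r.
by rewrite hj ?mulr0 //; lia.
Qed.

(** The canonical truncation of A at m: degrees below m and the cocycles in degree m. As H^k(A) = 0
    for m < k < 0, the cone of its inclusion has only the cohomology H^0(A). *)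
Definition trunc_le : subdg (self A).
Proof.
exists (fun b : A => degree_below (m + 1) b /\ dif sA (cmp sA m b) = 0).
- by rewrite cmp0 dif0; split=> // k _; apply: cmp0.
- move=> b c [hb db] [hc dc]; split; first exact: degree_belowD.
  by rewrite cmpD difD db dc addr0.
- move=> c b [hb db]; split; first exact: degree_belowM.
  rewrite [c *: b]/(c * b) cmp_mul_top; last by move=> k mk; apply: hb; lia.
  have l := leibniz (M := self A) (cmp sA 0 c) (cmp sA m b).
  by rewrite [LHS]l db scaler0 addr0 (dif_homog0 (homog_cmp _ _ _)) scale0r.
- move=> n b [hb db]; split=> [k mk|]; first by rewrite cmp_cmp; case: eqP => // <-; apply: hb.
  by rewrite cmp_cmp; case: eqP => [<-|]; rewrite ?db ?dif0.
- move=> b [hb db]; split=> [k mk|]; last by rewrite dif_cmpE dif_dif.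
  rewrite dif_cmpE; have [e|ne] := eqVneq (k - 1) m; first by rewrite e db.
  by rewrite hb ?dif0 //; lia.
Defined.

Local Notation J := (sub_dgmod trunc_le).
Local Notation Z := (cone (sub_incl trunc_le)).

Lemma trunc_leP (j : J) : degree_below (m + 1) (val j : A) /\ dif sA (cmp sA m (val j)) = 0.
Proof. exact: sub_carP j. Qed.

Lemma trunc_le_top (j : J) k : m < k -> cmp sA k (val j) = 0.
Proof. by move=> mk; apply: (trunc_leP j).1; lia. Qed.

Lemma trunc_le_homog (j : J) k : homog (dgm_st J) k j -> m < k -> j = 0.
Proof.
by move=> /(congr1 val) /= hj mk; apply: val_inj; apply: (etrans (esym hj)); exact: trunc_le_top.
Qed.

Lemma trunc_le_scale (a : A) (j : J) : coboundary sA m (cmp sA m (val j)) ->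
  coboundary sA m (cmp sA m (val (a *: j))).
Proof.
move=> [y hy ey]; rewrite [val _]/(a * val j) cmp_mul_top; last exact: trunc_le_top.
have h0 := homog_cmp sA 0 a; exists (cmp sA 0 a * y).
  by rewrite -[m - 1]add0r; apply: dgr_mul.
have l := leibniz (M := self A) (cmp sA 0 a) y.
by rewrite ey [RHS]l (dif_homog0 h0) scale0r add0r (twist_homog _ h0) andbF.
Qed.

(** The quotient of the cone by this is Z^m / B^m = H^m(A), placed in degree m - 1 because the first
    summand of a cone is shifted. *)
Definition cone_top : subdg Z.
Proof.
exists (fun z : Z => coboundary sA m (cmp sA m (val z.1))).
- by rewrite cmp0; apply: coboundary0.
- by move=> x y hx hy; rewrite /= cmpD; apply: coboundaryD.
- by move=> a z; apply: trunc_le_scale.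
- move=> n z hz; rewrite /= cmp_cmp; case: eqP => [<-|_] //; exact: coboundary0.
- move=> z _; rewrite /= cmpN; apply: coboundaryN; rewrite dif_cmpE.
  by apply: coboundary_dif; apply: homog_cmp.
Defined.

Local Notation Y := (quo_dgmod cone_top).
Local Notation kappa := (quo_proj cone_top).

(** Only the degree 0 part of [b] (up to a twist) matters in degree m; it is some [d c], and
    [d c * z = d (c * z)] for a cocycle [z]. *)
Lemma cone_top_kill (b : A) : piH A b = 0 -> forall y : Y, b *: y = 0.
Proof.
move=> b0 y; have [z ->] := quo_proj_surj y; rewrite -dmhZ; apply/quo_proj_eq0.
have [c hc ec] : coboundary sA 0 (cmp sA 0 (twist true b)).
  by apply: piH_eq0; rewrite piH_twist.
rewrite -[cone_top _]/(coboundary sA m (cmp sA m (twist true b * val z.1))).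
rewrite cmp_mul_top; last exact: trunc_le_top.
exists (c * cmp sA m (val z.1)).
  have -> : m - 1 = 0 - 1 + m by lia.
  by apply: dgr_mul => //; apply: homog_cmp.
have l := leibniz (M := self A) c (cmp sA m (val z.1)).
by rewrite [RHS]l (trunc_leP z.1).2 scaler0 addr0 ec.
Qed.

Lemma cone_top_degree n (y : Y) : n != m - 1 -> cmp (dgm_st Y) n y = 0.
Proof.
move=> nm; have [z ->] := quo_proj_surj y; rewrite -dmh_cmp; apply/quo_proj_eq0.
rewrite /= cmp_cmp; case: eqP => [e|_]; last exact: coboundary0.
by rewrite e addrK eqxx in nm.
Qed.

Lemma coind_top_degree n (f : coind_dgmod Y) : n != m - 1 -> homog (coind_st Y) n f -> f = 0.
Proof. by move=> nm <-; apply: coind_ext1; apply: cone_top_degree. Qed.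

Local Notation SH := (S (self H)).

Definition cone_piH : dghom Z SH.
Proof.
exists (fun z : Z => piH A (z.2 : A) : SH) => [x y|a x|n x|x].
- exact: (drhD (piH A)).
- exact: (drhM (piH A)).
- exact: (drh_cmp (piH A)).
- rewrite [LHS](drhD (piH A)) piH_dif addr0.
  apply: piH_fun0; exact: trunc_le_top.
Defined.

Lemma cone_piH_qis : dg_qis cone_piH.
Proof.
move=> n; split=> [[j b] [[hj hb] [dj db]] /piH_coboundary b0|y [hy _]]; last first.
  have [b hb ey] := piH_surj y; have [n0|n0] := eqVneq n 0.
    exists ((0, b) : Z).
      split; congr pair.
      - exact: cmp0 (dgm_st J) _.
      - by rewrite n0.
      - by rewrite [dif _ _](dif0 (dgm_st J)) oppr0.
      - by rewrite [dif _ _](dif_homog0 hb) addr0.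
    by rewrite ey subrr; apply: coboundary0.
  have -> : y = 0 by rewrite -[y]hy /= /conc_cmp (negPf n0).
  exists 0; first exact: cocycle0.
  by rewrite dmh0 subrr; apply: coboundary0.
have prim (c : A) : homog sA (n - 1) c -> j = 0 -> b = dif sA c ->
    coboundary (dgm_st Z) n ((j, b) : Z).
  move=> hc -> ->; exists ((0, c) : Z); congr pair => //.
  - exact: cmp0 (dgm_st J) _.
  - by rewrite [dif _ _](dif0 (dgm_st J)) oppr0.
  - by rewrite [RHS]add0r.
(* Above degree m the first component vanishes and [b] is a boundary, by [acm] or, when n = 0, by
   its vanishing in H^0(A). *)
have [nm|nm] := ltP m n.
  have j0 : j = 0 by apply: (trunc_le_homog hj); lia.
  have db0 : dif sA b = 0 by rewrite -[LHS]add0r -[RHS]db j0.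
  have [n0|n0|n0] := ltgtP n 0.
  - by have [c hc ec] := acm nm n0 (conj hb db0); apply: prim ec.
  - by apply: (@prim 0); rewrite ?dif0 //; [apply: homog0|apply: dgr_homog_pos hb].
  - have [c hc ec] := piH_eq0 b0; apply: (@prim c); rewrite ?n0 //.
    by rewrite -ec -n0 [cmp _ _ _]hb.
have jE : val j = - dif sA b by apply/eqP; rewrite -addr_eq0 [X in X == 0]db.
(* In degrees n <= m the element [b] itself lies in the truncation, and [(b, 0)] is a primitive of
   [(j, b)], since its differential is [(- d b, b)]. *)
have Jb : trunc_le b.
  split; first by apply: degree_below_homog hb _; lia.
  have [e|ne] := eqVneq m n; last by rewrite (homog_neq hb) ?dif0.
  rewrite e [cmp _ n b]hb; apply: oppr_inj; rewrite -jE oppr0.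
  by rewrite (trunc_le_homog hj) //; lia.
exists ((to_sub Jb, 0) : Z).
  congr pair; last exact: cmp0.
  by apply: val_inj; rewrite /= subrK.
congr pair; first by apply: val_inj; apply: jE.
by rewrite [RHS]/= dif0 addr0.
Qed.

(* The morphism from H^0(A) to the shift of H^m(A) given by cone_piH^-1 and kappa
   comes from D(H^0(A)) if S is full, hence vanishes for degree reasons. *)
Lemma forgetful_full_step : coh_zero sA m.
Proof.
move=> a ca; pose kap := dghom_comp (killed_unit cone_top_kill) kappa.
have [psi [psi1 _]] := Dl_iso cone_piH_qis.
have [k ek] := Sfull (ccomp (Dl kap) psi : @hom (Dcat A) (S (self H)) (S (coind_dgmod Y))).
have [k0 ek0] := Dl_rep_Kproj k (@self_Kprojective H).
have k00 x : k0 x = 0.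
  rewrite (self_mapE k0 x); have -> : k0 1 = 0; last exact: scaler0.
  apply: (@coind_top_degree 0); first by lia.
  by apply: (dmh_homog k0); apply: dgr_1.
have ekap : heq (Dl kap) (Dl (dghom0 Z (S (coind_dgmod Y)))).
  apply: heq_trans (heq_sym (cancel_invr _ psi1)) _.
  apply: heq_trans (compr _ (heq_sym ek)) _.
  apply: heq_trans (compr _ (fmap_heq (forgetful A) ek0)) _.
  apply: heq_trans (heq_sym (Dl_comp _ _)) _; apply: Dl_eq => x; exact: k00.
pose P := resolution SH; pose p := res_aug SH.
have KP : K_projective P := @resolution_Kprojective _ _.
have [q eq] := Kproj_lift KP cone_piH_qis p.
have [h hh eh] : homotopic (dghom_comp kap q) (dghom0 P (S (coind_dgmod Y))).
  apply: (Dl_inj_Kproj KP); apply: heq_trans (Dl_comp _ _) _.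
  apply: heq_trans (compr _ ekap) _; apply: heq_trans (heq_sym (Dl_comp _ _)) _.
  exact: Dl_eq.
have c1 : cocycle (dgm_st SH) 0 (1 : H) by split; [exact: dgr_1|].
have SH0 n (z : SH) : coboundary (dgm_st SH) n z -> z = 0 by case.
have [x [hx dx] /SH0/eqP] := (res_aug_qis SH 0).2 _ c1.
rewrite subr_eq0 => /eqP px.
have a0 : piH A a = 0 by rewrite (piH_homog ca.1) // lt_eqF.
(* The augmentation of [a *: x] carries the factor [piH A a = 0], so this cocycle bounds in the
   resolution. *)
have [y hy ey] : coboundary (dgm_st P) m (a *: x).
  apply: (res_aug_qis SH m).1.
    split; first by rewrite -[m]addr0; apply: dgm_scale => //; case: ca.
    by rewrite leibniz ca.2 dx scaler0 scale0r addr0.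
  rewrite dmhZ -[_ *: _]/(piH A a * _) a0 mul0r; exact: coboundary0.
have [hq2 pq2] : homog sA 0 (q x).2 /\ piH A (q x).2 = 1.
  split; first exact: (congr1 snd (dmh_homog q hx)).
  have /SH0/eqP := homotopic_coboundary eq (conj hx dx).
  by rewrite subr_eq0 => /eqP; rewrite -px.
have [c hc ec] : coboundary sA 0 ((q x).2 - 1).
  have h0 : homog sA 0 ((q x).2 - 1) by apply: homogB => //; apply: dgr_1.
  rewrite -h0; apply: piH_eq0.
  by rewrite (morphB (drhD (piH A))) pq2 drh1 subrr.
have hqy := dmh_homog q hy.
have bj : coboundary sA m (val (q y).1 : A).
  have hj : homog sA m (val (q y).1 : A).
    by have := congr1 val (congr1 fst hqy); rewrite /= subrK.
  rewrite -hj; apply: (iffLR (quo_proj_eq0 cone_top (q y))).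
  apply: (killed_unit_eq0 (kill := cone_top_kill)).
  have := eh y; rewrite subr0 hom_difN1 -ey (ghZ hh) => e.
  rewrite [LHS]e -[_ *: _]/(piH A (twist _ a) *: (h x : coind_dgmod Y)) piH_twist a0 scale0r addr0.
  (* [y] has degree m - 1, so [h y] has degree m - 2, while the coinduced module lives in degree m -
     1 only. *)
  have -> : h y = 0; last exact: dif0.
  by apply: (@coind_top_degree (m - 1 - 1)); [lia|apply: (gh_homog hh)].
have := congr1 snd (dmh_dif q y); rewrite -ey dmhZ /= => e.
(* The second component of [q (d y) = a *: q x] in the cone reads
   [a * (q x).2 = (q y).1 + d (q y).2], and [(q x).2 = 1 + d c]. *)
have -> : a = val (q y).1 + dif sA (q y).2 - a * dif sA c.
  by rewrite -[X in X - _]e -ec -[_ *: _]/(a * _) mulrBr mulr1 subKr.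
apply: coboundaryB; last first.
  rewrite (dif_mulr_cocycle _ ca.2); apply: coboundary_dif.
  have -> : m - 1 = m + (0 - 1) by rewrite sub0r.
  by apply: dgr_mul => //; rewrite (twist_homog _ ca.1); apply: homog_sgn; case: ca.
apply: coboundaryD => //; apply: coboundary_dif; exact: (congr1 snd hqy).
Qed.

End Step.

Lemma forgetful_full_conv : equiv_H0 A.
Proof.
apply/equiv_H0P => n n0.
suff H k : forall n, n = - (k.+1)%:Z -> coh_zero sA n by apply: (H `|n|.-1); lia.
elim/ltn_ind: k => k IH {n0} {}n en.
apply: forgetful_full_step; first by lia.
by move=> l nl l0; apply: (IH `|l|.-1); lia.
Qed.

End ForgetfulConverse.

(** * Examples *)

Section ZeroDifferential.
Variable A : dgring.
Local Notation H := (H0 A).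
Local Notation sA := (dgr_st A).
Hypothesis dA : forall a : A, dif sA a = 0.

Let sec_fun (h : H) : A := projT1 (cid2 (piH_surj h)).
Let sec_homog h : homog sA 0 (sec_fun h). Proof. by rewrite /sec_fun; case: (cid2 _). Qed.
Let secK h : piH A (sec_fun h) = h. Proof. by rewrite /sec_fun; case: (cid2 _). Qed.

Let sec_uniq h (a : A) : homog sA 0 a -> piH A a = h -> sec_fun h = a.
Proof.
move=> ha e; apply/eqP; rewrite -subr_eq0; apply/eqP.
have hd : homog sA 0 (sec_fun h - a) by apply: homogB.
have [|c _ ec] := @piH_eq0 A (sec_fun h - a).
  by rewrite (morphB (drhD (piH A))) secK e subrr.
by rewrite -hd ec dA.
Qed.

(** With zero differential no boundaries are divided out, so each class in H^0(A) has exactly one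
    representative of degree 0, and taking it is multiplicative. *)
Definition H0_section : dgrhom H A.
Proof.
exists sec_fun.
- by move=> x y; apply: sec_uniq; [apply: homogD|rewrite drhD !secK].
- move=> x y; apply: sec_uniq; last by rewrite drhM !secK.
  by rewrite -[0]addr0; apply: dgr_mul.
- by apply: sec_uniq; [apply: dgr_1|apply: drh1].
- move=> n x; rewrite /= /conc_cmp; have [->|n0] := eqVneq n 0; first by rewrite sec_homog.
  rewrite (homog_neq (sec_homog x) n0).
  by apply: sec_uniq; [apply: homog0|apply: drh0].
- by move=> x; rewrite dA; apply: sec_uniq; [apply: homog0|apply: drh0].
Defined.

Lemma H0_sectionK h : piH A (H0_section h) = h. Proof. exact: secK. Qed.

Let R := restr_D H0_section.

Definition section_iso (N : dgmod H) :
  dghom N (restr_dgmod H0_section (restr_dgmod (piH A) N)).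
Proof.
exists (fun x : N => x : restr_dgmod H0_section (restr_dgmod (piH A) N)) => // a x.
by rewrite -[RHS]/(piH A (H0_section a) *: x) H0_sectionK.
Defined.

Lemma section_iso_qis N : dg_qis (section_iso N).
Proof.
by move=> n; split=> // y cy; exists y; rewrite //= subrr; apply: coboundary0.
Qed.

(** Naturality is clear for maps of DG-modules; for a formal inverse it follows from that of [w] by
    cancellation. Hence restriction along the section is a left inverse of S up to isomorphism. *)
Lemma section_natural (M N : dgmod H) (phi : @hom (Dcat H) M N) :
  heq (ccomp (Dl (section_iso N)) phi)
      (ccomp (fmap R (fmap (forgetful A) phi)) (Dl (section_iso M))).
Proof.
elim: phi => {M N} [M N f|M N w qw|M N P g IHg f IHf].
- apply: heq_trans (heq_sym (Dl_comp (section_iso N) f)) _.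
  by apply: heq_trans (Dl_comp (restr_hom H0_section (restr_hom (piH A) f)) _); apply: Dl_eq.
- apply: (iso_mono (fmap_iso R (fmap_iso (forgetful A) (Dl_iso qw)))).
  have e1 : heq (ccomp (Dl w) (linv qw : @hom (Dcat H) N M)) (idm (N : Dcat H)).
    exact: leq_invr.
  have e2 : heq (ccomp (fmap R (fmap (forgetful A) (Dl w)))
      (fmap R (fmap (forgetful A) (linv qw : @hom (Dcat H) N M)))) (idm _).
    exact: leq_invr.
  apply: heq_sym; apply: heq_trans (cancel_invl _ e2) _.
  apply: heq_sym; apply: heq_trans (ccompA _ _ _) _.
  have e3 : heq (ccomp (fmap R (fmap (forgetful A) (Dl w))) (Dl (section_iso M)))
      (ccomp (Dl (section_iso N)) (Dl w)).
    apply: heq_trans (Dl_comp (section_iso N) w).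
    apply: heq_trans (heq_sym (Dl_comp (restr_hom H0_section (restr_hom (piH A) w)) _)) _.
    exact: Dl_eq.
  apply: heq_trans (compr _ e3) _; exact: cancel_invr.
- apply: heq_trans (ccompA (Dl (section_iso P)) (g : @hom (Dcat H) N P) (f : @hom (Dcat H) M N)) _.
  apply: heq_trans (compr _ IHg) _; apply: heq_trans (heq_sym (ccompA _ _ _)) _.
  apply: heq_trans (compl _ IHf) _; apply: heq_trans (ccompA _ _ _) _.
  exact: heq_refl.
Qed.

Lemma dif0_forgetful_faithful : faithful (forgetful A).
Proof.
move=> M N phi psi e; apply: (iso_mono (Dl_iso (@section_iso_qis N))).
apply: heq_trans (section_natural phi) _; apply: heq_sym.
apply: heq_trans (section_natural psi) _; apply: heq_sym.
by apply: compr; apply: fmap_heq.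
Qed.

End ZeroDifferential.

Section FiniteRing.
Variables (A : dgring) (k : nat) (g : 'I_k -> A).
Hypothesis g_surj : forall x : A, exists i, x = g i.

(** All elements of the finite ring serve as generators; those outside the ideal, or not cocycles,
    are replaced by 0 to keep a fixed index set. *)
Lemma finite_dg_noetherian : dg_noetherian A.
Proof.
split=> [I I0 ID IZ|n].
  pose h i := piH A (g i) : H0_car A.
  exists k, (fun i => if `[< I (h i) >] then h i else 0) => x; split=> [Ix|[c ->]].
    have [a _ ea] := piH_surj (x : H0 A); have [i0 ei] := g_surj a.
    exists (fun i => if i == i0 then 1 else 0).
    rewrite (bigD1 i0) //= big1 => [|i /negPf ->]; last by rewrite mul0r.
    have hx : h i0 = x by rewrite /h -ei -ea.
    by rewrite hx eqxx mul1r addr0 asboolT.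
  elim/big_ind: _ => // i _; apply: IZ.
  by case: asboolP.
exists k, (fun i => if `[< cocycle (dgr_st A) n (g i) >] then g i else 0); split=> [i|z cz].
  by case: asboolP => // _; apply: cocycle0.
have [i0 ei] := g_surj z; exists (fun i => if i == i0 then 1 else 0); split=> [i|].
  by case: ifP => _; [apply: dgr_1|apply: homog0].
rewrite (bigD1 i0) //= big1 => [|i /negPf ->]; last by rewrite mul0r.
rewrite eqxx mul1r addr0 -ei asboolT // subrr; exact: coboundary0.
Qed.

End FiniteRing.

(* The DG-ring R (+) E, with E an R-module in degree -1, E * E = 0 and the
   differential e |-> (bd e, 0). *)
Section TwoTerm.
Variables (R : comPzRingType) (E : lmodType R) (bd : E -> R).
Hypothesis bdD : {morph bd : x y / x + y}.
Hypothesis bdZ : forall r e, bd (r *: e) = r * bd e.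
Hypothesis bd_comm : forall e f, bd e *: f = bd f *: e.

Definition tt_car : Type := (R * E)%type.
HB.instance Definition _ := GRing.Zmodule.on tt_car.

Definition tt_mul (x y : tt_car) : tt_car := (x.1 * y.1, x.1 *: y.2 + y.1 *: x.2).

Fact tt_mulA : associative tt_mul.
Proof.
move=> x y z; congr pair; rewrite /= ?mulrA // !scalerDr !scalerA addrA.
by rewrite [x.1 * z.1]mulrC [y.1 * z.1]mulrC.
Qed.
Fact tt_mul1l : left_id ((1, 0) : tt_car) tt_mul.
Proof. by move=> [r e]; congr pair; rewrite /= ?mul1r // scale1r scaler0 addr0. Qed.
Fact tt_mul1r : right_id ((1, 0) : tt_car) tt_mul.
Proof. by move=> [r e]; congr pair; rewrite /= ?mulr1 // scale1r scaler0 add0r. Qed.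
Fact tt_mulDl : left_distributive tt_mul +%R.
Proof.
by move=> x y z; congr pair; rewrite /= ?mulrDl // scalerDl scalerDr addrACA.
Qed.
Fact tt_mulDr : right_distributive tt_mul +%R.
Proof.
by move=> x y z; congr pair; rewrite /= ?mulrDr // scalerDl scalerDr addrACA.
Qed.
HB.instance Definition _ := GRing.Zmodule_isPzRing.Build tt_car
  tt_mulA tt_mul1l tt_mul1r tt_mulDl tt_mulDr.

Definition tt_cmp (n : int) (x : tt_car) : tt_car :=
  (if n == 0 then x.1 else 0, if n == -1 then x.2 else 0).

Definition tt_st : dgstruct tt_car.
Proof.
exists tt_cmp (fun x => (bd x.2, 0) : tt_car).
- by move=> n x y; congr pair => /=; case: ifP => _; rewrite ?addr0.
- move=> m n x; have [->|mn] := eqVneq m n.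
    by congr pair => /=; case: (n == _).
  congr pair => /=.
    by have [m0|//] := eqVneq m 0; rewrite -m0 eq_sym (negPf mn).
  by have [m0|//] := eqVneq m (-1); rewrite -m0 eq_sym (negPf mn).
- move=> [r e]; exists [:: 0; -1]; split=> //.
  by rewrite big_cons big_seq1; congr pair; rewrite /= ?addr0 ?add0r.
- by move=> x y; congr pair; rewrite /= ?bdD ?addr0.
- move=> n x; congr pair; rewrite /= ?if_same //.
  rewrite -[0 in LHS](addNr 1) (inj_eq (addIr 1)); case: ifP => //= _.
  by rewrite (morph0 bdD).
- by move=> x; congr pair; rewrite (morph0 bdD).
Defined.

Lemma tt_homogP n x : homog tt_st n x ->
  [\/ n = 0 /\ x = (x.1, 0), n = -1 /\ x = (0, x.2) | x = 0].
Proof.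
move=> hx; have e : x = (if n == 0 then x.1 else 0, if n == -1 then x.2 else 0) := esym hx.
have [n0|n0] := eqVneq n 0; first by constructor 1; rewrite {1}e n0.
have [n1|n1] := eqVneq n (-1); first by constructor 2; rewrite {1}e n1.
by constructor 3; rewrite e (negPf n0) (negPf n1).
Qed.

Fact tt_one : homog tt_st 0 1. Proof. by []. Qed.

Fact tt_mul_homog i j a b :
  homog tt_st i a -> homog tt_st j b -> homog tt_st (i + j) (a * b).
Proof.
move=> /tt_homogP ha /tt_homogP hb.
  case: ha => [[-> ->]|[-> ->]|->]; last by rewrite mul0r; apply: homog0.
    case: hb => [[-> ->]|[-> ->]|->]; last by rewrite mulr0; apply: homog0.
      by congr pair; rewrite //= !scaler0 addr0.
    by congr pair; rewrite //= mulr0.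
  case: hb => [[-> ->]|[-> ->]|->]; last by rewrite mulr0; apply: homog0.
    by congr pair; rewrite //= mul0r.
  by congr pair; rewrite //= ?mul0r // !scale0r addr0.
Qed.

(** The delicate case is that of two elements of degree -1: their product is 0, so the rule demands
    [bd e *: f = bd f *: e], which is [bd_comm]. *)
Fact tt_leibniz i a b : homog tt_st i a ->
  dif tt_st (a * b) = dif tt_st a * b + (-1) ^+ `|i|%N * (a * dif tt_st b).
Proof.
move=> ha; have [r0|[i0 ->]|[i1 ->]] : [\/ a = 0, i = 0 /\ a = (a.1, 0) | i = -1 /\ a = (0, a.2)].
  + by case: (tt_homogP ha) => [?|?|?]; [constructor 2|constructor 3|constructor 1].
  + by rewrite r0 !mul0r (dif0 tt_st) !(mul0r, mulr0) addr0.
  + rewrite i0 expr0 mul1r; congr pair; rewrite /= (morph0 bdD) !scaler0 !addr0.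
      by rewrite bdZ mul0r add0r.
    by rewrite scale0r.
  + rewrite i1 expr1 mulN1r; congr pair; rewrite /= !scale0r !add0r.
      by rewrite bdZ mul0r subr0 mulrC.
    by rewrite scaler0 addr0 bd_comm subrr.
Qed.

Fact tt_nonpos n a : 0 < n -> cmp tt_st n a = 0.
Proof.
move=> n0; congr pair; rewrite /=; case: eqP => // e; by rewrite e in n0.
Qed.

Definition two_term : dgring := DGRing tt_one tt_mul_homog tt_leibniz tt_nonpos.

Lemma two_term_commutative : dg_commutative two_term.
Proof.
have C (x y : two_term) : x * y = y * x.
  by congr pair; [apply: mulrC|apply: addrC].
split=> [i j a b ha hb|i a ha oi].
  rewrite C; have [e|e] := boolP (odd `|(i * j)%R|%N); last first.
    by rewrite -signr_odd (negPf e) expr0 mul1r.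
  suff -> : b * a = 0 by rewrite mulr0.
  case: (tt_homogP ha) e => [[-> _]|[-> ->]|->]; rewrite ?mul0r ?mulr0 //.
  case: (tt_homogP hb) => [[-> _]|[-> ->]|->]; rewrite ?mulr0 ?mul0r // => _.
  by congr pair; rewrite /= ?mul0r // !scale0r addr0.
case: (tt_homogP ha) oi => [[-> _] //|[_ ->]|->]; last by rewrite mul0r.
by move=> _; congr pair; rewrite /= ?mul0r // !scale0r addr0.
Qed.

Lemma two_term_bounded : bounded_cohomology two_term.
Proof.
exists (-1) => n n1 x [/tt_homogP hx _].
have -> : x = 0 by case: hx => [[e _]|[e _]|//]; rewrite e in n1.
exact: coboundary0.
Qed.

(** Nothing lives in degree -2, so a nonzero [e] in the kernel of [bd] is a nonzero class of degree
    -1. *)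
Lemma two_term_not_equiv (e : E) : bd e = 0 -> e <> 0 -> ~ equiv_H0 two_term.
Proof.
move=> be e0 /equiv_H0P/(_ (-1))/(_ _)/(_ ((0, e) : tt_car)) [] //.
  by split; congr pair.
by move=> y _ /(congr1 snd).
Qed.

End TwoTerm.

Section FirstExample.
Local Notation F2 := ('F_2 : fieldType).

Let bd0 (e : F2^o) : F2 := 0.

(** The generator of square zero has degree -1. Over the finite field F_2, noetherianity reduces to
    an enumeration. *)
Definition dual_numbers : dgring :=
  @two_term F2 (F2^o) bd0 (fun _ _ => esym (addr0 0)) (fun r _ => esym (mulr0 r))
    (fun e f => etrans (scale0r f) (esym (scale0r e))).

Lemma dual_numbers_noetherian : dg_noetherian dual_numbers.
Proof.
apply: (@finite_dg_noetherian dual_numbers _ (fun i : 'I_#|{: 'F_2 * 'F_2}| => enum_val i)).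
by move=> x; exists (enum_rank (x : 'F_2 * 'F_2)); rewrite enum_rankK.
Qed.

Lemma dual_numbers_not_equiv : ~ equiv_H0 dual_numbers.
Proof. by apply: (@two_term_not_equiv _ _ _ _ _ _ 1). Qed.

Lemma dual_numbers_faithful : faithful (forgetful dual_numbers).
Proof. exact: dif0_forgetful_faithful. Qed.

End FirstExample.

Lemma coef_conc_dif (A : dgring) (G : finType) (delta : G -> free (H0 A) G) f g :
  coef (free_dif delta f) g = \sum_g' coef f g' * coef (delta g') g.
Proof.
have D g' : {morph (fun a : H0 A => fbase (dif (dgr_st (H0 A)) a) g' + twist true a *: delta g')
    : a b / a + b}.
  by move=> a b; rewrite difD fbaseD twistD scalerDl addrACA.
rewrite /free_dif (fsumE D (s := index_enum G)) ?index_enum_uniq // => [|g'].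
  rewrite (big_morph (fun f => coef f g) (id1 := 0) (op1 := +%R)) //.
  by apply: eq_bigr => g' _; rewrite coefD fbase0 coef0 add0r twist_conc.
by rewrite mem_index_enum.
Qed.

Ltac pairs := repeat (apply: (f_equal2 (@pair _ _))); rewrite /=; try ring.

(** * The Massey product example *)

Section SecondExampleRing.
Variable F : fieldType.

(* F[x, y] / (x^3, x y, y^2), with basis ((1, x), (y, x^2)). *)
Definition mono_car : Type := ((F * F) * (F * F))%type.
HB.instance Definition _ := GRing.Zmodule.on mono_car.

Definition mono_mul (r s : mono_car) : mono_car :=
  ((r.1.1 * s.1.1, r.1.1 * s.1.2 + r.1.2 * s.1.1),
   (r.1.1 * s.2.1 + r.2.1 * s.1.1, r.1.1 * s.2.2 + r.2.2 * s.1.1 + r.1.2 * s.1.2)).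

Fact mono_mulA : associative mono_mul. Proof. by move=> r s t; pairs. Qed.
Fact mono_mulC : commutative mono_mul. Proof. by move=> r s; pairs. Qed.
Fact mono_mul1 : left_id (((1, 0), (0, 0)) : mono_car) mono_mul.
Proof. by move=> [[? ?] [? ?]]; pairs. Qed.
Fact mono_mulDl : left_distributive mono_mul +%R.
Proof. by move=> r s t; pairs. Qed.
HB.instance Definition _ := GRing.Zmodule_isComPzRing.Build mono_car
  mono_mulA mono_mulC mono_mul1 mono_mulDl.

(* The module with basis (e, z), where y e = z. *)
Definition ez_car : Type := (F * F)%type.
HB.instance Definition _ := GRing.Zmodule.on ez_car.

Definition ez_scale (r : mono_car) (e : ez_car) : ez_car :=
  (r.1.1 * e.1, r.1.1 * e.2 + r.2.1 * e.1).

Fact ez_scaleA r s e : ez_scale r (ez_scale s e) = ez_scale (r * s) e.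
Proof. by pairs. Qed.
Fact ez_scale1 : left_id 1 ez_scale. Proof. by move=> [? ?]; pairs. Qed.
Fact ez_scaleDr : right_distributive ez_scale +%R. Proof. by move=> r e f; pairs. Qed.
Fact ez_scaleDl e : {morph ez_scale^~ e : r s / r + s}. Proof. by move=> r s; pairs. Qed.
HB.instance Definition _ := GRing.Zmodule_isLmodule.Build mono_car ez_car
  ez_scaleA ez_scale1 ez_scaleDr ez_scaleDl.

Definition ez_bd (e : ez_car) : mono_car := ((0, 0), (0, e.1)).

Fact ez_bdD : {morph ez_bd : e f / e + f}. Proof. by move=> e f; pairs. Qed.
Fact ez_bdZ r e : ez_bd (r *: e) = r * ez_bd e. Proof. by pairs. Qed.
Fact ez_bd_comm e f : ez_bd e *: f = ez_bd f *: e. Proof. by pairs. Qed.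

(* d e = x^2 and x y = 0, so that y e = z represents the Massey product <y, x, x>. *)
Definition massey : dgring := two_term ez_bdD ez_bdZ ez_bd_comm.

End SecondExampleRing.

Section SecondExample.
Variable F : fieldType.
Local Notation A := (massey F).
Local Notation H := (H0 A).
Local Notation sA := (dgr_st A).

Definition mel (r0 rx ry rw e z : F) : A := (((r0, rx), (ry, rw)) : mono_car F, (e, z) : ez_car F).

(** As x^2 = d e, the ring H^0(A) is F[x, y] / (x^2, x y, y^2), with basis 1, x, y. *)
Definition hel (r0 rx ry : F) : H := piH A (mel r0 rx ry 0 0 0).

Lemma piH_hel (a : A) : piH A a = hel a.1.1.1 a.1.1.2 a.1.2.1.
Proof.
apply/eqP; rewrite -subr_eq0 -(morphB (drhD (piH A))); apply/eqP.
case: a => [[[r0 rx] [ry rw]] [e z]].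
have -> : ((r0, rx, (ry, rw), (e, z)) : A) - mel r0 rx ry 0 0 0 =
    dif sA (mel 0 0 0 0 rw 0) + mel 0 0 0 0 e z.
  by pairs.
rewrite drhD piH_dif add0r; apply: (@piH_homog _ (-1)) => //.
Qed.

Lemma helD r0 rx ry s0 sx sy :
  hel r0 rx ry + hel s0 sx sy = hel (r0 + s0) (rx + sx) (ry + sy).
Proof. by rewrite /hel -drhD piH_hel. Qed.

Lemma helM r0 rx ry s0 sx sy :
  hel r0 rx ry * hel s0 sx sy = hel (r0 * s0) (r0 * sx + rx * s0) (r0 * sy + ry * s0).
Proof. by rewrite /hel -drhM piH_hel. Qed.

Lemma hel0 : hel 0 0 0 = 0. Proof. exact: drh0. Qed.

Lemma helN r0 rx ry : - hel r0 rx ry = hel (- r0) (- rx) (- ry).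
Proof. by apply/eqP; rewrite eq_sym -addr_eq0 helD !addNr hel0. Qed.

Lemma hel_eq0 r0 rx ry : hel r0 rx ry = 0 -> [/\ r0 = 0, rx = 0 & ry = 0].
Proof. by move=> /piH_eq0[[y e] _ [-> -> -> _]]. Qed.

Lemma hel_surj (h : H) : exists r0 rx ry, h = hel r0 rx ry.
Proof. by have [a _ ->] := piH_surj h; rewrite piH_hel; do 3 eexists. Qed.

(* The complex H -x-> H -x-> H -y-> H in degrees -3, ..., 0. *)
Local Notation G4 := 'I_4.
Definition kdeg (i : G4) : int := - (i%:Z).
Definition kdelta (i : G4) : free H G4 :=
  match val i with
  | 1 => fbase (hel 0 0 1) (@Ordinal 4 0 isT)
  | 2 => fbase (hel 0 1 0) (@Ordinal 4 1 isT)
  | 3 => fbase (hel 0 1 0) (@Ordinal 4 2 isT)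
  | _ => 0
  end.

Lemma kdelta_homog i : free_cmp kdeg (kdeg i + 1) (kdelta i) = kdelta i.
Proof.
case: i => [[|[|[|[|i]]]] lt] //=; rewrite /kdelta /=; first exact: morph0 (free_cmpD _ _);
  by rewrite free_cmp_base /= /conc_cmp.
Qed.

Lemma kdelta_cocycle i : free_dif kdelta (kdelta i) = 0.
Proof.
have z2 : hel 0 1 0 * hel 0 0 1 = 0 by rewrite helM !(mulr0, mul0r, addr0) hel0.
have z3 : hel 0 1 0 * hel 0 1 0 = 0 by rewrite helM !(mulr0, mul0r, addr0) hel0.
have b0 g : fbase (0 : H) g = 0 := fbase0 _ g.
have D h g : free_dif kdelta (fbase h g) = h *: kdelta g.
  by rewrite free_dif_base [dif _ _]/(0 : H) b0 add0r twist_conc.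
case: i => [[|[|[|[|i]]]] lt] //.
- exact: morph0 (free_difD _).
- by rewrite -[kdelta (Ordinal lt)]/(fbase (hel 0 0 1) (@Ordinal 4 0 isT)) D scaler0.
- rewrite -[kdelta (Ordinal lt)]/(fbase (hel 0 1 0) (@Ordinal 4 1 isT)) D.
  by rewrite [kdelta _]/(fbase (hel 0 0 1) (@Ordinal 4 0 isT)) fbaseZ z2 b0.
- rewrite -[kdelta (Ordinal lt)]/(fbase (hel 0 1 0) (@Ordinal 4 2 isT)) D.
  by rewrite [kdelta _]/(fbase (hel 0 1 0) (@Ordinal 4 1 isT)) fbaseZ z3 b0.
Qed.

Definition kmod : dgmod H := free_dgmod kdelta_homog kdelta_cocycle.

Lemma kmod_Kprojective : K_projective kmod.
Proof.
apply: (semifree_Kprojective (free_semifree kdelta_homog kdelta_cocycle (rk := val) _)).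
move=> i j; case: i => [[|[|[|[|i]]]] lt] //=; rewrite /kdelta /= ?eqxx // coef_base;
  by case: (eqVneq j _) => [->|_]; rewrite // eqxx.
Qed.

Lemma kmod_dif (f : free H G4) (i : G4) : coef (free_dif kdelta f) i =
  match val i with
  | 0 => coef f (@Ordinal 4 1 isT) * hel 0 0 1
  | 1 => coef f (@Ordinal 4 2 isT) * hel 0 1 0
  | 2 => coef f (@Ordinal 4 3 isT) * hel 0 1 0
  | _ => 0
  end.
Proof.
rewrite coef_conc_dif !big_ord_recl big_ord0 /kdelta /= !coef_base coef0 mulr0 add0r addr0.
rewrite -!(inj_eq val_inj) /=.
have E (j k : G4) (h : H) : val j = val k -> coef f j * h = coef f k * h.
  by move=> /val_inj ->.
by case: i => [[|[|[|[|i]]]] lt] //=; rewrite ?(mulr0, addr0, add0r); try exact: E.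
Qed.

Fact ntop_homog (i : unit) : free_cmp (fun=> -3) (-3 + 1) (0 : free H unit) = 0.
Proof. exact: morph0 (free_cmpD _ _). Qed.
Fact ntop_cocycle (i : unit) : free_dif (fun=> 0) (0 : free H unit) = 0.
Proof. exact: morph0 (free_difD _). Qed.
(** This is H[3]. *)
Definition ntop : dgmod H := free_dgmod ntop_homog ntop_cocycle.

Lemma ntop_dif (f : ntop) : dif (dgm_st ntop) f = 0.
Proof.
by apply: free_ext => i; rewrite [LHS]coef_conc_dif big1 // => j _; rewrite mulr0.
Qed.

Definition phi_fun (f : kmod) : ntop := fbase (coef f (@Ordinal 4 3 isT) * hel 0 0 1) tt.

Fact phi_cmp n x : phi_fun (cmp (dgm_st kmod) n x) = cmp (dgm_st ntop) n (phi_fun x).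
Proof.
rewrite [RHS]free_cmp_base /phi_fun coef_cmp; congr fbase.
by rewrite /= /conc_cmp; case: ifP => _; rewrite ?mul0r.
Qed.

Definition phi : dghom kmod ntop.
Proof.
exists phi_fun => [x y|a x|n x|x].
- by rewrite /phi_fun coefD mulrDl fbaseD.
- by rewrite /phi_fun coefZ -mulrA -fbaseZ.
- exact: phi_cmp.
- by rewrite ntop_dif /phi_fun [coef _ _]kmod_dif mul0r fbase0.
Defined.

(** On the last generator, a null-homotopy is governed by its value on generator 2, and would make y
    a multiple of x in H. *)
Lemma phi_neq0 : ~ heq (Dl phi) (Dl (dghom0 kmod ntop)).
Proof.
move=> /(Dl_inj_Kproj kmod_Kprojective)[h hh eh].
pose g i := gen kdelta_homog kdelta_cocycle i.
have := eh (g (@Ordinal 4 3 isT)); rewrite subr0 hom_difN1 ntop_dif add0r.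
rewrite (dif_gen kdelta_homog) /kdelta /= (graded_hom_fbase _ _ hh) twist_conc.
move=> /(congr1 (fun f => coef f tt)); rewrite coefZ /= coef_base.
have [r0 [rx [ry ->]]] := hel_surj
  (coef (h (gen kdelta_homog kdelta_cocycle (@Ordinal 4 2 isT))) tt).
rewrite coef_base /= mul1r helM !(mulr0, mul0r, addr0, add0r) => /eqP.
rewrite -subr_eq0 helN helD => /eqP/hel_eq0[_ _ /eqP].
by rewrite subr0 oner_eq0.
Qed.

End SecondExample.

Section SecondExampleResolution.
Variable F : fieldType.
Local Notation A := (massey F).
Local Notation H := (H0 A).
Local Notation sA := (dgr_st A).

(* A non-free model over A of the complex kmod: its generators m_0, ..., m_3
   lift those of kmod, and x^2 m_1 = z m_0 is killed by the extra generator n of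
   degree -2, with d m_3 = x m_2 - n and d n = z m_0. The coordinates in
   degrees 0, -1, -2, -3 are
     (m0, x m0, y m0, x^2 m0), (e m0, z m0, m1, x m1, y m1),
     (m2, x m2, y m2, n) and (m3, x m3, y m3). *)
Definition rmod_car : Type :=
  (((F * F) * (F * F)) * (((F * F) * (F * F)) * F) *
   (((F * F) * (F * F)) * ((F * F) * F)))%type.
HB.instance Definition _ := GRing.Zmodule.on rmod_car.

Definition rel (m0 xm0 ym0 wm0 em0 zm0 m1 xm1 ym1 m2 xm2 ym2 n m3 xm3 ym3 : F) : rmod_car :=
  ((((m0, xm0), (ym0, wm0)), (((em0, zm0), (m1, xm1)), ym1)),
   (((m2, xm2), (ym2, n)), ((m3, xm3), ym3))).

Local Notation m0 v := (v.1.1.1.1) (only parsing).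
Local Notation xm0 v := (v.1.1.1.2) (only parsing).
Local Notation ym0 v := (v.1.1.2.1) (only parsing).
Local Notation wm0 v := (v.1.1.2.2) (only parsing).
Local Notation em0 v := (v.1.2.1.1.1) (only parsing).
Local Notation zm0 v := (v.1.2.1.1.2) (only parsing).
Local Notation m1 v := (v.1.2.1.2.1) (only parsing).
Local Notation xm1 v := (v.1.2.1.2.2) (only parsing).
Local Notation ym1 v := (v.1.2.2) (only parsing).
Local Notation m2 v := (v.2.1.1.1) (only parsing).
Local Notation xm2 v := (v.2.1.1.2) (only parsing).
Local Notation ym2 v := (v.2.1.2.1) (only parsing).
Local Notation nn v := (v.2.1.2.2) (only parsing).
Local Notation m3 v := (v.2.2.1.1) (only parsing).
Local Notation xm3 v := (v.2.2.1.2) (only parsing).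
Local Notation ym3 v := (v.2.2.2) (only parsing).
Local Notation r0 a := (a.1.1.1) (only parsing).
Local Notation rx a := (a.1.1.2) (only parsing).
Local Notation ry a := (a.1.2.1) (only parsing).
Local Notation rw a := (a.1.2.2) (only parsing).
Local Notation ce a := (a.2.1) (only parsing).
Local Notation cz a := (a.2.2) (only parsing).

(** Products outside the listed basis vanish, except x^2 m_1 = z m_0; in particular x^2, e and z
    kill m_2 and m_3, and x, y kill n. *)
Definition rmod_scale (a : A) (v : rmod_car) : rmod_car :=
  rel (r0 a * m0 v) (r0 a * xm0 v + rx a * m0 v) (r0 a * ym0 v + ry a * m0 v)
    (r0 a * wm0 v + rx a * xm0 v + rw a * m0 v)
    (r0 a * em0 v + ce a * m0 v)
    (r0 a * zm0 v + ry a * em0 v + rx a * xm1 v + rw a * m1 v + ce a * ym0 v + cz a * m0 v)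
    (r0 a * m1 v) (r0 a * xm1 v + rx a * m1 v) (r0 a * ym1 v + ry a * m1 v)
    (r0 a * m2 v) (r0 a * xm2 v + rx a * m2 v) (r0 a * ym2 v + ry a * m2 v) (r0 a * nn v)
    (r0 a * m3 v) (r0 a * xm3 v + rx a * m3 v) (r0 a * ym3 v + ry a * m3 v).

Ltac rmod_elim v :=
  move: v => [[[[? ?] [? ?]] [[[? ?] [? ?]] ?]] [[[? ?] [? ?]] [[? ?] ?]]].

Ltac massey_elim a := move: a => [[[? ?] [? ?]] [? ?]].

Fact rmod_scaleA a b v : rmod_scale a (rmod_scale b v) = rmod_scale (a * b) v.
Proof. by pairs. Qed.
Fact rmod_scale1 : left_id 1 rmod_scale.
Proof. move=> v; rmod_elim v; by pairs. Qed.
Fact rmod_scaleDr : right_distributive rmod_scale +%R.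
Proof. by move=> a u v; pairs. Qed.
Fact rmod_scaleDl v : {morph rmod_scale^~ v : a b / a + b}.
Proof. by move=> a b; pairs. Qed.
HB.instance Definition _ := GRing.Zmodule_isLmodule.Build A rmod_car
  rmod_scaleA rmod_scale1 rmod_scaleDr rmod_scaleDl.

Definition rmod_cmp (n : int) (v : rmod_car) : rmod_car :=
  ((if n == 0 then v.1.1 else 0, if n == -1 then v.1.2 else 0),
   (if n == -2 then v.2.1 else 0, if n == -3 then v.2.2 else 0)).

(** The value d (x m_2) = x^2 m_1 = z m_0 is nonzero: this is the Massey product that obstructs d
    m_3 = x m_2, and n corrects it. *)
Definition rmod_dif (v : rmod_car) : rmod_car :=
  rel 0 0 (m1 v) (em0 v) 0 (xm2 v + nn v) 0 (m2 v) 0 0 (m3 v) 0 (- m3 v) 0 0 0.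

Fact rmod_cmpD n : {morph rmod_cmp n : x y / x + y}.
Proof.
by move=> u v; congr pair; congr pair; rewrite /=; case: (n == _); rewrite ?addr0.
Qed.

Fact rmod_difD : {morph rmod_dif : x y / x + y}.
Proof. by move=> u v; pairs. Qed.

Fact rmod_cmp_cmp m n v : rmod_cmp m (rmod_cmp n v) = if m == n then rmod_cmp n v else 0.
Proof.
have [->|mn] := eqVneq m n.
  by congr pair; congr pair; rewrite /=; case: (n == _).
have E (k : int) (V : zmodType) (u : V) : (if m == k then if n == k then u else 0 else 0) = 0.
  by case: (eqVneq m k) => [<-|//]; rewrite eq_sym (negPf mn).
by congr pair; congr pair; rewrite /= E.
Qed.

Fact rmod_cmp_sum v : exists s : seq int, uniq s /\ v = \sum_(n <- s) rmod_cmp n v.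
Proof.
exists [:: 0; -1; -2; -3]; split=> //.
rewrite !big_cons big_nil; move: v => [[? ?] [? ?]].
by congr pair; congr pair; rewrite /= ?(addr0, add0r).
Qed.

Fact rmod_dif_cmp n v : rmod_cmp (n + 1) (rmod_dif v) = rmod_dif (rmod_cmp n v).
Proof.
rmod_elim v.
have [->|n0] := eqVneq n 0; first by pairs.
have [->|n1] := eqVneq n (-1); first by pairs.
have [->|n2] := eqVneq n (-2); first by pairs.
have [->|n3] := eqVneq n (-3); first by pairs.
rewrite /rmod_cmp (negPf n0) (negPf n1) (negPf n2) (negPf n3).
have -> : (n + 1 == 0) = false by lia.
have -> : (n + 1 == -1) = false by lia.
have -> : (n + 1 == -2) = false by lia.
by case: (n + 1 == -3); pairs.
Qed.

Fact rmod_dif_dif v : rmod_dif (rmod_dif v) = 0.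
Proof. by rmod_elim v; pairs. Qed.

Definition rmod_st : dgstruct rmod_car :=
  DGStruct rmod_cmpD rmod_cmp_cmp rmod_cmp_sum rmod_difD rmod_dif_cmp rmod_dif_dif.

Lemma rmod_homogP n v : homog rmod_st n v ->
  [\/ v = 0, n = 0 /\ v = ((v.1.1, 0), 0) , n = -1 /\ v = ((0, v.1.2), 0)
   | n = -2 /\ v = (0, (v.2.1, 0)) \/ n = -3 /\ v = (0, (0, v.2.2))].
Proof.
move=> hv; have e : v = rmod_cmp n v := esym hv; rewrite /rmod_cmp in e.
have [n0|n0] := eqVneq n 0; first by constructor 2; rewrite {1}e n0.
have [n1|n1] := eqVneq n (-1); first by constructor 3; rewrite {1}e n1.
have [n2|n2] := eqVneq n (-2); first by constructor 4; left; rewrite {1}e n2.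
have [n3|n3] := eqVneq n (-3); first by constructor 4; right; rewrite {1}e n3.
by constructor 1; rewrite e (negPf n0) (negPf n1) (negPf n2) (negPf n3).
Qed.

Fact rmod_scale_homog i j (a : A) v :
  homog sA i a -> homog rmod_st j v -> homog rmod_st (i + j) (a *: v).
Proof.
move=> /tt_homogP ha /rmod_homogP hv.
case: ha => [[-> ->]|[-> ->]|->]; last by rewrite scale0r; apply: homog0.
  case: hv => [->|[-> ->]|[-> ->]|[[-> ->]|[-> ->]]]; rewrite ?scaler0; first exact: homog0;
  massey_elim a; rmod_elim v; by pairs.
case: hv => [->|[-> ->]|[-> ->]|[[-> ->]|[-> ->]]]; rewrite ?scaler0; first exact: homog0;
massey_elim a; rmod_elim v; by pairs.
Qed.

Fact rmod_leibniz i (a : A) v : homog sA i a ->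
  dif rmod_st (a *: v) = dif sA a *: v + (-1) ^+ `|i|%N *: (a *: dif rmod_st v).
Proof.
move=> /tt_homogP ha; rewrite scale_sign.
case: ha => [[-> ->]|[-> ->]|->]; rewrite ?[odd _]/=.
- massey_elim a; rmod_elim v; by pairs.
- massey_elim a; rmod_elim v; by pairs.
- by case: (odd _); pairs.
Qed.

Definition rmod : dgmod A := DGMod rmod_scale_homog rmod_leibniz.

End SecondExampleResolution.

Lemma homotopic_restr0 (A B : dgring) (psi : dgrhom A B) (M : dgmod A) (N : dgmod B)
  (f : dghom M (restr_dgmod psi N)) (h : M -> N) :
  graded_hom (-1) (h : M -> restr_dgmod psi N) ->
  (forall x, f x = dif (dgm_st N) (h x) + h (dif (dgm_st M) x) :> N) ->
  homotopic f (dghom0 M (restr_dgmod psi N)).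
Proof. by move=> hh e; exists h => // x; rewrite subr0 hom_difN1; apply: e. Qed.

Section SecondExampleComparison.
Variable F : fieldType.
Local Notation A := (massey F).
Local Notation H := (H0 A).
Local Notation rmod := (rmod F).
Local Notation rmod_st := (rmod_st F).

Local Notation m0 v := (v.1.1.1.1) (only parsing).
Local Notation xm0 v := (v.1.1.1.2) (only parsing).
Local Notation ym0 v := (v.1.1.2.1) (only parsing).
Local Notation wm0 v := (v.1.1.2.2) (only parsing).
Local Notation em0 v := (v.1.2.1.1.1) (only parsing).
Local Notation zm0 v := (v.1.2.1.1.2) (only parsing).
Local Notation m1 v := (v.1.2.1.2.1) (only parsing).
Local Notation xm1 v := (v.1.2.1.2.2) (only parsing).
Local Notation ym1 v := (v.1.2.2) (only parsing).
Local Notation m2 v := (v.2.1.1.1) (only parsing).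
Local Notation xm2 v := (v.2.1.1.2) (only parsing).
Local Notation ym2 v := (v.2.1.2.1) (only parsing).
Local Notation nn v := (v.2.1.2.2) (only parsing).
Local Notation m3 v := (v.2.2.1.1) (only parsing).
Local Notation xm3 v := (v.2.2.1.2) (only parsing).
Local Notation ym3 v := (v.2.2.2) (only parsing).

Local Notation G4 := 'I_4.

Definition rmod_coef (v : rmod_car F) (i : G4) : H :=
  match val i with
  | 0 => hel (m0 v) (xm0 v) (ym0 v)
  | 1 => hel (m1 v) (xm1 v) (ym1 v)
  | 2 => hel (m2 v) (xm2 v) (ym2 v)
  | _ => hel (m3 v) (xm3 v) (ym3 v)
  end.

Lemma rmod_coefD u v i : rmod_coef (u + v) i = rmod_coef u i + rmod_coef v i.
Proof. by rewrite /rmod_coef; case: (val i) => [|[|[|k]]]; rewrite helD. Qed.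

Lemma rmod_coefZ (a : A) v i : rmod_coef (rmod_scale a v) i = piH A a * rmod_coef v i.
Proof.
rewrite piH_hel /rmod_coef /rmod_scale /rel /=.
by case: (val i) => [|[|[|k]]]; rewrite helM.
Qed.

Lemma rmod_coef_cmp n v i :
  rmod_coef (rmod_cmp n v) i = cmp (dgr_st H) (n - kdeg i) (rmod_coef v i).
Proof.
rewrite /= /conc_cmp subr_eq0 /kdeg /rmod_coef /rmod_cmp.
by case: i => [[|[|[|[|k]]]] lt] //=; case: (n == _); rewrite // hel0.
Qed.

Lemma rmod_coef_dif v i : rmod_coef (rmod_dif v) i =
  match val i with
  | 0 => rmod_coef v (@Ordinal 4 1 isT) * hel 0 0 1
  | 1 => rmod_coef v (@Ordinal 4 2 isT) * hel 0 1 0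
  | 2 => rmod_coef v (@Ordinal 4 3 isT) * hel 0 1 0
  | _ => 0
  end.
Proof.
rewrite /rmod_coef /rmod_dif /rel /=.
by case: i => [[|[|[|[|k]]]] lt] //=; rewrite ?helM ?(mulr0, mul0r, addr0, add0r, mulr1, hel0).
Qed.

Fact rmod_map_subproof v : exists s : seq G4, forall i, i \notin s -> rmod_coef v i = 0.
Proof. by exists (enum G4) => i; rewrite mem_enum. Qed.

Definition rmod_map_fun (v : rmod_car F) : free H G4 := Free (rmod_map_subproof v).

Lemma coef_rmod_map v i : coef (rmod_map_fun v) i = rmod_coef v i. Proof. by []. Qed.

Lemma rmod_mapD : {morph rmod_map_fun : u v / u + v}.
Proof. by move=> u v; apply: free_ext => i; rewrite coefD !coef_rmod_map rmod_coefD. Qed.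

Lemma rmod_mapZ (a : A) v : rmod_map_fun (rmod_scale a v) = piH A a *: rmod_map_fun v.
Proof. by apply: free_ext => i; rewrite coefZ !coef_rmod_map rmod_coefZ. Qed.

Lemma rmod_map_cmp n v : rmod_map_fun (rmod_cmp n v) = free_cmp kdeg n (rmod_map_fun v).
Proof. by apply: free_ext => i; rewrite coef_cmp !coef_rmod_map rmod_coef_cmp. Qed.

Lemma rmod_map_dif v : rmod_map_fun (rmod_dif v) = free_dif (kdelta F) (rmod_map_fun v).
Proof. by apply: free_ext => i; rewrite kmod_dif !coef_rmod_map rmod_coef_dif. Qed.

Definition rmod_map : dghom rmod (restr_dgmod (piH A) (kmod F)) :=
  @DGHom A rmod (restr_dgmod (piH A) (kmod F)) rmod_map_fun
    rmod_mapD rmod_mapZ rmod_map_cmp rmod_map_dif.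

(** The kernel is spanned by x^2 m_0, e m_0, z m_0 and n, and splits into the acyclic pairs d (e
    m_0) = x^2 m_0 and d n = z m_0. *)
Lemma rmod_map_qis : dg_qis rmod_map.
Proof.
apply: surj_acyclic_ker_qis => [y|n v [hv dv] t0].
  pose c i := coef (y : kmod F) i.
  have E (j k : G4) : val j = val k -> c j = c k by move=> /val_inj ->.
  have [a0 [a1 [a2 e0]]] := hel_surj (c (@Ordinal 4 0 isT)).
  have [b0 [b1 [b2 e1]]] := hel_surj (c (@Ordinal 4 1 isT)).
  have [c0 [c1 [c2 e2]]] := hel_surj (c (@Ordinal 4 2 isT)).
  have [d0 [d1 [d2 e3]]] := hel_surj (c (@Ordinal 4 3 isT)).
  exists (rel a0 a1 a2 0 0 0 b0 b1 b2 c0 c1 c2 0 d0 d1 d2).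
  apply: free_ext => i; rewrite [RHS]coef_rmod_map /rmod_coef.
  case: i => [[|[|[|[|k]]]] lt] //=; rewrite -?e0 -?e1 -?e2 -?e3;
    exact: (E (Ordinal lt)).
have ti i : rmod_coef v i = 0 by have := congr1 (fun f => coef (f : kmod F) i) t0.
have /hel_eq0[p1 p2 p3] := ti (@Ordinal 4 0 isT).
have /hel_eq0[q1 q2 q3] := ti (@Ordinal 4 1 isT).
have /hel_eq0[r1 r2 r3] := ti (@Ordinal 4 2 isT).
have /hel_eq0[s1 s2 s3] := ti (@Ordinal 4 3 isT).
pose z := rel 0 0 0 0 (wm0 v) 0 0 0 0 0 0 0 (zm0 v) 0 0 0.
have tz : rmod_map_fun z = 0.
  apply: free_ext => i; rewrite coef_rmod_map /rmod_coef /=.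
  by case: (val i) => [|[|[|k]]]; apply: hel0.
exists (cmp rmod_st (n - 1) z); split; first exact: homog_cmp.
  apply: (etrans (rmod_map_cmp (n - 1) z)); rewrite tz; exact: morph0 (free_cmpD _ _).
rewrite -dif_cmpE -[LHS]hv; congr (cmp _ n _).
have e1 : em0 v = 0 := congr1 (fun u : rmod_car F => wm0 u) dv.
have e2 : xm2 v + nn v = 0 := congr1 (fun u : rmod_car F => zm0 u) dv.
rewrite r2 add0r in e2.
have -> : v = rel (m0 v) (xm0 v) (ym0 v) (wm0 v) (em0 v) (zm0 v) (m1 v) (xm1 v) (ym1 v)
    (m2 v) (xm2 v) (ym2 v) (nn v) (m3 v) (xm3 v) (ym3 v).
  by case: (v : rmod_car F) => [[[[? ?] [? ?]] [[[? ?] [? ?]] ?]] [[[? ?] [? ?]] [[? ?] ?]]].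
rewrite p1 p2 p3 e1 q1 q2 q3 r1 r2 r3 e2 s1 s2 s3.
by rewrite [RHS]/= /rmod_dif /rel /= add0r oppr0.
Qed.

(** Since [phi] sends m_3 to y and d m_3 = x m_2 - n, sending n to -y and all else to 0 gives a
    null-homotopy. Linearity holds because x and y kill n and also kill y in H. *)
Definition null_fun (v : rmod_car F) : free H unit := fbase (hel 0 0 (- nn v)) tt.

Lemma null_funD : {morph null_fun : u v / u + v}.
Proof. by move=> u v; rewrite /null_fun -fbaseD helD !addr0 -opprD. Qed.

Lemma null_funZ (a : A) v : null_fun (rmod_scale a v) = piH A a *: null_fun v.
Proof.
by rewrite piH_hel /null_fun fbaseZ helM !(mulr0, add0r, addr0) mulrN.
Qed.

Lemma null_fun_cmp k v :
  free_cmp (fun=> -3) (k + -1) (null_fun v) = null_fun (rmod_cmp k v).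
Proof.
rewrite /null_fun free_cmp_base /= /conc_cmp.
have -> : (k + -1 - -3 == 0) = (k == -2) by lia.
by case: (k == -2); rewrite //= oppr0 hel0.
Qed.

Lemma null_fun_graded :
  graded_hom (-1) (null_fun : rmod -> restr_dgmod (piH A) (ntop F)).
Proof.
apply/graded_homP; split=> [|k v|a v].
- exact: null_funD.
- exact: null_fun_cmp.
- apply: (etrans (null_funZ a v)); rewrite -(piH_twist (par (-1)) a); reflexivity.
Qed.

Lemma null_fun_homotopy v : phi_fun (rmod_map_fun v) =
  dif (dgm_st (ntop F)) (null_fun v) + null_fun (rmod_dif v) :> ntop F.
Proof.
rewrite ntop_dif add0r.
rewrite /phi_fun coef_rmod_map /rmod_coef /= helM /null_fun /rmod_dif /rel /=.
by rewrite !(mulr0, mul0r, addr0, add0r, mulr1) opprK.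
Qed.

Lemma phi_map_null : homotopic (dghom_comp (restr_hom (piH A) (phi F)) rmod_map)
  (dghom0 rmod (restr_dgmod (piH A) (ntop F))).
Proof.
exact (@homotopic_restr0 A H (piH A) rmod (ntop F)
  (dghom_comp (restr_hom (piH A) (phi F)) rmod_map) null_fun
  null_fun_graded null_fun_homotopy).
Qed.

Lemma massey_not_faithful : ~ faithful (forgetful A).
Proof.
move=> fS; apply: (@phi_neq0 F); apply: fS.
apply: (iso_epi (Dl_iso rmod_map_qis)).
apply: heq_trans (heq_sym (Dl_comp _ _)) _; apply: heq_trans (Dl_homotopic phi_map_null) _.
by apply: heq_sym; apply: heq_trans (heq_sym (Dl_comp _ _)) _; apply: Dl_eq.
Qed.

End SecondExampleComparison.

Lemma massey_noetherian : dg_noetherian (massey 'F_2).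
Proof.
pose T : finType := ((('F_2 * 'F_2) * ('F_2 * 'F_2)) * ('F_2 * 'F_2))%type.
apply: (@finite_dg_noetherian (massey 'F_2) _ (fun i : 'I_#|T| => enum_val i)).
by move=> x; exists (enum_rank (x : T)); rewrite enum_rankK.
Qed.

Lemma massey_not_equiv (F : fieldType) : ~ equiv_H0 (massey F).
Proof.
apply: (@two_term_not_equiv _ _ _ _ _ _ ((0, 1) : ez_car F)) => [|/(congr1 snd)/eqP].
  by [].
by rewrite /= oner_eq0.
Qed.

Theorem theorem1 :
  (forall A : dgring,
     (forall F : functor (Dcat A) (Dcat (H0 A)), is_reduction F ->
        (full F <-> equiv_H0 A) /\ (faithful F <-> equiv_H0 A)) /\
     (forall G : functor (Dcat A) (Dcat (H0 A)), is_coreduction G ->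
        (full G <-> equiv_H0 A) /\ (faithful G <-> equiv_H0 A)) /\
     (full (forgetful A) <-> equiv_H0 A)) /\
  (exists A : dgring,
     ~ equiv_H0 A /\ faithful (forgetful A) /\
     dg_commutative A /\ dg_noetherian A /\ bounded_cohomology A) /\
  (exists A : dgring,
     ~ equiv_H0 A /\ ~ faithful (forgetful A) /\
     dg_commutative A /\ dg_noetherian A /\ bounded_cohomology A).
Proof.
split; [move=> A; split; [|split]|split].
- move=> F [eps [nat res]]; split; split.
  + exact: reduction_full_conv nat res.
  + exact: reduction_full nat res.
  + exact: reduction_faithful_conv nat res.
  + exact: reduction_faithful nat res.
- move=> G [eta [nat res]]; split; split.
  + exact: coreduction_full_conv nat res.
  + exact: coreduction_full nat res.
  + exact: coreduction_faithful_conv nat res.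
  + exact: coreduction_faithful nat res.
- by split=> [|qA]; [apply: forgetful_full_conv|apply: forgetful_full].
- exists dual_numbers; split; first exact: dual_numbers_not_equiv.
  split; first exact: dual_numbers_faithful.
  split; first exact: two_term_commutative.
  split; [exact: dual_numbers_noetherian|exact: two_term_bounded].
exists (massey 'F_2); split; first exact: massey_not_equiv.
split; first exact: massey_not_faithful.
split; first exact: two_term_commutative.
split; [exact: massey_noetherian|exact: two_term_bounded].
Qed.
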